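(* Let $V:S^1\to\mathbb{R}$ be of class $C^{k-1,1}(S^1)$ for some integer $k\ge 1$, and let $\phi(\theta)=e^{-V(\theta)}$. Let $\pi_n(z)$ be the monic polynomial of degree $n$ orthogonal with respect to $\phi$ on the unit circle. Then for each fixed integer $p\ge 0$ and each $\rho>1$ there is a constant $K_{p,\rho}>0$ such that \[ \sup_{|z|\ge\rho}\left|\frac{d^p}{dz^p}\left[\pi_n(z)z^{-n}e^{-N(z)}-1\right]\right|\le K_{p,\rho}\frac{\log(n)}{n^{2k}} \] for all sufficiently large $n$.
   Context: $C^{k-1,1}(S^1)$ denotes functions on the circle whose $2\pi$-periodic extension has $k-1$ Lipschitz continuous derivatives. The inner product is $\langle f,g\rangle_\phi=\frac{1}{2\pi}\int_{-\pi}^{\pi}f(\theta)\overline{g(\theta)}\phi(\theta)\,d\theta$, polynomials being evaluated at $z=e^{i\theta}$; $\pi_n$ is the monic degree-$n$ polynomial with $\langle \pi_n,z^j\rangle_\phi=0$ for $0\le j<n$. With Fourier coefficients $V_j=\frac{1}{2\pi}\int_{-\pi}^{\pi}V(\theta)e^{-ij\theta}d\theta$, define $N(z)=\sum_{j=1}^\infty V_{-j}z^{-j}$ for $|z|\ge 1$. *)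

(* Defs.v *)
From Stdlib Require Import Reals.
From Coquelicot Require Import Coquelicot.
Open Scope R_scope.

Notation CC := Complex.C.

Definition cexp (z : CC) : CC :=
  (exp (fst z) * cos (snd z), exp (fst z) * sin (snd z)).

Definition eit (t : R) : CC := (cos t, sin t).

Definition cpow (z : CC) (m : nat) : CC := pow_n (K := C_Ring) z m.

Definition C_lip_periodic (k : nat) (V : R -> R) : Prop :=
  (forall t, V (t + 2 * PI) = V t) /\
  (forall j, (j <= k - 1)%nat -> forall t, ex_derive_n V j t) /\
  (exists L, forall s t,
      Rabs (Derive_n V (k - 1) s - Derive_n V (k - 1) t) <= L * Rabs (s - t)).

Definition weight (V : R -> R) (t : R) : R := exp (- V t).

Definition inner (V : R -> R) (f g : CC -> CC) : CC :=
  Cmult (RtoC (/ (2 * PI)))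
    (RInt (V := C_R_CompleteNormedModule)
       (fun t => Cmult (Cmult (f (eit t)) (Cconj (g (eit t)))) (RtoC (weight V t)))
       (- PI) PI).

Definition poly_eval (n : nat) (c : nat -> CC) (z : CC) : CC :=
  sum_n (G := C_AbelianMonoid) (fun m => Cmult (c m) (cpow z m)) n.

Definition is_monic_OPUC (V : R -> R) (n : nat) (c : nat -> CC) : Prop :=
  c n = RtoC 1 /\
  forall j, (j < n)%nat -> inner V (poly_eval n c) (fun z => cpow z j) = RtoC 0.

Definition fourier (V : R -> R) (j : Z) : CC :=
  Cmult (RtoC (/ (2 * PI)))
    (RInt (V := C_R_CompleteNormedModule)
       (fun t => Cmult (RtoC (V t)) (eit (- IZR j * t))) (- PI) PI).

Definition Nfun (V : R -> R) (z : CC) : CC :=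
  let a := fun m : nat =>
    Cmult (fourier V (- Z.of_nat (S m))) (Cinv (cpow z (S m))) in
  (Series (fun m => fst (a m)), Series (fun m => snd (a m))).

Definition deriv_chain (f : CC -> CC) (p : nat) (g : nat -> CC -> CC) : Prop :=
  g O = f /\
  forall j, (j < p)%nat -> forall z, 1 < Cmod z ->
    is_derive (K := C_AbsRing) (V := C_NormedModule) (g j) z (g (S j) z).

(* Main.v *)
Require Import Defs.
From Stdlib Require Import Reals Lra Lia Arith Factorial.
From Coquelicot Require Import Coquelicot.
Open Scope R_scope.

(** Put [w = 1/z] and [A(w) = N(1/w)], so that [V = V_0 + A + conj A] and the weight is
    [e^(-V_0) |D|^2] on the circle, with [D = e^(-A)] and inverse [E = e^A].  The reversed
    polynomial [q(w) = z^(-n) pi_n(z)] satisfies [q(0) = 1], and orthogonality says that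
    [f = q D - 1] is orthogonal in [L^2] of the circle to [w^l D] for [1 <= l <= n].
    Let [E_M] be the Taylor polynomial of [E] of degree [M].  Since [V] is [C^(k-1,1)],
    Bessel's inequality for the [k]-th differences of [V] gives
    [sum j^(2k) |V_j|^2 < oo]; this property passes to the coefficients of [E], so that
    [||1 - E_M D|| = O(M^(-k))].  Comparing [q] with [E_n] yields [||f|| = O(n^(-k))], and
    the [m]-th coefficient of [f] equals [<f, w^m> = <f, w^m (1 - E_(n-m) D)>], which is
    [O(n^(-k) (n-m)^(-k)) = O((m+1)^k n^(-2k))].  Summing the differentiated Laurent series
    of [f] on [|z| >= rho] then gives the estimate, even without the logarithm. *)

(** Pointwise decay [V_j = O(j^-k)] would lose a factor [sqrt M] in the [L^2] tail of [E], hence the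
    square-summable form. It is obtained from differences because the [k]-th derivative of [V] need
    not exist everywhere. It is paired with absolute summability so that both together survive
    products, hence exponentials.

    The orthogonality has two sources. [<q D, w^l D>] equals [e^(V_0) <pi_n, z^(n-l)>_phi], which
    vanishes since [n - l < n]; and [<1, w^l D>] vanishes since [w^l D] is a power series in [w]
    without constant term.

    Comparing [q] with [E_n] is a projection argument: both have constant term 1, so their
    difference times [D] is a combination of the [w^l D] with [1 <= l <= n] and is orthogonal to
    [f]. The rate doubles because [w^m E_(n-m)] also has all its exponents between [m] and [n]. The
    inequality [n + 1 <= (m + 1) (n - m + 1)] then trades the rate in [n - m] for one in [n], at the
    price of a power of [m + 1], which [rho^(-m)] absorbs. *)

(** * The modulus of complex numbers *)

Lemma Cmod_fst (z : CC) : Rabs (fst z) <= Cmod z.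
Proof. eapply Rle_trans; [apply Rmax_l | apply Rmax_Cmod]. Qed.

Lemma Cmod_snd (z : CC) : Rabs (snd z) <= Cmod z.
Proof. eapply Rle_trans; [apply Rmax_r | apply Rmax_Cmod]. Qed.

Lemma Cmod_le_abs (z : CC) : Cmod z <= Rabs (fst z) + Rabs (snd z).
Proof.
  destruct z as [x y]; simpl.
  replace (x, y) with (RtoC x + Ci * RtoC y)%C.
  - eapply Rle_trans; [apply Cmod_triangle|].
    rewrite Cmod_mult, Cmod_Ci, !Cmod_R; lra.
  - unfold Ci, RtoC, Cplus, Cmult; simpl; f_equal; ring.
Qed.

Lemma Cmod_sqr (z : CC) : Cmod z ^ 2 = fst z ^ 2 + snd z ^ 2.
Proof. exact (Cmod2_alt z). Qed.

Lemma Cmod_sym (x y : CC) : Cmod (x - y) = Cmod (y - x).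
Proof. rewrite <- Cmod_opp; f_equal; ring. Qed.

Lemma Cmod_dist_triangle (x y z : CC) : Cmod (x - z) <= Cmod (x - y) + Cmod (y - z).
Proof. replace (x - z)%C with ((x - y) + (y - z))%C by ring; apply Cmod_triangle. Qed.

Lemma C_eq_of_dist (x y : CC) : (forall eps, 0 < eps -> Cmod (x - y) <= eps) -> x = y.
Proof.
  intros H.
  assert (H0 : Cmod (x - y) = 0).
  { apply Rle_antisym; [|apply Cmod_ge_0].
    apply le_epsilon; intros e He; rewrite Rplus_0_l; apply H, He. }
  apply Cmod_eq_0 in H0.
  replace x with ((x - y) + y)%C by ring; rewrite H0; ring.
Qed.

(** * Finite sums *)

Fixpoint csum (a : nat -> CC) (n : nat) : CC :=
  match n with
  | O => a O
  | S m => (csum a m + a (S m))%C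
  end.

Lemma csum_sum_n (a : nat -> CC) n : sum_n (G := C_AbelianMonoid) a n = csum a n.
Proof.
  induction n as [|n IH]; simpl.
  - apply sum_O.
  - rewrite sum_Sn, IH; reflexivity.
Qed.

Lemma csum_ext (a b : nat -> CC) n :
  (forall j, (j <= n)%nat -> a j = b j) -> csum a n = csum b n.
Proof.
  induction n as [|n IH]; intros H; simpl; [apply H; lia|].
  rewrite IH, H; auto.
Qed.

Lemma csum_plus (a b : nat -> CC) n :
  csum (fun j => a j + b j)%C n = (csum a n + csum b n)%C.
Proof. induction n as [|n IH]; simpl; [|rewrite IH]; ring. Qed.

Lemma csum_minus (a b : nat -> CC) n :
  csum (fun j => a j - b j)%C n = (csum a n - csum b n)%C.
Proof. induction n as [|n IH]; simpl; [|rewrite IH]; ring. Qed.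

Lemma csum_scal (c : CC) (a : nat -> CC) n :
  csum (fun j => c * a j)%C n = (c * csum a n)%C.
Proof. induction n as [|n IH]; simpl; [|rewrite IH]; ring. Qed.

Lemma csum_0 (a : nat -> CC) n : (forall j, (j <= n)%nat -> a j = RtoC 0) -> csum a n = RtoC 0.
Proof.
  induction n as [|n IH]; intros H; simpl; [apply H; lia|].
  rewrite IH, H by auto; ring.
Qed.

Lemma csum_shift (a : nat -> CC) n :
  csum a (S n) = (a O + csum (fun j => a (S j)) n)%C.
Proof. induction n as [|n IH]; simpl in *; [|rewrite IH]; ring. Qed.

Lemma csum_rev (a : nat -> CC) n : csum a n = csum (fun j => a (n - j)%nat) n.
Proof.
  induction n as [|n IH]; [reflexivity|].
  rewrite (csum_shift (fun j => a (S n - j)%nat)); simpl csum; rewrite IH.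
  replace (S n - 0)%nat with (S n) by lia.
  rewrite Cplus_comm; f_equal.
Qed.

Lemma csum_extend (a : nat -> CC) n m :
  (n <= m)%nat -> (forall j, (n < j)%nat -> a j = RtoC 0) -> csum a m = csum a n.
Proof.
  intros Hnm H; induction Hnm as [|m Hnm IH]; [reflexivity|].
  simpl; rewrite IH, H by lia; ring.
Qed.

Lemma csum_swap (F : nat -> nat -> CC) n m :
  csum (fun i => csum (fun j => F i j) m) n = csum (fun j => csum (fun i => F i j) n) m.
Proof.
  induction n as [|n IH]; simpl; [reflexivity|].
  rewrite IH, <- csum_plus; reflexivity.
Qed.

Lemma csum_conj (a : nat -> CC) n : Cconj (csum a n) = csum (fun j => Cconj (a j)) n.
Proof. induction n as [|n IH]; simpl; [|rewrite Cplus_conj, IH]; reflexivity. Qed.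

Lemma csum_fst (a : nat -> CC) n : fst (csum a n) = sum_f_R0 (fun j => fst (a j)) n.
Proof. induction n as [|n IH]; simpl; [|rewrite IH]; reflexivity. Qed.

Lemma csum_snd (a : nat -> CC) n : snd (csum a n) = sum_f_R0 (fun j => snd (a j)) n.
Proof. induction n as [|n IH]; simpl; [|rewrite IH]; reflexivity. Qed.

Lemma Cmod_csum (a : nat -> CC) n : Cmod (csum a n) <= sum_f_R0 (fun j => Cmod (a j)) n.
Proof.
  induction n as [|n IH]; simpl; [lra|].
  eapply Rle_trans; [apply Cmod_triangle|]; lra.
Qed.

Lemma sum_nonneg (x : nat -> R) n : (forall j, 0 <= x j) -> 0 <= sum_f_R0 x n.
Proof. intros H; apply cond_pos_sum, H. Qed.

Lemma sum_mono (x : nat -> R) n m :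
  (forall j, 0 <= x j) -> (n <= m)%nat -> sum_f_R0 x n <= sum_f_R0 x m.
Proof.
  intros H Hnm; induction Hnm as [|m Hnm IH]; [lra|].
  simpl; specialize (H (S m)); lra.
Qed.

Lemma sum_scal_l (c : R) (x : nat -> R) n :
  sum_f_R0 (fun j => c * x j) n = c * sum_f_R0 x n.
Proof. induction n as [|n IH]; simpl; [|rewrite IH]; ring. Qed.

Lemma sum_swap (F : nat -> nat -> R) n m :
  sum_f_R0 (fun i => sum_f_R0 (fun j => F i j) m) n
  = sum_f_R0 (fun j => sum_f_R0 (fun i => F i j) n) m.
Proof.
  induction n as [|n IH]; simpl; [reflexivity|].
  rewrite IH, <- plus_sum; reflexivity.
Qed.

(** The Cauchy-Schwarz inequality with the squares [b], [q] of the two factors as data, so that no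
    square roots of weights have to be taken. *)
Lemma sum_cauchy_schwarz (y b q : nat -> R) n :
  (forall i, 0 <= b i) -> (forall i, 0 <= q i) ->
  (forall i, (i <= n)%nat -> y i ^ 2 <= b i * q i) ->
  sum_f_R0 y n ^ 2 <= sum_f_R0 b n * sum_f_R0 q n.
Proof.
  intros Hb Hq; induction n as [|n IH]; intros H; simpl sum_f_R0; [apply H; lia|].
  assert (IH' := IH (fun i Hi => H i (le_S _ _ Hi))).
  assert (Hn := H (S n) (le_n _)).
  pose proof (sum_nonneg b n Hb) as HB; pose proof (sum_nonneg q n Hq) as HQ.
  specialize (Hb (S n)); specialize (Hq (S n)).
  set (Y := sum_f_R0 y n) in *; set (B := sum_f_R0 b n) in *.
  set (Q := sum_f_R0 q n) in *; set (y1 := y (S n)) in *.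
  set (b1 := b (S n)) in *; set (q1 := q (S n)) in *.
  assert (Hs : 0 <= B * q1 + b1 * Q) by nra.
  (* The cross term: its square is at most [4 (B q1) (b1 Q)], hence at most [(B q1 + b1 Q) ^ 2]. *)
  assert (2 * (Y * y1) <= B * q1 + b1 * Q).
  { apply Rsqr_incr_0_var; [|exact Hs].
    assert (H1 : (Y ^ 2) * (y1 ^ 2) <= (B * Q) * (b1 * q1)).
    { apply Rmult_le_compat; nra. }
    unfold Rsqr. pose proof (Rle_0_sqr (B * q1 - b1 * Q)) as H2; unfold Rsqr in H2.
    nra. }
  nra.
Qed.

(** * Convolutions *)

Definition conv (a b : nat -> CC) (n : nat) : CC :=
  csum (fun i => a i * b (n - i)%nat)%C n.

Definition rconv (x y : nat -> R) (n : nat) : R :=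
  sum_f_R0 (fun i => x i * y (n - i)%nat) n.

Lemma sum_rconv (x y : nat -> R) n :
  sum_f_R0 (rconv x y) n = sum_f_R0 (fun i => x i * sum_f_R0 y (n - i)) n.
Proof.
  induction n as [|n IH]; [reflexivity|].
  simpl sum_f_R0 at 1; rewrite IH; unfold rconv; simpl.
  rewrite Nat.sub_diag, <- Rplus_assoc, <- plus_sum; simpl; f_equal.
  apply sum_eq; intros i Hi.
  replace (match i with 0%nat => S n | S l => (n - l)%nat end) with (S (n - i)) by (destruct i; lia).
  simpl; ring.
Qed.

Lemma sum_rconv_le (x y : nat -> R) n :
  (forall i, 0 <= x i) -> (forall i, 0 <= y i) ->
  sum_f_R0 (rconv x y) n <= sum_f_R0 x n * sum_f_R0 y n.
Proof.
  intros Hx Hy; rewrite sum_rconv, Rmult_comm, scal_sum.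
  apply sum_Rle; intros i Hi; apply Rmult_le_compat_l; [apply Hx|].
  apply sum_mono; [apply Hy|lia].
Qed.

Lemma rconv_nonneg (x y : nat -> R) n :
  (forall i, 0 <= x i) -> (forall i, 0 <= y i) -> 0 <= rconv x y n.
Proof. intros Hx Hy; apply sum_nonneg; intros; apply Rmult_le_pos; auto. Qed.

(** The bound of [l^1 * l^2] in [l^2]: Cauchy-Schwarz with weight [x] gives
    [(x * y)_j ^ 2 <= (sum x) (x * y^2)_j], and summing over [j] costs a second factor [sum x]. *)
Lemma young_ineq (x y : nat -> R) n :
  (forall i, 0 <= x i) -> (forall i, 0 <= y i) ->
  sum_f_R0 (fun j => rconv x y j ^ 2) n
  <= sum_f_R0 x n ^ 2 * sum_f_R0 (fun j => y j ^ 2) n.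
Proof.
  intros Hx Hy.
  apply Rle_trans with (sum_f_R0 (fun j => rconv x (fun i => y i ^ 2) j * sum_f_R0 x n) n).
  - apply sum_Rle; intros j Hj.
    apply Rle_trans with (sum_f_R0 x j * rconv x (fun i => y i ^ 2) j).
    + apply sum_cauchy_schwarz; auto.
      * intros i; apply Rmult_le_pos; [auto|apply pow2_ge_0].
      * intros i _; right; ring.
    + rewrite Rmult_comm; apply Rmult_le_compat_l.
      * apply rconv_nonneg; auto; intros; apply pow2_ge_0.
      * apply sum_mono; auto.
  - rewrite <- scal_sum.
    replace (sum_f_R0 x n ^ 2) with (sum_f_R0 x n * sum_f_R0 x n) by ring.
    rewrite Rmult_assoc; apply Rmult_le_compat_l; [apply sum_nonneg, Hx|].
    apply sum_rconv_le; auto; intros; apply pow2_ge_0.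
Qed.

Lemma Cmod_conv (a b : nat -> CC) n :
  Cmod (conv a b n) <= rconv (fun i => Cmod (a i)) (fun i => Cmod (b i)) n.
Proof.
  unfold conv, rconv; eapply Rle_trans; [apply Cmod_csum|].
  right; apply sum_eq; intros; apply Cmod_mult.
Qed.

(** * Absolutely convergent complex series *)

Definition clim (s : nat -> CC) (l : CC) : Prop :=
  forall eps, 0 < eps -> exists N, forall n, (N <= n)%nat -> Cmod (s n - l) <= eps.

Lemma clim_unique (s : nat -> CC) l1 l2 : clim s l1 -> clim s l2 -> l1 = l2.
Proof.
  intros H1 H2; apply C_eq_of_dist; intros eps He.
  destruct (H1 (eps / 2)) as [N1 K1]; [lra|].
  destruct (H2 (eps / 2)) as [N2 K2]; [lra|].
  specialize (K1 (N1 + N2)%nat ltac:(lia)); specialize (K2 (N1 + N2)%nat ltac:(lia)).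
  eapply Rle_trans; [apply (Cmod_dist_triangle _ (s (N1 + N2)%nat))|].
  rewrite Cmod_sym in K1; lra.
Qed.

Lemma clim_components (s : nat -> CC) (l : CC) :
  clim s l <-> is_lim_seq (fun n => fst (s n)) (fst l) /\ is_lim_seq (fun n => snd (s n)) (snd l).
Proof.
  split.
  - intros H; split; apply is_lim_seq_spec; intros eps;
      destruct (H (eps / 2)) as [N K]; try (destruct eps; simpl; lra);
      exists N; intros n Hn; specialize (K n Hn).
    + pose proof (Cmod_fst (s n - l)) as Hf; simpl in Hf.
      unfold Rminus; destruct eps as [e He]; simpl in *; lra.
    + pose proof (Cmod_snd (s n - l)) as Hf; simpl in Hf.
      unfold Rminus; destruct eps as [e He]; simpl in *; lra.
  - intros [H1 H2] eps He; apply is_lim_seq_spec in H1; apply is_lim_seq_spec in H2.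
    assert (He2 : 0 < eps / 2) by lra.
    destruct (H1 (mkposreal _ He2)) as [N1 K1]; destruct (H2 (mkposreal _ He2)) as [N2 K2].
    exists (N1 + N2)%nat; intros n Hn.
    specialize (K1 n ltac:(lia)); specialize (K2 n ltac:(lia)); simpl in K1, K2.
    eapply Rle_trans; [apply Cmod_le_abs|]; simpl; unfold Rminus in *; lra.
Qed.

(** Built from two real [Series], exactly as in [Nfun], so that [Nfun] is an instance by
    conversion. *)
Definition cser (a : nat -> CC) : CC :=
  (Series (fun m => fst (a m)), Series (fun m => snd (a m))).

Definition l1 (a : nat -> CC) (B : R) : Prop :=
  forall n, sum_f_R0 (fun j => Cmod (a j)) n <= B.

Lemma ex_series_bounded (x : nat -> R) (B : R) :
  (forall j, 0 <= x j) -> (forall n, sum_f_R0 x n <= B) -> ex_series x.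
Proof.
  intros Hx HB.
  destruct (ex_finite_lim_seq_incr (sum_n x) B) as [l Hl].
  - intros n; rewrite sum_Sn; specialize (Hx (S n)); unfold plus; simpl; lra.
  - intros n; rewrite sum_n_Reals; apply HB.
  - exists l; exact Hl.
Qed.

Lemma is_series_sum_f (x : nat -> R) l :
  is_series x l <-> is_lim_seq (sum_f_R0 x) l.
Proof.
  unfold is_series; change (is_lim_seq (sum_n x) l <-> is_lim_seq (sum_f_R0 x) l).
  split; apply is_lim_seq_ext; intros n; rewrite sum_n_Reals; reflexivity.
Qed.

Lemma l1_nonneg a B : l1 a B -> 0 <= B.
Proof. intros H; specialize (H O); simpl in H; pose proof (Cmod_ge_0 (a O)); lra. Qed.

Lemma l1_le (a b : nat -> CC) B : (forall j, Cmod (b j) <= Cmod (a j)) -> l1 a B -> l1 b B.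
Proof.
  intros H Ha n; eapply Rle_trans; [|apply (Ha n)]; apply sum_Rle; auto.
Qed.

Lemma l1_ex_series_abs (a : nat -> CC) B : l1 a B ->
  ex_series (fun j => Rabs (fst (a j))) /\ ex_series (fun j => Rabs (snd (a j))).
Proof.
  intros H; split; apply ex_series_bounded with B; try (intros; apply Rabs_pos);
    intros n; (eapply Rle_trans; [|apply (H n)]); apply sum_Rle; intros;
    [apply Cmod_fst | apply Cmod_snd].
Qed.

Lemma cser_clim (a : nat -> CC) B : l1 a B -> clim (csum a) (cser a).
Proof.
  intros H; destruct (l1_ex_series_abs a B H) as [H1 H2].
  apply ex_series_Rabs in H1; apply ex_series_Rabs in H2.
  apply clim_components; split.
  - apply is_lim_seq_ext with (sum_f_R0 (fun j => fst (a j))).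
    + intros n; symmetry; apply csum_fst.
    + apply is_series_sum_f, Series_correct, H1.
  - apply is_lim_seq_ext with (sum_f_R0 (fun j => snd (a j))).
    + intros n; symmetry; apply csum_snd.
    + apply is_series_sum_f, Series_correct, H2.
Qed.

Lemma cser_unique (a : nat -> CC) l : clim (csum a) l -> cser a = l.
Proof.
  intros H; apply clim_components in H; destruct H as [H1 H2].
  destruct l as [l1 l2]; unfold cser; f_equal; apply is_series_unique, is_series_sum_f.
  - eapply is_lim_seq_ext; [|exact H1]; intros n; apply csum_fst.
  - eapply is_lim_seq_ext; [|exact H2]; intros n; apply csum_snd.
Qed.

Lemma cser_ext (a b : nat -> CC) : (forall j, a j = b j) -> cser a = cser b.
Proof. intros H; unfold cser; f_equal; apply Series_ext; intros; rewrite H; reflexivity. Qed.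

Lemma Cmod_clim_le (s : nat -> CC) l c B :
  clim s l -> (exists N, forall n, (N <= n)%nat -> Cmod (s n - c) <= B) -> Cmod (l - c) <= B.
Proof.
  intros H [N HN]; apply le_epsilon; intros e He.
  destruct (H e He) as [M HM].
  specialize (HM (N + M)%nat ltac:(lia)); specialize (HN (N + M)%nat ltac:(lia)).
  eapply Rle_trans; [apply (Cmod_dist_triangle _ (s (N + M)%nat))|].
  rewrite Cmod_sym in HM; lra.
Qed.

Lemma Cmod_cser_le (a : nat -> CC) B : l1 a B -> Cmod (cser a) <= B.
Proof.
  intros H; replace (cser a) with (cser a - RtoC 0)%C by ring.
  apply (Cmod_clim_le _ _ _ _ (cser_clim a B H)).
  exists O; intros n _; replace (csum a n - RtoC 0)%C with (csum a n) by ring.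
  eapply Rle_trans; [apply Cmod_csum|apply H].
Qed.

Lemma Cmod_csum_diff (a : nat -> CC) n m : (n <= m)%nat ->
  Cmod (csum a m - csum a n)
  <= sum_f_R0 (fun j => Cmod (a j)) m - sum_f_R0 (fun j => Cmod (a j)) n.
Proof.
  intros H; induction H as [|m H IH].
  - replace (csum a n - csum a n)%C with (RtoC 0) by ring; rewrite Cmod_0; lra.
  - simpl; replace (csum a m + a (S m) - csum a n)%C
      with ((csum a m - csum a n) + a (S m))%C by ring.
    eapply Rle_trans; [apply Cmod_triangle|]; lra.
Qed.

Lemma sum_f_diff_le (x y : nat -> R) n m : (n <= m)%nat -> (forall j, x j <= y j) ->
  sum_f_R0 x m - sum_f_R0 x n <= sum_f_R0 y m - sum_f_R0 y n.
Proof.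
  intros H Hxy; induction H as [|m H IH]; [lra|].
  simpl; specialize (Hxy (S m)); lra.
Qed.

Lemma l1_tail (a : nat -> CC) B : l1 a B -> forall eps, 0 < eps ->
  exists N, forall n m, (N <= n <= m)%nat ->
    sum_f_R0 (fun j => Cmod (a j)) m - sum_f_R0 (fun j => Cmod (a j)) n <= eps.
Proof.
  intros H eps He.
  destruct (ex_series_bounded (fun j => Cmod (a j)) B) as [l Hl];
    [intros; apply Cmod_ge_0|exact H|].
  apply is_series_sum_f, is_lim_seq_spec in Hl.
  assert (He2 : 0 < eps / 2) by lra.
  destruct (Hl (mkposreal _ He2)) as [N HN]; simpl in HN.
  exists N; intros n m Hnm.
  pose proof (HN n ltac:(lia)) as K1; pose proof (HN m ltac:(lia)) as K2.
  apply Rabs_def2 in K1; apply Rabs_def2 in K2; lra.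
Qed.

(** The index [N] depends on the majorant [a] alone. Taking [b] to be the terms of a power series at
    varying points of the disc gives uniform convergence. *)
Lemma cser_dominated (a : nat -> CC) B : l1 a B -> forall eps, 0 < eps ->
  exists N, forall b, (forall j, Cmod (b j) <= Cmod (a j)) ->
    forall n, (N <= n)%nat -> Cmod (cser b - csum b n) <= eps.
Proof.
  intros H eps He; destruct (l1_tail a B H eps He) as [N HN].
  exists N; intros b Hb n Hn.
  apply (Cmod_clim_le (csum b)); [apply (cser_clim b B), (l1_le a); auto|].
  exists n; intros m Hm; eapply Rle_trans; [apply Cmod_csum_diff, Hm|].
  eapply Rle_trans; [apply sum_f_diff_le; [exact Hm|exact Hb]|].
  apply HN; lia.
Qed.

(** Tannery's theorem, with termwise stabilisation in place of termwise convergence; truncated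
    exponential series have coefficients of this kind. *)
Lemma cser_dominated_convergence (F : nat -> nat -> CC) (b : nat -> CC) (a : nat -> CC) B :
  l1 a B -> (forall n j, Cmod (F n j) <= Cmod (a j)) ->
  (forall j, exists N, forall n, (N <= n)%nat -> F n j = b j) ->
  clim (fun n => cser (F n)) (cser b).
Proof.
  intros Ha HF Hb eps He.
  assert (Hba : forall j, Cmod (b j) <= Cmod (a j)).
  { intros j; destruct (Hb j) as [N HN]; rewrite <- (HN N) by lia; apply HF. }
  destruct (cser_dominated a B Ha (eps / 2) ltac:(lra)) as [M HM].
  assert (HN : exists N, forall n, (N <= n)%nat -> forall j, (j <= M)%nat -> F n j = b j).
  { clear HM; induction M as [|M [N IH]].
    - destruct (Hb O) as [N HN]; exists N; intros n Hn j Hj.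
      replace j with O by lia; apply HN, Hn.
    - destruct (Hb (S M)) as [N' HN']; exists (N + N')%nat; intros n Hn j Hj.
      destruct (Nat.eq_dec j (S M)) as [->|Hne]; [apply HN'; lia|apply IH; lia]. }
  destruct HN as [N HN]; exists N; intros n Hn.
  pose proof (HM (F n) (HF n) M (le_n _)) as K1.
  pose proof (HM b Hba M (le_n _)) as K2.
  rewrite (csum_ext (F n) b M) in K1 by (intros; apply HN; auto).
  eapply Rle_trans; [apply (Cmod_dist_triangle _ (csum b M))|].
  rewrite (Cmod_sym (csum b M)); lra.
Qed.

Lemma l1_conv (a b : nat -> CC) A B : l1 a A -> l1 b B -> l1 (conv a b) (A * B).
Proof.
  intros Ha Hb n.
  eapply Rle_trans; [apply sum_Rle; intros; apply Cmod_conv|].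
  eapply Rle_trans; [apply sum_rconv_le; intros; apply Cmod_ge_0|].
  apply Rmult_le_compat; auto; apply sum_nonneg; intros; apply Cmod_ge_0.
Qed.

(** The Cauchy product, reduced to the four real products of real and imaginary parts. *)
Lemma cser_conv (a b : nat -> CC) A B : l1 a A -> l1 b B ->
  cser (conv a b) = (cser a * cser b)%C.
Proof.
  intros Ha Hb.
  destruct (l1_ex_series_abs a A Ha) as [Ha1 Ha2].
  destruct (l1_ex_series_abs b B Hb) as [Hb1 Hb2].
  pose proof (Series_correct _ (ex_series_Rabs _ Ha1)) as Sa1.
  pose proof (Series_correct _ (ex_series_Rabs _ Ha2)) as Sa2.
  pose proof (Series_correct _ (ex_series_Rabs _ Hb1)) as Sb1.
  pose proof (Series_correct _ (ex_series_Rabs _ Hb2)) as Sb2.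
  pose proof (is_series_mult _ _ _ _ Sa1 Sb1 Ha1 Hb1) as M11.
  pose proof (is_series_mult _ _ _ _ Sa2 Sb2 Ha2 Hb2) as M22.
  pose proof (is_series_mult _ _ _ _ Sa1 Sb2 Ha1 Hb2) as M12.
  pose proof (is_series_mult _ _ _ _ Sa2 Sb1 Ha2 Hb1) as M21.
  unfold cser at 1; unfold Cmult; f_equal; simpl; apply is_series_unique.
  - eapply is_series_ext; [|apply (is_series_minus _ _ _ _ M11 M22)].
    intros n; unfold conv; rewrite csum_fst; symmetry.
    exact (minus_sum (fun i => fst (a i) * fst (b (n - i)%nat))
                     (fun i => snd (a i) * snd (b (n - i)%nat)) n).
  - eapply is_series_ext; [|apply (is_series_plus _ _ _ _ M12 M21)].
    intros n; unfold conv; rewrite csum_snd; symmetry.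
    exact (plus_sum (fun i => fst (a i) * snd (b (n - i)%nat))
                    (fun i => snd (a i) * fst (b (n - i)%nat)) n).
Qed.

(** * Power series on the closed unit disc *)

Definition PS (a : nat -> CC) (w : CC) : CC := cser (fun j => a j * w ^ j)%C.

Lemma Cmod_pow_le1 (w : CC) j : Cmod w <= 1 -> Cmod (w ^ j)%C <= 1.
Proof.
  intros H; rewrite Cmod_pow; induction j as [|j IH]; simpl; [lra|].
  pose proof (Cmod_ge_0 w); pose proof (pow_le (Cmod w) j H0); nra.
Qed.

Lemma Cmod_term_le (a : nat -> CC) w j : Cmod w <= 1 -> Cmod (a j * w ^ j)%C <= Cmod (a j).
Proof.
  intros H; rewrite Cmod_mult; pose proof (Cmod_pow_le1 w j H).
  pose proof (Cmod_ge_0 (a j)); nra.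
Qed.

Lemma PS_bound (a : nat -> CC) B w : l1 a B -> Cmod w <= 1 -> Cmod (PS a w) <= B.
Proof.
  intros Ha Hw; apply Cmod_cser_le, (l1_le a); auto; intros; apply Cmod_term_le, Hw.
Qed.

Lemma PS_clim (a : nat -> CC) B w : l1 a B -> Cmod w <= 1 ->
  clim (csum (fun j => a j * w ^ j)%C) (PS a w).
Proof.
  intros Ha Hw; apply (cser_clim _ B), (l1_le a); auto; intros; apply Cmod_term_le, Hw.
Qed.

Lemma PS_uniform (a : nat -> CC) B : l1 a B -> forall eps, 0 < eps ->
  exists N, forall n w, (N <= n)%nat -> Cmod w <= 1 ->
    Cmod (PS a w - csum (fun j => a j * w ^ j)%C n) <= eps.
Proof.
  intros Ha eps He; destruct (cser_dominated a B Ha eps He) as [N HN].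
  exists N; intros n w Hn Hw; apply HN; auto; intros; apply Cmod_term_le, Hw.
Qed.

Lemma PS_conv (a b : nat -> CC) A B w : l1 a A -> l1 b B -> Cmod w <= 1 ->
  PS (conv a b) w = (PS a w * PS b w)%C.
Proof.
  intros Ha Hb Hw; unfold PS.
  rewrite <- (cser_conv _ _ A B).
  - apply cser_ext; intros n; unfold conv.
    rewrite Cmult_comm, <- csum_scal; apply csum_ext; intros i Hi.
    replace (w ^ n)%C with (w ^ i * w ^ (n - i))%C.
    + ring.
    + rewrite <- Cpow_add_r; f_equal; lia.
  - apply (l1_le a); auto; intros; apply Cmod_term_le, Hw.
  - apply (l1_le b); auto; intros; apply Cmod_term_le, Hw.
Qed.

Lemma PS_finite (a : nat -> CC) n w : (forall j, (n < j)%nat -> a j = RtoC 0) ->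
  PS a w = csum (fun j => a j * w ^ j)%C n.
Proof.
  intros H; apply cser_unique; intros eps He; exists n; intros m Hm.
  rewrite (csum_extend _ n m Hm).
  - replace (_ - _)%C with (RtoC 0) by ring; rewrite Cmod_0; lra.
  - intros j Hj; rewrite H by auto; ring.
Qed.

Lemma l1_finite (a : nat -> CC) n : (forall j, (n < j)%nat -> a j = RtoC 0) ->
  l1 a (sum_f_R0 (fun j => Cmod (a j)) n).
Proof.
  intros H m; destruct (Nat.le_ge_cases m n) as [Hm|Hm].
  - apply sum_mono; auto; intros; apply Cmod_ge_0.
  - right; induction Hm as [|m Hm IH]; [reflexivity|].
    simpl; rewrite IH, H, Cmod_0 by lia; ring.
Qed.

(** * The complex exponential *)

Lemma cexp_plus (x y : CC) : cexp (x + y) = (cexp x * cexp y)%C.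
Proof.
  unfold cexp, Cmult; simpl; rewrite exp_plus, cos_plus, sin_plus; f_equal; ring.
Qed.

Lemma Cmod_cexp (z : CC) : Cmod (cexp z) = exp (fst z).
Proof.
  unfold Cmod, cexp; simpl fst; simpl snd.
  replace (_ + _) with (exp (fst z) ^ 2).
  - apply sqrt_pow2; left; apply exp_pos.
  - pose proof (sin2_cos2 (snd z)) as H; unfold Rsqr in H.
    replace ((exp (fst z) * cos (snd z)) ^ 2 + (exp (fst z) * sin (snd z)) ^ 2)
      with (exp (fst z) ^ 2 * (sin (snd z) * sin (snd z) + cos (snd z) * cos (snd z))) by ring.
    rewrite H; ring.
Qed.

Lemma cexp_0 : cexp (RtoC 0) = RtoC 1.
Proof. unfold cexp, RtoC; simpl; rewrite exp_0, cos_0, sin_0; f_equal; ring. Qed.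

Definition exp_term (z : CC) (m : nat) : CC := (RtoC (/ INR (fact m)) * z ^ m)%C.

(* The scalar product of the curve with its endpoint [r x] is compared with [Cmod (r x) * b]. *)
Lemma curve_mvt (r dr : R -> CC) (b db : R -> R) :
  (forall t, is_derive (fun s => fst (r s)) t (fst (dr t))) ->
  (forall t, is_derive (fun s => snd (r s)) t (snd (dr t))) ->
  (forall t, is_derive b t (db t)) ->
  (forall t, 0 <= t -> Cmod (dr t) <= db t) ->
  r 0 = RtoC 0 -> b 0 = 0 ->
  forall x, 0 <= x -> Cmod (r x) <= b x.
Proof.
  intros H1 H2 Hb Hle Hr0 Hb0 x Hx.
  destruct (Rle_lt_or_eq_dec 0 x Hx) as [Hx'|<-];
    [|rewrite Hr0, Hb0, Cmod_0; lra].
  destruct (Req_dec (Cmod (r x)) 0) as [E|E].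
  { rewrite E, <- Hb0.
    destruct (MVT_gen b 0 x db) as [c [Hc Ec]].
    - intros; apply Hb.
    - intros; apply derivable_continuous_pt, ex_derive_Reals_0; eexists; apply Hb.
    - rewrite Rmin_left, Rmax_right in Hc by lra.
      pose proof (Hle c ltac:(lra)); pose proof (Cmod_ge_0 (dr c)); nra. }
  pose proof (Cmod_ge_0 (r x)) as Hp.
  set (p := fst (r x)) in *; set (q := snd (r x)) in *; set (M := Cmod (r x)) in *.
  set (f := fun t => p * fst (r t) + q * snd (r t) - M * b t).
  set (df := fun t => p * fst (dr t) + q * snd (dr t) - M * db t).
  assert (Hf : forall t, is_derive f t (df t)).
  { intros t; unfold f, df.
    apply @is_derive_minus; [apply @is_derive_plus|];
      apply is_derive_scal; auto. }
  destruct (MVT_gen f 0 x df) as [c [Hc Ec]].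
  - intros; apply Hf.
  - intros; apply derivable_continuous_pt, ex_derive_Reals_0; eexists; apply Hf.
  - rewrite Rmin_left, Rmax_right in Hc by lra.
    assert (HM : M ^ 2 = p ^ 2 + q ^ 2) by apply Cmod_sqr.
    assert (Hd : df c <= 0).
    { unfold df; specialize (Hle c ltac:(lra)).
      pose proof (Cmod_sqr (dr c)) as HD; pose proof (Cmod_ge_0 (dr c)) as HD0.
      assert (p * fst (dr c) + q * snd (dr c) <= M * Cmod (dr c)); [|nra].
      apply Rsqr_incr_0_var; [|nra]; unfold Rsqr.
      pose proof (Rle_0_sqr (p * snd (dr c) - q * fst (dr c))) as Hs; unfold Rsqr in Hs.
      replace (M * Cmod (dr c) * (M * Cmod (dr c))) with (M ^ 2 * Cmod (dr c) ^ 2) by ring.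
      rewrite HM, HD; nra. }
    assert (f x <= 0).
    { assert (f 0 = 0) by (unfold f; rewrite Hr0, Hb0; simpl; ring).
      nra. }
    unfold f in H; fold p q in H.
    assert (M * (M - b x) <= 0) by nra.
    nra.
Qed.

Lemma exp_term_S (z : CC) m t :
  exp_term (RtoC t * z) (S m) = (RtoC (t ^ S m) * (RtoC (/ INR (fact (S m))) * z ^ S m))%C.
Proof.
  unfold exp_term; rewrite Cpow_mult_l, <- RtoC_pow; ring.
Qed.

Lemma is_derive_exp_term (z : CC) m t :
  is_derive (fun s => fst (exp_term (RtoC s * z) (S m))) t (fst (z * exp_term (RtoC t * z) m)%C) /\
  is_derive (fun s => snd (exp_term (RtoC s * z) (S m))) t (snd (z * exp_term (RtoC t * z) m)%C).
Proof.
  set (c := (RtoC (/ INR (fact (S m))) * z ^ S m)%C).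
  assert (E : (z * exp_term (RtoC t * z) m)%C = (RtoC (INR (S m) * t ^ m) * c)%C).
  { unfold exp_term, c; rewrite Cpow_mult_l, <- RtoC_pow.
    replace (RtoC (/ INR (fact m))) with (RtoC (INR (S m)) * RtoC (/ INR (fact (S m))))%C.
    - rewrite RtoC_mult; simpl Cpow; ring.
    - rewrite <- RtoC_mult; f_equal.
      rewrite fact_simpl, mult_INR; field; split; [apply INR_fact_neq_0|apply not_0_INR; lia]. }
  rewrite E; split.
  - apply is_derive_ext with (fun s => fst c * s ^ S m).
    + intros s; rewrite exp_term_S; fold c; simpl; ring.
    + auto_derive; [trivial|]; simpl pred; simpl fst; ring.
  - apply is_derive_ext with (fun s => snd c * s ^ S m).
    + intros s; rewrite exp_term_S; fold c; simpl; ring.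
    + auto_derive; [trivial|]; simpl pred; simpl snd; ring.
Qed.

Lemma is_derive_exp_sum (z : CC) m t :
  is_derive (fun s => fst (csum (exp_term (RtoC s * z)) (S m))) t
    (fst (z * csum (exp_term (RtoC t * z)) m)%C) /\
  is_derive (fun s => snd (csum (exp_term (RtoC s * z)) (S m))) t
    (snd (z * csum (exp_term (RtoC t * z)) m)%C).
Proof.
  induction m as [|m [IH1 IH2]].
  - destruct (is_derive_exp_term z 0 t) as [H1 H2]; simpl csum; split.
    + apply is_derive_ext with (fun s => 1 + fst (exp_term (RtoC s * z) 1)).
      * intros s; unfold exp_term; simpl; field.
      * replace (fst _) with (0 + fst (z * exp_term (RtoC t * z) 0)%C) by ring.
        apply @is_derive_plus; [apply @is_derive_const|exact H1].
    + apply is_derive_ext with (fun s => 0 + snd (exp_term (RtoC s * z) 1)).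
      * intros s; unfold exp_term; simpl; field.
      * replace (snd _) with (0 + snd (z * exp_term (RtoC t * z) 0)%C) by ring.
        apply @is_derive_plus; [apply @is_derive_const|exact H2].
  - destruct (is_derive_exp_term z (S m) t) as [H1 H2]; split.
    + replace (z * csum (exp_term (RtoC t * z)) (S m))%C
        with (z * csum (exp_term (RtoC t * z)) m + z * exp_term (RtoC t * z) (S m))%C
        by (simpl; ring).
      exact (is_derive_plus _ _ _ _ _ IH1 H1).
    + replace (z * csum (exp_term (RtoC t * z)) (S m))%C
        with (z * csum (exp_term (RtoC t * z)) m + z * exp_term (RtoC t * z) (S m))%C
        by (simpl; ring).
      exact (is_derive_plus _ _ _ _ _ IH2 H2).
Qed.

Lemma is_derive_cexp_line (z : CC) t :
  is_derive (fun s => fst (cexp (RtoC s * z))) t (fst (z * cexp (RtoC t * z))%C) /\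
  is_derive (fun s => snd (cexp (RtoC s * z))) t (snd (z * cexp (RtoC t * z))%C).
Proof.
  destruct z as [x y]; split; unfold cexp; simpl; auto_derive; trivial; unfold Rminus; ring.
Qed.


(** Following the Taylor remainder along the segment from 0 to [z] turns it into a curve in one real
    variable, so that real calculus is enough. *)
Definition exp_rem (z : CC) (m : nat) (t : R) : CC :=
  (cexp (RtoC t * z) - csum (exp_term (RtoC t * z)) m)%C.

Lemma is_derive_exp_rem (z : CC) m t :
  is_derive (fun s => fst (exp_rem z (S m) s)) t (fst (z * exp_rem z m t)%C) /\
  is_derive (fun s => snd (exp_rem z (S m) s)) t (snd (z * exp_rem z m t)%C).
Proof.
  destruct (is_derive_cexp_line z t) as [H1 H2]; destruct (is_derive_exp_sum z m t) as [K1 K2].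
  replace (z * exp_rem z m t)%C
    with (z * cexp (RtoC t * z) - z * csum (exp_term (RtoC t * z)) m)%C
    by (unfold exp_rem; ring).
  split; [exact (is_derive_minus _ _ _ _ _ H1 K1)|exact (is_derive_minus _ _ _ _ _ H2 K2)].
Qed.

Lemma is_derive_exp_rem_0 (z : CC) t :
  is_derive (fun s => fst (exp_rem z 0 s)) t (fst (z * cexp (RtoC t * z))%C) /\
  is_derive (fun s => snd (exp_rem z 0 s)) t (snd (z * cexp (RtoC t * z))%C).
Proof.
  destruct (is_derive_cexp_line z t) as [H1 H2]; split.
  - apply is_derive_ext with (fun s => fst (cexp (RtoC s * z)) + (- 1)).
    + intros s; unfold exp_rem, exp_term; simpl; field.
    + replace (fst (z * _)%C) with (fst (z * cexp (RtoC t * z))%C + 0) by ring.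
      apply @is_derive_plus; [exact H1|apply @is_derive_const].
  - apply is_derive_ext with (fun s => snd (cexp (RtoC s * z)) + 0).
    + intros s; unfold exp_rem, exp_term; simpl; field.
    + replace (snd (z * _)%C) with (snd (z * cexp (RtoC t * z))%C + 0) by ring.
      apply @is_derive_plus; [exact H2|apply @is_derive_const].
Qed.

Lemma exp_rem_at_0 (z : CC) m : exp_rem z m 0 = RtoC 0.
Proof.
  unfold exp_rem; replace (RtoC 0 * z)%C with (RtoC 0) by ring; rewrite cexp_0.
  replace (csum (exp_term 0) m) with (RtoC 1); [ring|].
  rewrite (csum_extend _ 0 m); [unfold exp_term; simpl; rewrite Rinv_1; ring|lia|].
  intros [|j] Hj; [lia|]; unfold exp_term; simpl; ring.
Qed.

(** The remainder is majorised by the one of the real exponential at [|z|]. Each derivative in [t]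
    lowers the order by one and brings out a factor [z], so [curve_mvt] lifts the bound from order
    [m] to [m + 1]; order 0 rests on [|e^(tz)| <= e^(t|z|)]. *)
Lemma exp_rem_bound (z : CC) m t : 0 <= t ->
  Cmod (exp_rem z m t) <= fst (exp_rem (RtoC (Cmod z)) m t).
Proof.
  revert t; induction m as [|m IH].
  - apply (curve_mvt _ (fun t => z * cexp (RtoC t * z))%C _
             (fun t => fst (RtoC (Cmod z) * cexp (RtoC t * RtoC (Cmod z)))%C));
      try (intros; apply is_derive_exp_rem_0); try apply exp_rem_at_0.
    + intros t Ht; rewrite Cmod_mult, Cmod_cexp; unfold cexp; simpl.
      replace (t * 0 + 0 * Cmod z) with 0 by ring; rewrite cos_0, sin_0.
      replace (t * Cmod z - 0 * 0) with (t * Cmod z) by ring.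
      assert (exp (t * fst z - 0 * snd z) <= exp (t * Cmod z)).
      { assert (Hx : t * fst z - 0 * snd z <= t * Cmod z)
          by (pose proof (Cmod_fst z); pose proof (Rle_abs (fst z)); nra).
        destruct Hx as [Hl|Hl]; [left; apply exp_increasing, Hl|rewrite Hl; lra]. }
      pose proof (Cmod_ge_0 z); nra.
    + rewrite exp_rem_at_0; reflexivity.
  - apply (curve_mvt _ (fun t => z * exp_rem z m t)%C _
             (fun t => fst (RtoC (Cmod z) * exp_rem (RtoC (Cmod z)) m t)%C));
      try (intros; apply is_derive_exp_rem); try apply exp_rem_at_0.
    + intros t Ht; rewrite Cmod_mult; specialize (IH t Ht).
      destruct (exp_rem (RtoC (Cmod z)) m t) as [u v]; simpl in *.
      pose proof (Cmod_ge_0 z); nra.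
    + rewrite exp_rem_at_0; reflexivity.
Qed.

Lemma exp_partial_sum_clim (x : R) :
  is_lim_seq (sum_f_R0 (fun j => x ^ j / INR (fact j))) (exp x).
Proof.
  apply is_series_sum_f.
  apply is_series_ext with (2 := is_exp_Reals x).
  intros n; rewrite pow_n_pow; unfold scal; simpl; unfold mult; simpl; field.
  apply INR_fact_neq_0.
Qed.

Lemma exp_partial_sum_le (x : R) n : 0 <= x ->
  sum_f_R0 (fun j => x ^ j / INR (fact j)) n <= exp x.
Proof.
  intros Hx; apply (is_lim_seq_incr_compare _ _ (exp_partial_sum_clim x)).
  intros m; simpl.
  assert (0 <= x ^ S m / INR (fact (S m))); [|simpl in *; lra].
  apply Rmult_le_pos; [apply pow_le, Hx|left; apply Rinv_0_lt_compat, INR_fact_lt_0].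
Qed.

Lemma cexp_taylor (z : CC) : clim (csum (exp_term z)) (cexp z).
Proof.
  intros eps He; pose proof (exp_partial_sum_clim (Cmod z)) as H.
  apply is_lim_seq_spec in H; destruct (H (mkposreal eps He)) as [N HN]; exists N.
  intros n Hn; specialize (HN n Hn); simpl in HN.
  pose proof (exp_rem_bound z n 1 Rle_0_1) as Hb.
  unfold exp_rem in Hb at 1.
  replace (RtoC 1 * z)%C with z in Hb by ring.
  rewrite Cmod_sym; eapply Rle_trans; [exact Hb|].
  unfold exp_rem; replace (RtoC 1 * RtoC (Cmod z))%C with (RtoC (Cmod z)) by ring.
  unfold Cminus, Cplus; simpl fst; rewrite csum_fst.
  rewrite (sum_eq _ (fun j => Cmod z ^ j / INR (fact j))).
  - unfold cexp; simpl; rewrite cos_0.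
    apply Rabs_def2 in HN; lra.
  - intros j _; unfold exp_term; rewrite <- RtoC_pow; simpl; field; apply INR_fact_neq_0.
Qed.

(** * Exponentials of power series *)

Definition delta0 (j : nat) : CC := match j with O => RtoC 1 | S _ => RtoC 0 end.

Fixpoint conv_pow (a : nat -> CC) (m : nat) : nat -> CC :=
  match m with
  | O => delta0
  | S m' => conv a (conv_pow a m')
  end.

(** A series without constant term has an [m]-th power that starts at [w ^ m]. *)
Lemma conv_pow_small (a : nat -> CC) m j : a O = RtoC 0 -> (j < m)%nat -> conv_pow a m j = RtoC 0.
Proof.
  intros Ha; revert j; induction m as [|m IH]; intros j Hj; [lia|].
  simpl; apply csum_0; intros [|i] Hi; [rewrite Ha; ring|].
  rewrite IH by lia; ring.
Qed.

(* The coefficient of [w ^ j] in [exp (PS a w)]; when [a 0 = 0] the powers above [j] do not contribute. *)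
Definition exp_coef (a : nat -> CC) (j : nat) : CC :=
  csum (fun m => RtoC (/ INR (fact m)) * conv_pow a m j)%C j.

(** All coefficients of index at most [M] can thus share the cut-off [M], which allows the sums over
    [j] and [m] to be interchanged. *)
Lemma exp_coef_extend (a : nat -> CC) j M : a O = RtoC 0 -> (j <= M)%nat ->
  exp_coef a j = csum (fun m => RtoC (/ INR (fact m)) * conv_pow a m j)%C M.
Proof.
  intros Ha Hj; symmetry; apply csum_extend; auto.
  intros m Hm; rewrite conv_pow_small by auto; ring.
Qed.

Lemma exp_coef_0 (a : nat -> CC) : exp_coef a O = RtoC 1.
Proof. unfold exp_coef; simpl; rewrite Rinv_1; ring. Qed.

(* [wiener k a B] bounds by [B] the norm of [a] in the algebra of sequences with
   [sum |a j| < oo] and [sum j^(2k) |a j|^2 < oo]. *)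
Definition wiener (k : nat) (a : nat -> CC) (B : R) : Prop :=
  0 <= B /\ l1 a B /\
  forall n, sum_f_R0 (fun j => (INR j ^ k * Cmod (a j)) ^ 2) n <= B ^ 2.

Lemma wiener_delta0 k : wiener k delta0 1.
Proof.
  split; [lra|split]; intros n.
  - induction n as [|n IH]; simpl; [rewrite Cmod_1; lra|].
    rewrite Cmod_0; simpl in IH; lra.
  - induction n as [|n IH].
    + simpl sum_f_R0; rewrite Cmod_1.
      destruct k as [|k]; simpl; lra.
    + rewrite tech5; replace (Cmod (delta0 (S n))) with 0 by (symmetry; apply Cmod_0); lra.
Qed.

(** Distributes the weight [j ^ k] over the two indices of a convolution; the constant comes from
    replacing both summands by the larger one. *)
Lemma pow_add_le (x y : R) k : 0 <= x -> 0 <= y -> (x + y) ^ k <= 2 ^ k * (x ^ k + y ^ k).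
Proof.
  intros Hx Hy.
  assert (H : forall u v, 0 <= u -> u <= v -> (u + v) ^ k <= 2 ^ k * (u ^ k + v ^ k)).
  { intros u v Hu Huv; apply Rle_trans with ((2 * v) ^ k).
    - apply pow_incr; lra.
    - rewrite Rpow_mult_distr; apply Rmult_le_compat_l; [apply pow_le; lra|].
      pose proof (pow_le u k Hu); lra. }
  destruct (Rle_dec x y); [auto|].
  rewrite Rplus_comm, (Rplus_comm (x ^ k)); apply H; lra.
Qed.

(** With the weight moved onto one factor, [young_ineq] applies with the other factor in [l^1]. Of
    the constant [2 ^ S k], the part [2 ^ k] comes from [pow_add_le] and the last 2 from
    [(x + y)^2 <= 2 (x^2 + y^2)] applied to two equal bounds. *)
Lemma wiener_conv k a b A B : wiener k a A -> wiener k b B ->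
  wiener k (conv a b) (2 ^ S k * A * B).
Proof.
  intros (HA & Ha1 & Ha2) (HB & Hb1 & Hb2).
  assert (H1 : 1 <= 2 ^ S k) by (apply pow_R1_Rle; lra).
  assert (HAB : 0 <= A * B) by nra.
  split; [nra|split].
  { intros n; eapply Rle_trans; [apply (l1_conv a b A B); auto|]; nra. }
  intros n.
  set (xa := fun j => Cmod (a j)); set (xb := fun j => Cmod (b j)).
  set (wa := fun j => INR j ^ k * Cmod (a j)); set (wb := fun j => INR j ^ k * Cmod (b j)).
  assert (Pxa : forall j, 0 <= xa j) by (intros; apply Cmod_ge_0).
  assert (Pxb : forall j, 0 <= xb j) by (intros; apply Cmod_ge_0).
  assert (Pw : forall j, 0 <= INR j ^ k) by (intros; apply pow_le, pos_INR).
  assert (Pwa : forall j, 0 <= wa j) by (intros; apply Rmult_le_pos; auto; apply Cmod_ge_0).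
  assert (Pwb : forall j, 0 <= wb j) by (intros; apply Rmult_le_pos; auto; apply Cmod_ge_0).
  assert (K : forall j, INR j ^ k * Cmod (conv a b j) <= 2 ^ k * (rconv xb wa j + rconv xa wb j)).
  { intros j; apply Rle_trans with (INR j ^ k * rconv xa xb j).
    - apply Rmult_le_compat_l; auto; apply Cmod_conv.
    (* [young_ineq] takes the summable factor first, while the splitting of the weight produces the
       opposite order. *)
    - replace (rconv xb wa j) with (rconv wa xb j).
      + unfold rconv; rewrite <- plus_sum, <- !sum_scal_l; apply sum_Rle; intros i Hi.
        unfold wa, wb, xa, xb.
        assert (E : INR j = INR i + INR (j - i)) by (rewrite <- plus_INR; f_equal; lia).
        pose proof (pow_add_le (INR i) (INR (j - i)) k (pos_INR _) (pos_INR _)) as Hp.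
        rewrite <- E in Hp.
        pose proof (Cmod_ge_0 (a i)) as P1; pose proof (Cmod_ge_0 (b (j - i)%nat)) as P2.
        pose proof (Rmult_le_pos _ _ P1 P2) as P3.
        apply Rle_trans with (2 ^ k * (INR i ^ k + INR (j - i) ^ k) * (Cmod (a i) * Cmod (b (j - i)%nat)));
          [apply Rmult_le_compat_r; auto|right; ring].
      + unfold rconv; clear; set (u := wa); set (v := xb); clearbody u v.
        pose proof (csum_rev (fun i => RtoC (u i * v (j - i)%nat)) j) as E.
        apply (f_equal fst) in E; rewrite !csum_fst in E; simpl in E; rewrite E.
        apply sum_eq; intros i Hi; replace (j - (j - i))%nat with i by lia; ring. }
  assert (Y1 := young_ineq xb wa n Pxb Pwa); assert (Y2 := young_ineq xa wb n Pxa Pwb).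
  specialize (Ha1 n); specialize (Hb1 n); specialize (Ha2 n); specialize (Hb2 n).
  fold xa in Ha1; fold xb in Hb1.
  change (sum_f_R0 (fun j => wa j ^ 2) n <= A ^ 2) in Ha2.
  change (sum_f_R0 (fun j => wb j ^ 2) n <= B ^ 2) in Hb2.
  apply Rle_trans with (sum_f_R0 (fun j => (2 ^ k) ^ 2 * 2 * (rconv xb wa j ^ 2 + rconv xa wb j ^ 2)) n).
  - apply sum_Rle; intros j _.
    apply Rle_trans with ((2 ^ k * (rconv xb wa j + rconv xa wb j)) ^ 2).
    + apply pow_incr; split; [apply Rmult_le_pos; auto; apply Cmod_ge_0|apply K].
    + rewrite Rpow_mult_distr, Rmult_assoc; apply Rmult_le_compat_l; [apply pow2_ge_0|].
      pose proof (pow2_ge_0 (rconv xb wa j - rconv xa wb j)); lra.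
  - rewrite sum_scal_l, plus_sum.
    apply Rle_trans with ((2 ^ k) ^ 2 * 2 * (B ^ 2 * A ^ 2 + A ^ 2 * B ^ 2)).
    + apply Rmult_le_compat_l; [pose proof (pow2_ge_0 (2 ^ k)); lra|].
      apply Rplus_le_compat; (eapply Rle_trans; [eassumption|]);
        (apply Rmult_le_compat; auto; [apply pow2_ge_0|apply sum_nonneg; intros; apply pow2_ge_0|]);
        apply pow_incr; split; auto; apply sum_nonneg; auto.
    + right; simpl; ring.
Qed.

Lemma wiener_conv_pow k a A m : wiener k a A -> wiener k (conv_pow a m) ((2 ^ S k * A) ^ m).
Proof.
  intros Ha; induction m as [|m IH]; [apply wiener_delta0|].
  simpl conv_pow; replace ((2 ^ S k * A) ^ S m) with (2 ^ S k * A * (2 ^ S k * A) ^ m) by (simpl; ring).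
  apply wiener_conv; auto.
Qed.

Lemma wiener_le k a A B : A <= B -> wiener k a A -> wiener k a B.
Proof.
  intros H (H0 & H1 & H2); split; [lra|split]; intros n.
  - eapply Rle_trans; [apply H1|exact H].
  - eapply Rle_trans; [apply H2|]; apply pow_incr; lra.
Qed.

Lemma Cmod_exp_coef (a : nat -> CC) j M : a O = RtoC 0 -> (j <= M)%nat ->
  Cmod (exp_coef a j) <= sum_f_R0 (fun m => / INR (fact m) * Cmod (conv_pow a m j)) M.
Proof.
  intros Ha Hj; rewrite (exp_coef_extend a j M) by auto.
  eapply Rle_trans; [apply Cmod_csum|]; right; apply sum_eq; intros m _.
  rewrite Cmod_mult, Cmod_R, Rabs_right; [reflexivity|].
  apply Rle_ge; left; apply Rinv_0_lt_compat, INR_fact_lt_0.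
Qed.

(** The norms of the terms [a^m / m!] are dominated by [L^m / m!]. In the weighted [l^2] part,
    Cauchy-Schwarz in [m] with the weights [L^m / m!] does the work of Minkowski's inequality and
    gives the bound [(e^L)^2]. *)
Lemma wiener_exp_coef k a A : a O = RtoC 0 -> wiener k a A ->
  exists B, wiener k (exp_coef a) B.
Proof.
  intros Ha0 Ha.
  (* The summand 1 makes [L] positive, since powers of [L] are divided by below. *)
  set (L := 2 ^ S k * A + 1).
  assert (HL : 0 < L) by (destruct Ha as [HA _]; unfold L; pose proof (pow_lt 2 (S k)); nra).
  assert (Hm : forall m, wiener k (conv_pow a m) (L ^ m)).
  { intros m; apply wiener_le with ((2 ^ S k * A) ^ m); [|apply wiener_conv_pow, Ha].
    apply pow_incr; destruct Ha as [HA _]; unfold L; pose proof (pow_lt 2 (S k)); nra. }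
  assert (Hf : forall m, 0 < / INR (fact m)) by (intros; apply Rinv_0_lt_compat, INR_fact_lt_0).
  assert (Hb : forall m, 0 < L ^ m / INR (fact m))
    by (intros; apply Rmult_lt_0_compat; [apply pow_lt, HL|apply Hf]).
  exists (exp L); split; [left; apply exp_pos|split]; intros n.
  - apply Rle_trans with (sum_f_R0 (fun j => sum_f_R0 (fun m => / INR (fact m) * Cmod (conv_pow a m j)) n) n).
    + apply sum_Rle; intros j Hj; apply Cmod_exp_coef; auto.
    + rewrite sum_swap; eapply Rle_trans; [|apply (exp_partial_sum_le L n); lra].
      apply sum_Rle; intros m _; rewrite sum_scal_l; unfold Rdiv; rewrite Rmult_comm.
      apply Rmult_le_compat_r; [left; apply Hf|]; apply (Hm m).
  - set (beta := fun m => L ^ m / INR (fact m)).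
    (* Chosen so that [beta m * q j m] is the square of the [m]-th term, while the sum of [q j m]
       over [j] stays below [beta m]. *)
    set (q := fun j m => beta m * (INR j ^ k * Cmod (conv_pow a m j)) ^ 2 / (L ^ m) ^ 2).
    assert (Hq : forall j m, 0 <= q j m).
    { intros j m; unfold q; apply Rmult_le_pos.
      - apply Rmult_le_pos; [left; apply Hb|apply pow2_ge_0].
      - left; apply Rinv_0_lt_compat, pow_lt, pow_lt, HL. }
    apply Rle_trans with (sum_f_R0 (fun j => sum_f_R0 beta n * sum_f_R0 (q j) n) n).
    + apply sum_Rle; intros j Hj.
      apply Rle_trans with
        (sum_f_R0 (fun m => / INR (fact m) * (INR j ^ k * Cmod (conv_pow a m j))) n ^ 2).
      * apply pow_incr; split; [apply Rmult_le_pos; [apply pow_le, pos_INR|apply Cmod_ge_0]|].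
        eapply Rle_trans; [apply Rmult_le_compat_l; [apply pow_le, pos_INR|apply (Cmod_exp_coef a j n); auto]|].
        rewrite <- sum_scal_l; right; apply sum_eq; intros; ring.
      * apply sum_cauchy_schwarz; [intros; left; apply Hb|apply Hq|].
        intros m _; unfold q, beta; right; field; split;
          [apply INR_fact_neq_0|apply pow_nonzero; lra].
    + rewrite sum_scal_l, sum_swap.
      assert (Hs : sum_f_R0 (fun m => sum_f_R0 (fun j => q j m) n) n <= sum_f_R0 beta n).
      { apply sum_Rle; intros m _; unfold q.
        rewrite (sum_eq _ (fun j => beta m / (L ^ m) ^ 2 * (INR j ^ k * Cmod (conv_pow a m j)) ^ 2))
          by (intros; unfold Rdiv; ring).
        rewrite sum_scal_l.
        apply Rle_trans with (beta m / (L ^ m) ^ 2 * (L ^ m) ^ 2).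
        - apply Rmult_le_compat_l; [|apply (Hm m)].
          apply Rmult_le_pos; [left; apply Hb|left; apply Rinv_0_lt_compat, pow_lt, pow_lt, HL].
        - right; field; apply pow_nonzero; lra. }
      assert (H0 : 0 <= sum_f_R0 beta n) by (apply sum_nonneg; intros; left; apply Hb).
      assert (H1 : sum_f_R0 beta n <= exp L) by (apply exp_partial_sum_le; lra).
      assert (H2 := exp_pos L); nra.
Qed.

Lemma PS_conv_pow (a : nat -> CC) k A w m : wiener k a A -> Cmod w <= 1 ->
  PS (conv_pow a m) w = (PS a w ^ m)%C.
Proof.
  intros Ha Hw; induction m as [|m IH].
  - rewrite (PS_finite _ 0); [simpl; ring|].
    intros [|j] Hj; [lia|reflexivity].
  - simpl; rewrite (PS_conv _ _ A ((2 ^ S k * A) ^ m)), IH; auto.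
    + apply Ha.
    + apply (wiener_conv_pow k a A m Ha).
Qed.

Lemma clim_csum (F : nat -> nat -> CC) (l : nat -> CC) M :
  (forall m, clim (F m) (l m)) -> clim (fun n => csum (fun m => F m n) M) (csum l M).
Proof.
  intros H; induction M as [|M IH]; [apply H|].
  intros eps He; destruct (IH (eps / 2) ltac:(lra)) as [N1 K1].
  destruct (H (S M) (eps / 2) ltac:(lra)) as [N2 K2]; exists (N1 + N2)%nat; intros n Hn.
  specialize (K1 n ltac:(lia)); specialize (K2 n ltac:(lia)); simpl.
  match goal with |- Cmod ?x <= _ =>
    replace x with ((csum (fun m => F m n) M - csum l M) + (F (S M) n - l (S M)))%C by ring end.
  eapply Rle_trans; [apply Cmod_triangle|]; lra.
Qed.

Lemma clim_scal (c : CC) (s : nat -> CC) l : clim s l -> clim (fun n => c * s n)%C (c * l)%C.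
Proof.
  intros H eps He; pose proof (Cmod_ge_0 c) as Hc.
  destruct (H (eps / (Cmod c + 1))) as [N HN]; [apply Rdiv_lt_0_compat; lra|].
  exists N; intros n Hn; specialize (HN n Hn).
  replace (c * s n - c * l)%C with (c * (s n - l))%C by ring; rewrite Cmod_mult.
  apply Rle_trans with ((Cmod c + 1) * (eps / (Cmod c + 1))); [|right; field; lra].
  apply Rmult_le_compat; auto; [apply Cmod_ge_0|lra].
Qed.

(** Both sides are limits, as [M] grows, of the series whose coefficients [F M] come from the
    exponential sum cut at [M]: one by dominated convergence, the other by Taylor's formula for
    [cexp]. *)
Lemma PS_exp_coef (a : nat -> CC) k A w : a O = RtoC 0 -> wiener k a A -> Cmod w <= 1 ->
  PS (exp_coef a) w = cexp (PS a w).
Proof.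
  intros Ha0 Ha Hw.
  set (L := 2 ^ S k * A).
  assert (HL : 0 <= L) by (destruct Ha as [HA _]; apply Rmult_le_pos; auto; apply pow_le; lra).
  set (F := fun M j => csum (fun m => RtoC (/ INR (fact m)) * conv_pow a m j)%C M).
  assert (HF : forall M, PS (F M) w = csum (exp_term (PS a w)) M).
  { intros M; apply cser_unique.
    assert (Hl : clim (fun n => csum (fun m => RtoC (/ INR (fact m)) *
                    csum (fun j => conv_pow a m j * w ^ j) n)%C M) (csum (exp_term (PS a w)) M)).
    { apply (clim_csum (fun m n => RtoC (/ INR (fact m)) * csum (fun j => conv_pow a m j * w ^ j)%C n)%C).
      intros m; unfold exp_term; apply clim_scal.
      rewrite <- (PS_conv_pow a k A w m) by auto.
      apply (PS_clim _ (L ^ m)); auto; apply (wiener_conv_pow k a A m Ha). }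
    intros eps He; destruct (Hl eps He) as [N HN]; exists N; intros n Hn.
    specialize (HN n Hn).
    replace (csum (fun j => F M j * w ^ j)%C n) with
      (csum (fun m => RtoC (/ INR (fact m)) * csum (fun j => conv_pow a m j * w ^ j) n)%C M); auto.
    rewrite (csum_ext _ (fun m => csum (fun j => RtoC (/ INR (fact m)) * (conv_pow a m j * w ^ j))%C n))
      by (intros; symmetry; apply csum_scal).
    rewrite csum_swap; apply csum_ext; intros j _; unfold F.
    rewrite Cmult_comm, <- csum_scal; apply csum_ext; intros; ring. }
  set (g := fun j m => / INR (fact m) * Cmod (conv_pow a m j)).
  assert (Hf : forall m, 0 < / INR (fact m)) by (intros; apply Rinv_0_lt_compat, INR_fact_lt_0).
  assert (Hg : forall j m, 0 <= g j m).
  { intros; apply Rmult_le_pos; [left; apply Hf|apply Cmod_ge_0]. }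
  (* A majorant uniform in [M]: for [M >= j] the terms with [m > j] vanish, so the sum up to [j]
     already bounds every [F M j]. *)
  set (dom := fun j => RtoC (sum_f_R0 (g j) j)).
  assert (Edom : forall j, Cmod (dom j) = sum_f_R0 (g j) j).
  { intros j; unfold dom; rewrite Cmod_R, Rabs_right; [reflexivity|].
    apply Rle_ge, sum_nonneg, Hg. }
  assert (Hdom : l1 dom (exp L)).
  { intros n; apply Rle_trans with (sum_f_R0 (fun j => sum_f_R0 (g j) n) n).
    - apply sum_Rle; intros j Hj; rewrite Edom; apply sum_mono; auto.
    - rewrite sum_swap; eapply Rle_trans; [|apply (exp_partial_sum_le L n HL)].
      apply sum_Rle; intros m _; unfold g; rewrite sum_scal_l; unfold Rdiv; rewrite Rmult_comm.
      apply Rmult_le_compat_r; [left; apply Hf|]; apply (wiener_conv_pow k a A m Ha). }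
  apply clim_unique with (fun M => PS (F M) w).
  - apply (cser_dominated_convergence _ _ dom (exp L) Hdom).
    + intros M j; eapply Rle_trans; [apply Cmod_term_le, Hw|].
      assert (HFg : forall N, Cmod (F N j) <= sum_f_R0 (g j) N).
      { intros N; unfold F, g; eapply Rle_trans; [apply Cmod_csum|]; right; apply sum_eq; intros m _.
        rewrite Cmod_mult, Cmod_R, Rabs_right; [reflexivity|]; apply Rle_ge; left; apply Hf. }
      rewrite Edom; destruct (Nat.le_ge_cases M j) as [HM|HM].
      * eapply Rle_trans; [apply HFg|]; apply sum_mono; auto.
      * replace (F M j) with (F j j); [apply HFg|].
        apply (exp_coef_extend a j M Ha0 HM).
    + intros j; exists j; intros M HM; unfold F; rewrite <- exp_coef_extend; auto.
  - intros eps He; destruct (cexp_taylor (PS a w) eps He) as [N HN]; exists N.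
    intros n Hn; rewrite HF; apply HN, Hn.
Qed.

(** * Means over the circle *)

Definition rcont (g : R -> R) : Prop := forall t, continuous g t.

Definition ccont (F : R -> CC) : Prop :=
  rcont (fun t => fst (F t)) /\ rcont (fun t => snd (F t)).

Lemma rcont_ext (f g : R -> R) : (forall t, f t = g t) -> rcont f -> rcont g.
Proof. intros H Hf t; apply (continuous_ext f); auto. Qed.

Lemma rcont_const (c : R) : rcont (fun _ => c).
Proof. intros t; apply continuous_const. Qed.

Lemma rcont_plus (f g : R -> R) : rcont f -> rcont g -> rcont (fun t => f t + g t).
Proof. intros Hf Hg t; apply (continuous_plus f g); auto. Qed.

Lemma rcont_opp (f : R -> R) : rcont f -> rcont (fun t => - f t).
Proof. intros Hf t; apply (continuous_opp f); auto. Qed.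

Lemma rcont_minus (f g : R -> R) : rcont f -> rcont g -> rcont (fun t => f t - g t).
Proof. intros Hf Hg t; apply (continuous_minus f g); auto. Qed.

Lemma rcont_mult (f g : R -> R) : rcont f -> rcont g -> rcont (fun t => f t * g t).
Proof. intros Hf Hg t; apply (continuous_mult f g); auto. Qed.

Lemma rcont_comp (f g : R -> R) : rcont f -> rcont g -> rcont (fun t => g (f t)).
Proof. intros Hf Hg t; apply (continuous_comp f g); auto. Qed.

Lemma rcont_derive (f : R -> R) : (forall t, ex_derive f t) -> rcont f.
Proof. intros H t; apply (ex_derive_continuous f), H. Qed.

Lemma rcont_pow (f : R -> R) n : rcont f -> rcont (fun t => f t ^ n).
Proof.
  intros Hf; induction n as [|n IH]; simpl; [apply rcont_const|apply rcont_mult; auto].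
Qed.

Lemma rcont_ex_RInt (g : R -> R) a b : rcont g -> ex_RInt g a b.
Proof. intros H; apply (ex_RInt_continuous g); auto. Qed.

Lemma rcont_eps (g : R -> R) : rcont g <->
  forall t eps, 0 < eps -> exists d, 0 < d /\ forall s, Rabs (s - t) < d -> Rabs (g s - g t) <= eps.
Proof.
  split.
  - intros H t eps He; specialize (H t).
    apply continuity_pt_filterlim in H; destruct (H eps He) as [d [Hd K]].
    exists d; split; [exact Hd|]; intros s Hs.
    destruct (Req_dec s t) as [->|Hne]; [rewrite Rminus_diag, Rabs_R0; lra|].
    left; apply K; split; [split; [exact I|auto]|exact Hs].
  - intros H t; apply continuity_pt_filterlim; intros eps He.
    destruct (H t (eps / 2) ltac:(lra)) as [d [Hd K]]; exists d; split; [exact Hd|].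
    intros s [_ Hs]; specialize (K s Hs); unfold Rdist; simpl in *; unfold Rdist in *; lra.
Qed.

Lemma ccont_const (c : CC) : ccont (fun _ => c).
Proof. split; apply rcont_const. Qed.

Lemma ccont_plus (F G : R -> CC) : ccont F -> ccont G -> ccont (fun t => F t + G t)%C.
Proof. intros [H1 H2] [K1 K2]; split; simpl; apply rcont_plus; auto. Qed.

Lemma ccont_minus (F G : R -> CC) : ccont F -> ccont G -> ccont (fun t => F t - G t)%C.
Proof.
  intros [H1 H2] [K1 K2]; split; simpl; apply rcont_plus; auto; apply rcont_opp; auto.
Qed.

Lemma ccont_mult (F G : R -> CC) : ccont F -> ccont G -> ccont (fun t => F t * G t)%C.
Proof.
  intros [H1 H2] [K1 K2]; split; simpl;
    [apply rcont_minus|apply rcont_plus]; apply rcont_mult; auto.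
Qed.

Lemma ccont_conj (F : R -> CC) : ccont F -> ccont (fun t => Cconj (F t)).
Proof. intros [H1 H2]; split; simpl; [auto|apply rcont_opp; auto]. Qed.

Lemma ccont_RtoC (g : R -> R) : rcont g -> ccont (fun t => RtoC (g t)).
Proof. intros H; split; simpl; [auto|apply rcont_const]. Qed.

Lemma ccont_eit (x : R) : ccont (fun t => eit (x * t)).
Proof.
  split; simpl; apply rcont_derive; intros t; auto_derive; auto.
Qed.

Lemma ccont_csum (F : nat -> R -> CC) n :
  (forall j, ccont (F j)) -> ccont (fun t => csum (fun j => F j t) n).
Proof.
  intros H; induction n as [|n IH]; simpl; [apply H|apply ccont_plus; auto].
Qed.

Lemma ccont_ext (F G : R -> CC) : (forall t, F t = G t) -> ccont F -> ccont G.
Proof.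
  intros H [H1 H2]; split; [eapply rcont_ext; [|exact H1]|eapply rcont_ext; [|exact H2]];
    intros; simpl; rewrite H; reflexivity.
Qed.

Lemma rcont_Cmod_sqr (F : R -> CC) : ccont F -> rcont (fun t => Cmod (F t) ^ 2).
Proof.
  intros [H1 H2]; apply rcont_ext with (fun t => fst (F t) ^ 2 + snd (F t) ^ 2).
  - intros; symmetry; apply Cmod_sqr.
  - apply rcont_plus; apply rcont_pow; auto.
Qed.

Lemma ccont_uniform_limit (F : R -> CC) :
  (forall eps, 0 < eps -> exists G, ccont G /\ forall t, Cmod (F t - G t) <= eps) -> ccont F.
Proof.
  intros H; split; apply rcont_eps; intros t eps He;
    destruct (H (eps / 3) ltac:(lra)) as [G [[G1 G2] HG]].
  - destruct (proj1 (rcont_eps _) G1 t (eps / 3) ltac:(lra)) as [d [Hd K]].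
    exists d; split; [exact Hd|]; intros s Hs; specialize (K s Hs).
    pose proof (Rle_trans _ _ _ (Cmod_fst (F s - G s)) (HG s)) as P1.
    pose proof (Rle_trans _ _ _ (Cmod_fst (F t - G t)) (HG t)) as P2.
    simpl in P1, P2; revert P1 P2 K; unfold Rabs; repeat destruct Rcase_abs; lra.
  - destruct (proj1 (rcont_eps _) G2 t (eps / 3) ltac:(lra)) as [d [Hd K]].
    exists d; split; [exact Hd|]; intros s Hs; specialize (K s Hs).
    pose proof (Rle_trans _ _ _ (Cmod_snd (F s - G s)) (HG s)) as P1.
    pose proof (Rle_trans _ _ _ (Cmod_snd (F t - G t)) (HG t)) as P2.
    simpl in P1, P2; revert P1 P2 K; unfold Rabs; repeat destruct Rcase_abs; lra.
Qed.

Definition rmean (g : R -> R) : R := / (2 * PI) * RInt g (- PI) PI.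

Lemma rmean_ext (f g : R -> R) : (forall t, f t = g t) -> rmean f = rmean g.
Proof. intros H; unfold rmean; f_equal; apply RInt_ext; auto. Qed.

Lemma rmean_plus (f g : R -> R) : rcont f -> rcont g ->
  rmean (fun t => f t + g t) = rmean f + rmean g.
Proof.
  intros Hf Hg; unfold rmean; rewrite <- Rmult_plus_distr_l; f_equal.
  apply (RInt_plus f g); apply rcont_ex_RInt; auto.
Qed.

Lemma rmean_scal (c : R) (f : R -> R) : rcont f -> rmean (fun t => c * f t) = c * rmean f.
Proof.
  intros Hf; unfold rmean.
  replace (c * (/ (2 * PI) * RInt f (- PI) PI)) with (/ (2 * PI) * (c * RInt f (- PI) PI)) by ring.
  f_equal; apply (RInt_scal f); apply rcont_ex_RInt; auto.
Qed.

Lemma rmean_minus (f g : R -> R) : rcont f -> rcont g ->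
  rmean (fun t => f t - g t) = rmean f - rmean g.
Proof.
  intros Hf Hg; unfold rmean; rewrite <- Rmult_minus_distr_l; f_equal.
  apply (RInt_minus f g); apply rcont_ex_RInt; auto.
Qed.

Lemma rmean_opp (f : R -> R) : rcont f -> rmean (fun t => - f t) = - rmean f.
Proof.
  intros Hf; rewrite (rmean_ext _ (fun t => (-1) * f t)) by (intros; ring).
  rewrite rmean_scal by auto; ring.
Qed.

Lemma rmean_const (c : R) : rmean (fun _ => c) = c.
Proof.
  unfold rmean; rewrite RInt_const; unfold scal; simpl; unfold mult; simpl.
  field; apply PI_neq0.
Qed.

Lemma rmean_le (f g : R -> R) : rcont f -> rcont g ->
  (forall t, - PI <= t <= PI -> f t <= g t) -> rmean f <= rmean g.
Proof.
  intros Hf Hg H; unfold rmean; pose proof PI_RGT_0.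
  apply Rmult_le_compat_l; [left; apply Rinv_0_lt_compat; lra|].
  apply RInt_le; [lra|apply rcont_ex_RInt; auto|apply rcont_ex_RInt; auto|].
  intros; apply H; lra.
Qed.

Lemma rmean_nonneg (f : R -> R) : rcont f -> (forall t, 0 <= f t) -> 0 <= rmean f.
Proof.
  intros Hf H; rewrite <- (rmean_const 0); apply rmean_le; auto; apply rcont_const.
Qed.

Lemma RInt_shift (g : R -> R) (h a b : R) : rcont g ->
  RInt (fun t => g (t + h)) a b = RInt g (a + h) (b + h).
Proof.
  intros Hg.
  pose proof (RInt_comp_lin g 1 h a b) as E.
  replace (1 * a + h) with (a + h) in E by ring; replace (1 * b + h) with (b + h) in E by ring.
  rewrite <- E by (apply rcont_ex_RInt; auto).
  apply RInt_ext; intros x _; unfold scal; simpl; unfold mult; simpl.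
  rewrite !Rmult_1_l; reflexivity.
Qed.

Lemma rmean_shift (g : R -> R) (h : R) : rcont g -> (forall t, g (t + 2 * PI) = g t) ->
  rmean (fun t => g (t + h)) = rmean g.
Proof.
  intros Hg Hp; unfold rmean; f_equal; rewrite RInt_shift by auto.
  assert (E : RInt g (- PI) (- PI + h) = RInt g PI (PI + h)).
  { replace (RInt g PI (PI + h)) with (RInt g (- PI + 2 * PI) ((- PI + h) + 2 * PI))
      by (f_equal; ring).
    rewrite <- RInt_shift by auto; apply RInt_ext; intros; symmetry; apply Hp. }
  assert (X : forall a b, ex_RInt g a b) by (intros; apply rcont_ex_RInt; auto).
  pose proof (RInt_Chasles g (- PI) (- PI + h) (PI + h) (X _ _) (X _ _)) as C1.
  pose proof (RInt_Chasles g (- PI) PI (PI + h) (X _ _) (X _ _)) as C2.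
  unfold plus in C1, C2; simpl in C1, C2; lra.
Qed.

Definition cmean (F : R -> CC) : CC := (rmean (fun t => fst (F t)), rmean (fun t => snd (F t))).

(** The bridge from the complex-valued integrals in [inner] and [fourier] to pairs of real means. *)
Lemma cmean_RInt (F : R -> CC) : ccont F ->
  (RtoC (/ (2 * PI)) * RInt (V := C_R_CompleteNormedModule) F (- PI) PI)%C = cmean F.
Proof.
  intros [H1 H2].
  assert (E : RInt (V := C_R_CompleteNormedModule) F (- PI) PI
    = (RInt (fun t => fst (F t)) (- PI) PI, RInt (fun t => snd (F t)) (- PI) PI)).
  { apply is_RInt_unique.
    apply (is_RInt_fct_extend_pair (U := R_NormedModule) (V := R_NormedModule) F);
      apply (RInt_correct (V := R_CompleteNormedModule)), rcont_ex_RInt; auto. }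
  rewrite E; unfold cmean, rmean, RtoC, Cmult; simpl; f_equal; ring.
Qed.

Lemma cmean_ext (F G : R -> CC) : (forall t, F t = G t) -> cmean F = cmean G.
Proof.
  intros H; unfold cmean; f_equal; apply rmean_ext; intros; rewrite H; reflexivity.
Qed.

Lemma cmean_plus (F G : R -> CC) : ccont F -> ccont G ->
  cmean (fun t => F t + G t)%C = (cmean F + cmean G)%C.
Proof.
  intros [H1 H2] [K1 K2]; unfold cmean, Cplus; simpl; f_equal; apply rmean_plus; auto.
Qed.

Lemma cmean_minus (F G : R -> CC) : ccont F -> ccont G ->
  cmean (fun t => F t - G t)%C = (cmean F - cmean G)%C.
Proof.
  intros [H1 H2] [K1 K2]; unfold cmean, Cminus, Cplus, Copp; simpl; f_equal;
    apply (rmean_minus (fun t => _) (fun t => _)); auto.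
Qed.

Lemma cmean_scal (c : CC) (F : R -> CC) : ccont F ->
  cmean (fun t => c * F t)%C = (c * cmean F)%C.
Proof.
  intros [H1 H2]; unfold cmean, Cmult; simpl; f_equal.
  - rewrite rmean_minus, !rmean_scal; auto;
      apply rcont_mult; auto; apply rcont_const.
  - rewrite rmean_plus, !rmean_scal; auto;
      apply rcont_mult; auto; apply rcont_const.
Qed.

Lemma cmean_conj (F : R -> CC) : ccont F -> cmean (fun t => Cconj (F t)) = Cconj (cmean F).
Proof. intros [H1 H2]; unfold cmean, Cconj; simpl; f_equal; apply rmean_opp; auto. Qed.

Lemma cmean_const (c : CC) : cmean (fun _ => c) = c.
Proof. unfold cmean; rewrite !rmean_const; destruct c; reflexivity. Qed.

Lemma cmean_csum (F : nat -> R -> CC) n : (forall j, ccont (F j)) ->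
  cmean (fun t => csum (fun j => F j t) n) = csum (fun j => cmean (F j)) n.
Proof.
  intros H; induction n as [|n IH]; simpl; [reflexivity|].
  rewrite cmean_plus, IH; auto; apply ccont_csum; auto.
Qed.

Lemma cmean_shift (F : R -> CC) (h : R) : ccont F -> (forall t, F (t + 2 * PI) = F t) ->
  cmean (fun t => F (t + h)) = cmean F.
Proof.
  intros [H1 H2] Hp; unfold cmean; f_equal.
  - apply (rmean_shift (fun t => fst (F t))); auto; intros; rewrite Hp; reflexivity.
  - apply (rmean_shift (fun t => snd (F t))); auto; intros; rewrite Hp; reflexivity.
Qed.

(** Multiplying by the conjugate of the mean [c] rotates it to the real axis: [|c|^2] is the mean of
    [Re (conj c * F)], which is at most [|c| B]. *)
Lemma Cmod_cmean_le (F : R -> CC) B : ccont F -> (forall t, Cmod (F t) <= B) -> Cmod (cmean F) <= B.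
Proof.
  intros HF HB.
  set (c := cmean F).
  assert (HB0 : 0 <= B) by (eapply Rle_trans; [apply Cmod_ge_0|apply (HB 0)]).
  assert (E : fst (Cconj c * cmean F)%C = Cmod c ^ 2).
  { rewrite Cmod_sqr; unfold c; simpl; ring. }
  assert (Hc : ccont (fun t => Cconj c * F t)%C) by (apply ccont_mult; auto; apply ccont_const).
  rewrite <- cmean_scal in E by auto; simpl in E.
  assert (Cmod c ^ 2 <= Cmod c * B).
  { simpl; simpl in E; rewrite <- E, <- (rmean_const (Cmod c * B)).
    apply rmean_le; [apply Hc|apply rcont_const|].
    intros t _; eapply Rle_trans; [apply Rle_abs|].
    eapply Rle_trans; [apply (Cmod_fst (Cconj c * F t)%C)|].
    rewrite Cmod_mult, Cmod_conj; apply Rmult_le_compat_l; [apply Cmod_ge_0|apply HB]. }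
  pose proof (Cmod_ge_0 c).
  destruct (Req_dec (Cmod c) 0) as [->|Hn]; [auto|nra].
Qed.

Lemma cmean_uniform_limit (F : R -> CC) (G : nat -> R -> CC) (l : CC) :
  ccont F -> (forall n, ccont (G n)) ->
  (forall eps, 0 < eps -> exists N, forall n t, (N <= n)%nat -> Cmod (F t - G n t) <= eps) ->
  clim (fun n => cmean (G n)) l -> cmean F = l.
Proof.
  intros HF HG HU Hl; symmetry; apply (clim_unique _ _ _ Hl).
  intros eps He; destruct (HU eps He) as [N HN]; exists N; intros n Hn.
  rewrite Cmod_sym, <- cmean_minus by auto; apply Cmod_cmean_le; auto.
  apply ccont_minus; auto.
Qed.

(** * The mean-square norm *)

Definition norm2 (F : R -> CC) : R := rmean (fun t => Cmod (F t) ^ 2).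

Lemma norm2_nonneg F : ccont F -> 0 <= norm2 F.
Proof. intros H; apply rmean_nonneg; [apply rcont_Cmod_sqr, H|intros; apply pow2_ge_0]. Qed.

Lemma norm2_ext F G : (forall t, F t = G t) -> norm2 F = norm2 G.
Proof. intros H; apply rmean_ext; intros; rewrite H; reflexivity. Qed.

Lemma norm2_minus (F G : R -> CC) : ccont F -> ccont G ->
  norm2 (fun t => F t - G t)%C
  = norm2 F - 2 * fst (cmean (fun t => F t * Cconj (G t))%C) + norm2 G.
Proof.
  intros HF HG; unfold norm2.
  assert (HC : ccont (fun t => F t * Cconj (G t))%C) by (apply ccont_mult; auto; apply ccont_conj; auto).
  destruct HC as [HC _].
  rewrite (rmean_ext _ (fun t => (Cmod (F t) ^ 2 - 2 * fst (F t * Cconj (G t))%C) + Cmod (G t) ^ 2)).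
  - rewrite rmean_plus, rmean_minus, rmean_scal; auto using rcont_Cmod_sqr.
    + apply rcont_mult; auto; apply rcont_const.
    + apply rcont_minus; [apply rcont_Cmod_sqr; auto|].
      apply rcont_mult; auto; apply rcont_const.
  - intros t; rewrite !Cmod_sqr; destruct (F t), (G t); simpl; ring.
Qed.

Lemma norm2_scal (c : CC) (F : R -> CC) : ccont F ->
  norm2 (fun t => c * F t)%C = Cmod c ^ 2 * norm2 F.
Proof.
  intros HF; unfold norm2; rewrite <- rmean_scal by (apply rcont_Cmod_sqr; auto).
  apply rmean_ext; intros; rewrite Cmod_mult; ring.
Qed.

Lemma cmean_self (F : R -> CC) : cmean (fun t => F t * Cconj (F t))%C = RtoC (norm2 F).
Proof.
  unfold cmean, RtoC, norm2; f_equal.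
  - apply rmean_ext; intros; rewrite Cmod_sqr; destruct (F t); simpl; ring.
  - rewrite <- (rmean_const 0); apply rmean_ext; intros; destruct (F t); simpl; ring.
Qed.

Lemma norm2_mult_le (F G : R -> CC) B : ccont F -> ccont G -> (forall t, Cmod (G t) <= B) ->
  norm2 (fun t => F t * G t)%C <= B ^ 2 * norm2 F.
Proof.
  intros HF HG HB; unfold norm2; rewrite <- rmean_scal by (apply rcont_Cmod_sqr; auto).
  apply rmean_le.
  - apply rcont_Cmod_sqr, ccont_mult; auto.
  - apply rcont_mult; [apply rcont_const|apply rcont_Cmod_sqr; auto].
  - intros t _; rewrite Cmod_mult, Rpow_mult_distr, Rmult_comm.
    apply Rmult_le_compat_r; [apply pow2_ge_0|].
    apply pow_incr; split; [apply Cmod_ge_0|auto].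
Qed.

(** The squared norm of [F - s c G] is nonnegative for every real [s], where [c] is the inner
    product itself, so that only a real quadratic in [s] remains. *)
Lemma cmean_cauchy_schwarz (F G : R -> CC) : ccont F -> ccont G ->
  Cmod (cmean (fun t => F t * Cconj (G t))%C) ^ 2 <= norm2 F * norm2 G.
Proof.
  intros HF HG.
  set (c := cmean (fun t => F t * Cconj (G t))%C).
  assert (HC : ccont (fun t => F t * Cconj (G t))%C) by (apply ccont_mult; auto; apply ccont_conj; auto).
  assert (Q : forall s : R, 0 <= norm2 F - 2 * s * Cmod c ^ 2 + s ^ 2 * Cmod c ^ 2 * norm2 G).
  { intros s.
    assert (HG' : ccont (fun t => (RtoC s * c) * G t)%C) by (apply ccont_mult; auto; apply ccont_const).
    assert (H := norm2_nonneg _ (ccont_minus _ _ HF HG')).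
    rewrite norm2_minus, norm2_scal in H by auto.
    replace (cmean (fun t => F t * Cconj (RtoC s * c * G t))%C) with (RtoC s * Cconj c * c)%C in H.
    - replace (fst (RtoC s * Cconj c * c)%C) with (s * Cmod c ^ 2) in H
        by (rewrite Cmod_sqr; destruct c; simpl; ring).
      rewrite Cmod_mult, Cmod_R, Rpow_mult_distr, pow2_abs in H.
      lra.
    - rewrite <- Cmult_assoc; unfold c at 2; rewrite Cmult_assoc, <- cmean_scal by auto.
      apply cmean_ext; intros t; rewrite !Cmult_conj.
      replace (Cconj (RtoC s)) with (RtoC s); [ring|].
      unfold Cconj, RtoC; simpl; f_equal; ring. }
  pose proof (norm2_nonneg F HF) as PF; pose proof (norm2_nonneg G HG) as PG.
  pose proof (pow2_ge_0 (Cmod c)) as Pc.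
  set (x := Cmod c ^ 2) in *; set (f := norm2 F) in *; set (g := norm2 G) in *.
  destruct (Req_dec g 0) as [E|E].
  - rewrite E in *; destruct (Req_dec x 0) as [->|Ex]; [lra|].
    (* With [g = 0] the quadratic is linear in [s], and this [s] would give it the value -1. *)
    specialize (Q ((f + 1) / (2 * x))).
    replace (2 * ((f + 1) / (2 * x)) * x) with (f + 1) in Q by (field; auto); lra.
  - specialize (Q (/ g)).
    replace (f - 2 * / g * x + (/ g) ^ 2 * x * g) with (f - x / g) in Q by (field; auto).
    assert (x / g <= f) by lra.
    replace x with (x / g * g) by (field; auto).
    apply Rmult_le_compat_r; lra.
Qed.

(** * Fourier analysis on the circle *)

Lemma eit_plus (s t : R) : eit (s + t) = (eit s * eit t)%C.
Proof. unfold eit, Cmult; simpl; rewrite cos_plus, sin_plus; f_equal; ring. Qed.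

Lemma eit_0 : eit 0 = RtoC 1.
Proof. unfold eit; rewrite cos_0, sin_0; reflexivity. Qed.

Lemma Cmod_eit (t : R) : Cmod (eit t) = 1.
Proof.
  unfold Cmod, eit; simpl fst; simpl snd.
  replace (cos t ^ 2 + sin t ^ 2) with 1; [apply sqrt_1|].
  pose proof (sin2_cos2 t) as H; unfold Rsqr in H; lra.
Qed.

Lemma eit_conj (t : R) : Cconj (eit t) = eit (- t).
Proof. unfold eit, Cconj; simpl; rewrite cos_neg, sin_neg; reflexivity. Qed.

Lemma eit_pow (t : R) m : (eit t ^ m)%C = eit (INR m * t).
Proof.
  induction m as [|m IH]; [simpl; rewrite Rmult_0_l, eit_0; reflexivity|].
  rewrite Cpow_S, IH, <- eit_plus, S_INR; f_equal; ring.
Qed.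

Lemma eit_period (j : Z) (t : R) : eit (IZR j * (t + 2 * PI)) = eit (IZR j * t).
Proof.
  rewrite Rmult_plus_distr_l, eit_plus.
  replace (eit (IZR j * (2 * PI))) with (RtoC 1); [ring|].
  unfold eit; replace (IZR j * (2 * PI)) with (2 * (IZR j * PI)) by ring.
  assert (S0 : sin (IZR j * PI) = 0) by (apply sin_eq_0_1; exists j; reflexivity).
  rewrite cos_2a, sin_2a, S0.
  pose proof (sin2_cos2 (IZR j * PI)) as H; rewrite S0 in H; unfold Rsqr in H.
  unfold RtoC; f_equal; lra.
Qed.

(* The characters [w ^ m] at [w = 1 / z], [z = e^(it)]. *)
Definition em (m : nat) (t : R) : CC := (eit (- t) ^ m)%C.

Lemma em_eit m t : em m t = eit (IZR (- Z.of_nat m) * t).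
Proof. unfold em; rewrite eit_pow, opp_IZR, <- INR_IZR_INZ; f_equal; ring. Qed.

Lemma em_conj m t : Cconj (em m t) = eit (IZR (Z.of_nat m) * t).
Proof. rewrite em_eit, eit_conj, opp_IZR; f_equal; ring. Qed.

Lemma Cmod_em m t : Cmod (em m t) = 1.
Proof. rewrite em_eit; apply Cmod_eit. Qed.

Lemma ccont_em m : ccont (em m).
Proof.
  apply ccont_ext with (fun t => eit (IZR (- Z.of_nat m) * t)).
  - intros; symmetry; apply em_eit.
  - apply ccont_eit.
Qed.

Lemma em_mult i j t : (em i t * em j t)%C = em (i + j) t.
Proof. unfold em; rewrite Cpow_add_r; reflexivity. Qed.

Lemma cmean_eit (j : Z) : j <> 0%Z -> cmean (fun t => eit (IZR j * t)) = RtoC 0.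
Proof.
  intros Hj; assert (Hx : IZR j <> 0) by (apply not_0_IZR, Hj).
  assert (S0 : sin (IZR j * PI) = 0) by (apply sin_eq_0_1; exists j; reflexivity).
  unfold cmean, RtoC, rmean, eit; simpl; f_equal.
  - rewrite (is_RInt_unique _ _ _ (minus (sin (IZR j * PI) / IZR j) (sin (IZR j * - PI) / IZR j))).
    + unfold minus, plus, opp; simpl.
      replace (IZR j * - PI) with (- (IZR j * PI)) by ring.
      rewrite sin_neg, S0; field; split; [exact Hx|apply PI_neq0].
    + apply (is_RInt_derive (fun t => sin (IZR j * t) / IZR j)).
      * intros x _; auto_derive; [trivial|]; field; exact Hx.
      * intros x _; apply (ccont_eit (IZR j)).
  - rewrite (is_RInt_unique _ _ _ (minus (- cos (IZR j * PI) / IZR j) (- cos (IZR j * - PI) / IZR j))).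
    + unfold minus, plus, opp; simpl.
      replace (IZR j * - PI) with (- (IZR j * PI)) by ring.
      rewrite cos_neg; field; split; [exact Hx|apply PI_neq0].
    + apply (is_RInt_derive (fun t => - cos (IZR j * t) / IZR j)).
      * intros x _; auto_derive; [trivial|]; field; exact Hx.
      * intros x _; apply (ccont_eit (IZR j)).
Qed.

Lemma cmean_em m : (0 < m)%nat -> cmean (em m) = RtoC 0.
Proof.
  intros Hm; rewrite (cmean_ext _ (fun t => eit (IZR (- Z.of_nat m) * t))) by (intros; apply em_eit).
  apply cmean_eit; lia.
Qed.

Lemma em_conj_mult i j t :
  (em i t * Cconj (em j t))%C = eit (IZR (Z.of_nat j - Z.of_nat i) * t).
Proof.
  rewrite em_conj, em_eit, <- eit_plus, <- Rmult_plus_distr_r, <- plus_IZR; do 3 f_equal; lia.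
Qed.

Lemma em_norm i t : (em i t * Cconj (em i t))%C = RtoC 1.
Proof. rewrite em_conj_mult, Z.sub_diag, Rmult_0_l; apply eit_0. Qed.

(** The coefficient of [w ^ m], that is, the Fourier coefficient of index [-m]. Nonnegative powers
    of [w] suffice for [f] and [D], and for real functions the other coefficients follow by
    conjugation. *)
Definition fcoef (F : R -> CC) (m : nat) : CC := cmean (fun t => F t * Cconj (em m t))%C.

Lemma fcoef_em_same m : fcoef (em m) m = RtoC 1.
Proof.
  unfold fcoef; rewrite (cmean_ext _ (fun _ => RtoC 1)) by (intros; apply em_norm).
  apply cmean_const.
Qed.

Lemma fcoef_em_diff i j : i <> j -> fcoef (em i) j = RtoC 0.
Proof.
  intros H; unfold fcoef.
  rewrite (cmean_ext _ (fun t => eit (IZR (Z.of_nat j - Z.of_nat i) * t)))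
    by (intros; apply em_conj_mult).
  apply cmean_eit; lia.
Qed.

Lemma ccont_fcoef F m : ccont F -> ccont (fun t => F t * Cconj (em m t))%C.
Proof. intros H; apply ccont_mult; auto; apply ccont_conj, ccont_em. Qed.

Definition trig (r : nat -> CC) (n : nat) (t : R) : CC := csum (fun j => r j * em j t)%C n.

Lemma ccont_trig r n : ccont (trig r n).
Proof. apply ccont_csum; intros j; apply ccont_mult; [apply ccont_const|apply ccont_em]. Qed.

Lemma fcoef_trig_above r n m : (n < m)%nat -> fcoef (trig r n) m = RtoC 0.
Proof.
  intros H; unfold fcoef, trig.
  rewrite (cmean_ext _ (fun t => csum (fun j => r j * (em j t * Cconj (em m t)))%C n)).
  - rewrite cmean_csum.
    + apply csum_0; intros j Hj; rewrite cmean_scal by (apply ccont_fcoef, ccont_em).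
      change (cmean (fun t => em j t * Cconj (em m t))%C) with (fcoef (em j) m).
      rewrite fcoef_em_diff by lia; ring.
    + intros j; apply ccont_mult; [apply ccont_const|apply ccont_fcoef, ccont_em].
  - intros t; rewrite Cmult_comm, <- csum_scal; apply csum_ext; intros; ring.
Qed.

Lemma norm2_em (c : CC) m : norm2 (fun t => c * em m t)%C = Cmod c ^ 2.
Proof.
  unfold norm2; rewrite <- (rmean_const (Cmod c ^ 2)); apply rmean_ext; intros t.
  rewrite Cmod_mult, Cmod_em, Rmult_1_r; reflexivity.
Qed.

Lemma norm2_sub_em (F : R -> CC) (c : CC) m : ccont F ->
  norm2 (fun t => F t - c * em m t)%C
  = norm2 F - 2 * fst (Cconj c * fcoef F m)%C + Cmod c ^ 2.
Proof.
  intros HF; rewrite norm2_minus, norm2_em; auto.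
  - do 4 f_equal; unfold fcoef; rewrite <- cmean_scal by (apply ccont_fcoef; auto).
    apply cmean_ext; intros t; rewrite Cmult_conj; ring.
  - apply ccont_mult; [apply ccont_const|apply ccont_em].
Qed.

(** Characters are removed one at a time; what has been removed before is orthogonal to the next
    character and leaves its coefficient unchanged. *)
Lemma bessel_identity (F : R -> CC) n : ccont F ->
  norm2 (fun t => F t - trig (fcoef F) n t)%C
  = norm2 F - sum_f_R0 (fun j => Cmod (fcoef F j) ^ 2) n.
Proof.
  intros HF.
  assert (K : forall G m, ccont G -> fcoef G m = fcoef F m ->
    norm2 (fun t => G t - fcoef F m * em m t)%C = norm2 G - Cmod (fcoef F m) ^ 2).
  { intros G m HG E; rewrite norm2_sub_em, E by auto.
    replace (fst (Cconj (fcoef F m) * fcoef F m)%C) with (Cmod (fcoef F m) ^ 2); [ring|].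
    rewrite Cmod_sqr; destruct (fcoef F m); simpl; ring. }
  induction n as [|n IH].
  - apply (K F O); auto.
  - rewrite tech5.
    assert (HG : ccont (fun t => F t - trig (fcoef F) n t)%C)
      by (apply ccont_minus; auto; apply ccont_trig).
    rewrite (norm2_ext _ (fun t => (F t - trig (fcoef F) n t) - fcoef F (S n) * em (S n) t)%C).
    + rewrite K, IH; auto; [ring|].
      unfold fcoef at 1.
      rewrite (cmean_ext _ (fun t => F t * Cconj (em (S n) t)
                           - trig (fcoef F) n t * Cconj (em (S n) t))%C) by (intros; ring).
      rewrite cmean_minus by (apply ccont_fcoef; auto; apply ccont_trig).
      fold (fcoef (trig (fcoef F) n) (S n)); fold (fcoef F (S n)).
      rewrite fcoef_trig_above by lia; ring.
    + intros t; unfold trig; simpl; ring.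
Qed.

Lemma bessel (F : R -> CC) n : ccont F ->
  sum_f_R0 (fun j => Cmod (fcoef F j) ^ 2) n <= norm2 F.
Proof.
  intros HF.
  assert (H := norm2_nonneg _ (ccont_minus _ _ HF (ccont_trig (fcoef F) n))).
  rewrite bessel_identity in H by auto; lra.
Qed.

Lemma norm2_trig r n : norm2 (trig r n) = sum_f_R0 (fun j => Cmod (r j) ^ 2) n.
Proof.
  induction n as [|n IH].
  - apply norm2_em.
  - rewrite tech5, <- IH.
    rewrite (norm2_ext _ (fun t => trig r n t - (- r (S n)) * em (S n) t)%C)
      by (intros; unfold trig; simpl; ring).
    rewrite norm2_sub_em, fcoef_trig_above, Cmod_opp by (auto; apply ccont_trig).
    simpl; ring.
Qed.

Definition cPS (r : nat -> CC) (t : R) : CC := PS r (eit (- t)).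

Lemma trig_uniform (r : nat -> CC) B : l1 r B -> forall eps, 0 < eps ->
  exists N, forall n t, (N <= n)%nat -> Cmod (cPS r t - trig r n t) <= eps.
Proof.
  intros Hr eps He; destruct (PS_uniform r B Hr eps He) as [N HN].
  exists N; intros n t Hn; apply HN; [exact Hn|rewrite Cmod_eit; lra].
Qed.

Lemma cPS_bound r B t : l1 r B -> Cmod (cPS r t) <= B.
Proof. intros H; apply PS_bound; auto; rewrite Cmod_eit; lra. Qed.

Lemma ccont_cPS r B : l1 r B -> ccont (cPS r).
Proof.
  intros Hr; apply ccont_uniform_limit; intros eps He.
  destruct (trig_uniform r B Hr eps He) as [N HN].
  exists (trig r N); split; [apply ccont_trig|intros; apply HN; lia].
Qed.

(** Termwise integration, justified by uniform convergence on the circle. *)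
Lemma cmean_cPS_mult (r : nat -> CC) B (X : R -> CC) l : l1 r B -> ccont X ->
  (forall t, Cmod (X t) <= 1) ->
  clim (csum (fun j => r j * cmean (fun t => em j t * X t))%C) l ->
  cmean (fun t => cPS r t * X t)%C = l.
Proof.
  intros Hr HX HX1 Hl.
  apply (cmean_uniform_limit _ (fun n t => trig r n t * X t)%C).
  - apply ccont_mult; auto; apply (ccont_cPS r B Hr).
  - intros n; apply ccont_mult; auto; apply ccont_trig.
  - intros eps He; destruct (trig_uniform r B Hr eps He) as [N HN].
    exists N; intros n t Hn; specialize (HN n t Hn).
    replace (cPS r t * X t - trig r n t * X t)%C with ((cPS r t - trig r n t) * X t)%C by ring.
    rewrite Cmod_mult; pose proof (Cmod_ge_0 (cPS r t - trig r n t)); specialize (HX1 t).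
    pose proof (Cmod_ge_0 (X t)); nra.
  - intros eps He; destruct (Hl eps He) as [N HN]; exists N; intros n Hn; specialize (HN n Hn).
    replace (cmean (fun t => trig r n t * X t)%C)
      with (csum (fun j => r j * cmean (fun t => em j t * X t))%C n); auto.
    rewrite (cmean_ext _ (fun t => csum (fun j => r j * (em j t * X t))%C n)).
    + rewrite cmean_csum.
      * apply csum_ext; intros j _; rewrite cmean_scal; auto.
        apply ccont_mult; auto; apply ccont_em.
      * intros j; apply ccont_mult; [apply ccont_const|apply ccont_mult; auto; apply ccont_em].
    + intros t; unfold trig; rewrite Cmult_comm, <- csum_scal; apply csum_ext; intros; ring.
Qed.

Lemma fcoef_cPS r B m : l1 r B -> fcoef (cPS r) m = r m.
Proof.
  intros Hr; apply (cmean_cPS_mult r B); auto.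
  - apply ccont_conj, ccont_em.
  - intros; rewrite Cmod_conj, Cmod_em; lra.
  - intros eps He; exists m; intros n Hn.
    assert (E : forall k, csum (fun j => r j * cmean (fun t => em j t * Cconj (em m t)))%C k
                  = if le_dec m k then r m else RtoC 0).
    { intros k.
      assert (Hd : forall j, cmean (fun t => em j t * Cconj (em m t))%C
                     = if Nat.eq_dec j m then RtoC 1 else RtoC 0).
      { intros j; change (fcoef (em j) m = if Nat.eq_dec j m then RtoC 1 else RtoC 0).
        destruct (Nat.eq_dec j m) as [->|Hne]; [apply fcoef_em_same|apply fcoef_em_diff; auto]. }
      induction k as [|k IH]; simpl csum.
      - rewrite Hd; destruct (Nat.eq_dec 0 m) as [<-|];
          repeat destruct le_dec; try lia; ring.
      - rewrite IH, Hd; destruct (Nat.eq_dec (S k) m) as [<-|];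
          repeat destruct le_dec; try lia; ring. }
    rewrite E; destruct (le_dec m n); [|lia].
    replace (r m - r m)%C with (RtoC 0) by ring; rewrite Cmod_0; lra.
Qed.

(** Either alternative makes the product a power series in [w] without constant term. The first
    serves [A] in the inversion formula, the second serves [D] in the orthogonality relation. *)
Lemma cmean_cPS_em r B m : l1 r B -> (r O = RtoC 0 \/ (0 < m)%nat) ->
  cmean (fun t => cPS r t * em m t)%C = RtoC 0.
Proof.
  intros Hr Hm; apply (cmean_cPS_mult r B); auto.
  - apply ccont_em.
  - intros; rewrite Cmod_em; lra.
  - intros eps He; exists O; intros n Hn; rewrite csum_0.
    + replace (RtoC 0 - RtoC 0)%C with (RtoC 0) by ring; rewrite Cmod_0; lra.
    + intros j _; rewrite (cmean_ext _ (em (j + m))) by (intros; apply em_mult).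
      destruct (Nat.eq_dec (j + m) 0) as [E|E].
      * destruct Hm as [H0|H0]; [|lia]; replace j with O by lia; rewrite H0; ring.
      * rewrite cmean_em by lia; ring.
Qed.

(** One half of Parseval's identity, carried over from trigonometric polynomials by uniform
    approximation. *)
Lemma norm2_cPS_le r B Q : l1 r B ->
  (forall n, sum_f_R0 (fun j => Cmod (r j) ^ 2) n <= Q) -> norm2 (cPS r) <= Q.
Proof.
  intros Hr HQ; apply le_epsilon; intros e He.
  pose proof (l1_nonneg r B Hr) as HB.
  (* Both moduli are at most [B], so the difference of their squares is at most [2 B] times the
     approximation error. *)
  assert (Hd : 0 < e / (2 * B + 1)) by (apply Rdiv_lt_0_compat; lra).
  destruct (trig_uniform r B Hr _ Hd) as [N HN].
  apply Rle_trans with (norm2 (trig r N) + e); [|rewrite norm2_trig; specialize (HQ N); lra].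
  unfold norm2; rewrite <- (rmean_const e), <- rmean_plus.
  - apply rmean_le; [apply rcont_Cmod_sqr, (ccont_cPS r B Hr)| |].
    + apply rcont_plus; [apply rcont_Cmod_sqr, ccont_trig|apply rcont_const].
    + intros t _; specialize (HN N t (le_n _)).
      pose proof (cPS_bound r B t Hr) as H1.
      assert (H2 : Cmod (trig r N t) <= B).
      { unfold trig; eapply Rle_trans; [apply Cmod_csum|].
        eapply Rle_trans; [|apply (Hr N)]; right; apply sum_eq; intros.
        rewrite Cmod_mult, Cmod_em; ring. }
      assert (H3 : Cmod (cPS r t) <= Cmod (trig r N t) + e / (2 * B + 1)).
      { replace (cPS r t) with (trig r N t + (cPS r t - trig r N t))%C by ring.
        eapply Rle_trans; [apply Cmod_triangle|]; lra. }
      pose proof (Cmod_ge_0 (cPS r t)); pose proof (Cmod_ge_0 (trig r N t)).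
      set (x := Cmod (cPS r t)) in *; set (y := Cmod (trig r N t)) in *.
      assert ((x - y) * (x + y) <= e / (2 * B + 1) * (2 * B)).
      { destruct (Rle_dec (x - y) 0); [assert (0 <= e / (2 * B + 1) * (2 * B)) by nra; nra|].
        apply Rmult_le_compat; lra. }
      assert (e / (2 * B + 1) * (2 * B) <= e).
      { replace e with (e / (2 * B + 1) * (2 * B + 1)) at 2 by (field; lra).
        apply Rmult_le_compat_l; lra. }
      nra.
  - apply rcont_Cmod_sqr, ccont_trig.
  - apply rcont_const.
Qed.

(** * Uniqueness of Fourier coefficients *)

(** The de la Vallée-Poussin kernel [cos (t / 2) ^ (2 N)], left unnormalised: a nonnegative
    trigonometric polynomial that concentrates at 0. *)
Definition kern (N : nat) (t : R) : R := ((1 + cos t) / 2) ^ N.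

Lemma rcont_kern N : rcont (kern N).
Proof. apply rcont_derive; intros t; unfold kern; auto_derive; auto. Qed.

Lemma kern_nonneg N t : 0 <= kern N t.
Proof. apply pow_le; pose proof (COS_bound t); lra. Qed.

(* Integrate the derivative of [sin t * ((1 + cos t) / 2) ^ N] over a period. *)
Lemma rmean_kern_S N : INR (2 * N + 2) * rmean (kern (S N)) = INR (2 * N + 1) * rmean (kern N).
Proof.
  assert (E : rmean (fun t => INR (2 * N + 2) * kern (S N) t - INR (2 * N + 1) * kern N t) = 0).
  { unfold rmean.
    rewrite (is_RInt_unique _ _ _ (minus (sin PI * kern N PI) (sin (- PI) * kern N (- PI)))).
    - rewrite sin_neg, sin_PI; unfold minus, plus, opp; simpl; ring.
    - apply (is_RInt_derive (fun t => sin t * kern N t)).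
      + intros t _; unfold kern; auto_derive; [trivial|].
        rewrite !plus_INR, !mult_INR; simpl (INR 2); simpl (INR 1).
        pose proof (sin2_cos2 t) as Hs; unfold Rsqr in Hs.
        destruct N as [|N]; [simpl; field|].
        simpl pred; rewrite S_INR.
        set (c := cos t) in *; set (s := sin t) in *; set (x := ((1 + c) / 2)) in *.
        assert (Hx : c = 2 * x - 1) by (unfold x; field).
        assert (Hss : s * s = 4 * x * (1 - x)) by nra.
        simpl pow; unfold Rdiv; rewrite ?Rmult_1_l, ?Rplus_0_l.
        change ((1 + c) * / 2) with x; clearbody x.
        match goal with |- ?l = ?r =>
          replace l with (c * (x * x ^ N) - (INR N + 1) / 2 * x ^ N * (s * s)) by field end.
        rewrite Hss, Hx; field.
      + intros t _; apply rcont_minus; apply rcont_mult; try apply rcont_const; apply rcont_kern. }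
  rewrite rmean_minus, !rmean_scal in E; try lra;
    try apply rcont_kern; apply rcont_mult; try apply rcont_const; apply rcont_kern.
Qed.

Lemma rmean_kern_pos N : 0 < rmean (kern N).
Proof.
  induction N as [|N IH].
  - unfold kern; simpl; rewrite rmean_const; lra.
  - pose proof (rmean_kern_S N) as E.
    assert (P1 : 0 < INR (2 * N + 1)) by (apply lt_0_INR; lia).
    assert (P2 : 0 < INR (2 * N + 2)) by (apply lt_0_INR; lia).
    assert (0 < INR (2 * N + 1) * rmean (kern N)) by (apply Rmult_lt_0_compat; auto).
    nra.
Qed.

Lemma cos_eit t : RtoC ((1 + cos t) / 2)
  = (RtoC (1 / 2) + RtoC (1 / 4) * eit (IZR 1 * t) + RtoC (1 / 4) * eit (IZR (-1) * t))%C.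
Proof.
  unfold eit, RtoC, Cplus, Cmult; simpl.
  replace (IZR (-1) * t) with (- (1 * t)) by (simpl; ring).
  rewrite cos_neg, sin_neg, Rmult_1_l; f_equal; field.
Qed.

Lemma kern_orthogonal (g : R -> R) : rcont g ->
  (forall j : Z, cmean (fun t => RtoC (g t) * eit (IZR j * t))%C = RtoC 0) ->
  forall N, rmean (fun t => g t * kern N t) = 0.
Proof.
  intros Hg H.
  (* All frequencies have to be treated at once, since one more factor [(1 + cos t) / 2] mixes [j]
     with [j - 1] and [j + 1]. *)
  assert (K : forall N j, cmean (fun t => RtoC (g t * kern N t) * eit (IZR j * t))%C = RtoC 0).
  { induction N as [|N IH]; intros j.
    - rewrite <- (H j); apply cmean_ext; intros t; unfold kern; simpl; rewrite Rmult_1_r; reflexivity.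
    - set (G := fun i t => (RtoC (g t * kern N t) * eit (IZR i * t))%C).
      assert (HG : forall i, ccont (G i)).
      { intros i; apply ccont_mult; [apply ccont_RtoC, rcont_mult; auto; apply rcont_kern|apply ccont_eit]. }
      assert (Hc : forall (c : CC) i, ccont (fun t => c * G i t)%C)
        by (intros; apply ccont_mult; auto; apply ccont_const).
      rewrite (cmean_ext _ (fun t => (RtoC (1 / 2) * G j t + RtoC (1 / 4) * G (j + 1)%Z t)
                 + RtoC (1 / 4) * G (j + -1)%Z t)%C).
      + rewrite !cmean_plus, !cmean_scal; auto; [|apply ccont_plus; auto].
        unfold G; rewrite !IH; ring.
      + intros t; unfold G, kern; rewrite !plus_IZR, !Rmult_plus_distr_r, !eit_plus.
        rewrite <- tech_pow_Rmult, !RtoC_mult, cos_eit; ring. }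
  intros N; specialize (K N 0%Z); apply (f_equal fst) in K; simpl in K.
  rewrite <- K; apply rmean_ext; intros t; rewrite Rmult_0_l, cos_0, sin_0; ring.
Qed.

Lemma one_minus_cos_pos d : 0 < d <= PI -> forall t, d <= Rabs t -> Rabs t <= PI ->
  1 - cos d <= 1 - cos t.
Proof.
  intros Hd t H1 H2.
  assert (cos (Rabs t) = cos t) as <-.
  { unfold Rabs; destruct Rcase_abs; [apply cos_neg|reflexivity]. }
  pose proof (cos_decr_1 d (Rabs t)); lra.
Qed.

(** Since [g] is orthogonal to the kernel, [g 0] times the mean of the kernel is the mean of
    [(g 0 - g t) * kern N t]. Continuity bounds the difference by [e / 2 + C (1 - cos t)], and the
    recursion [rmean_kern_S] shows that the mean of [1 - cos t] against the normalised kernel is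
    [1 / (N + 1)]. *)
Lemma fourier_unique_at_0 (g : R -> R) : rcont g ->
  (forall j : Z, cmean (fun t => RtoC (g t) * eit (IZR j * t))%C = RtoC 0) -> g 0 = 0.
Proof.
  intros Hg H; pose proof PI_RGT_0 as HPI.
  assert (HM : exists M, forall t, - PI <= t <= PI -> Rabs (g t) <= M).
  { destruct (continuity_ab_maj (fun t => Rabs (g t)) (- PI) PI) as [m [Hm _]]; [lra| |].
    - intros c _; apply (continuity_pt_comp g Rabs).
      + apply continuity_pt_filterlim, Hg.
      + apply Rcontinuity_abs.
    - exists (Rabs (g m)); auto. }
  destruct HM as [M HM].
  assert (HM0 : 0 <= M) by (eapply Rle_trans; [apply Rabs_pos|apply (HM 0); lra]).
  assert (Habs : Rabs (g 0) <= 0).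
  { apply le_epsilon; intros e He; rewrite Rplus_0_l.
    destruct (proj1 (rcont_eps g) Hg 0 (e / 2) ltac:(lra)) as [d0 [Hd0 Kd]].
    set (d := Rmin d0 PI); assert (Hd : 0 < d <= PI).
    { unfold d; split; [apply Rmin_glb_lt; lra|apply Rmin_r]. }
    assert (Hcd : 0 < 1 - cos d).
    { pose proof (cos_decreasing_1 0 d); rewrite cos_0 in *; lra. }
    (* Away from 0, where [|t| >= d], this makes [C (1 - cos t)] at least [2 M], the trivial bound
       for the difference. *)
    set (C := 2 * M / (1 - cos d)).
    assert (HC : 0 <= C) by (unfold C; apply Rmult_le_pos; [lra|left; apply Rinv_0_lt_compat; lra]).
    assert (Hb : forall t, - PI <= t <= PI -> Rabs (g 0 - g t) <= e / 2 + C * (1 - cos t)).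
    { intros t Ht; pose proof (COS_bound t) as Hct.
      destruct (Rlt_dec (Rabs t) d) as [Hlt|Hge].
      - rewrite Rabs_minus_sym; assert (Rabs (g t - g 0) <= e / 2).
        { apply Kd; rewrite Rminus_0_r; pose proof (Rmin_l d0 PI); unfold d in Hlt; lra. }
        nra.
      - assert (1 - cos d <= 1 - cos t).
        { apply one_minus_cos_pos; auto; [lra|apply Rabs_le; lra]. }
        assert (2 * M <= C * (1 - cos t)).
        { unfold C; replace (2 * M) with (2 * M / (1 - cos d) * (1 - cos d)) at 1 by (field; lra).
          apply Rmult_le_compat_l; auto. }
        pose proof (HM 0 ltac:(lra)); pose proof (HM t Ht).
        pose proof (Rabs_triang (g 0) (- g t)); rewrite Rabs_Ropp in *; unfold Rminus; lra. }
    destruct (nfloor_ex (2 * C / e)) as [N [_ HN]];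
      [apply Rmult_le_pos; [lra|left; apply Rinv_0_lt_compat; lra]|].
    assert (O := kern_orthogonal g Hg H N).
    assert (P := rmean_kern_pos N); assert (E := rmean_kern_S N).
    assert (Hk := rcont_kern N); assert (Hk1 := rcont_kern (S N)).
    assert (D : rmean (fun t => (1 - cos t) * kern N t) = 2 * (rmean (kern N) - rmean (kern (S N)))).
    { rewrite <- rmean_minus, <- rmean_scal; auto; [|apply rcont_minus; auto].
      apply rmean_ext; intros t; unfold kern; rewrite <- tech_pow_Rmult; field. }
    assert (Hc : rcont (fun t => (1 - cos t) * kern N t)).
    { apply rcont_mult; auto; apply rcont_derive; intros; auto_derive; auto. }
    assert (B : Rabs (g 0) * rmean (kern N)
                <= e / 2 * rmean (kern N) + C * (2 * (rmean (kern N) - rmean (kern (S N))))).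
    { assert (Hgen : forall s : R, s = 1 \/ s = -1 -> s * g 0 * rmean (kern N)
                <= e / 2 * rmean (kern N) + C * (2 * (rmean (kern N) - rmean (kern (S N))))).
      { intros s Hs; rewrite <- D, <- !rmean_scal, <- rmean_plus; auto;
          try (apply rcont_mult; auto; apply rcont_const).
        apply Rle_trans with (rmean (fun t => s * g 0 * kern N t - s * (g t * kern N t))).
        - rewrite rmean_minus, (rmean_scal s), O; [right; ring| | |];
            repeat apply rcont_mult; auto; apply rcont_const.
        - apply rmean_le.
          + apply rcont_minus; repeat apply rcont_mult; auto; apply rcont_const.
          + apply rcont_plus; apply rcont_mult; auto; apply rcont_const.
          + intros t Ht; specialize (Hb t Ht); pose proof (kern_nonneg N t).
            assert (s * (g 0 - g t) <= Rabs (g 0 - g t)).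
            { destruct Hs as [-> | ->]; unfold Rabs; destruct Rcase_abs; lra. }
            nra. }
      unfold Rabs; destruct Rcase_abs.
      - replace (- g 0) with ((-1) * g 0) by ring; apply Hgen; auto.
      - replace (g 0) with (1 * g 0) by ring; apply Hgen; auto. }
    assert (F : rmean (kern N) - rmean (kern (S N)) = rmean (kern N) / INR (2 * N + 2)).
    { assert (P2 : 0 < INR (2 * N + 2)) by (apply lt_0_INR; lia).
      apply Rmult_eq_reg_l with (INR (2 * N + 2)); [|lra].
      rewrite Rmult_minus_distr_l, E.
      replace (2 * N + 2)%nat with (S (2 * N + 1)) by lia; rewrite S_INR; field.
      pose proof (pos_INR (2 * N + 1)); lra. }
    rewrite F in B.
    assert (P2 : INR (2 * N + 2) = 2 * (INR N + 1)).
    { rewrite plus_INR, mult_INR; simpl; ring. }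
    assert (HN1 : 0 < INR N + 1) by (pose proof (pos_INR N); lra).
    assert (Q : C / (INR N + 1) <= e / 2).
    { apply Rmult_le_reg_r with (INR N + 1); auto.
      unfold Rdiv at 1; rewrite Rmult_assoc, Rinv_l, Rmult_1_r by lra.
      assert (2 * C / e * (e / 2) = C) by (field; lra). nra. }
    assert (B' : Rabs (g 0) * rmean (kern N) <= (e / 2 + C / (INR N + 1)) * rmean (kern N)).
    { eapply Rle_trans; [exact B|]; rewrite P2; right; field; lra. }
    apply Rmult_le_reg_r in B'; auto; lra. }
  destruct (Req_dec (g 0) 0) as [E|E]; [exact E|].
  pose proof (Rabs_pos_lt _ E); lra.
Qed.

(** A translation by [x] multiplies each coefficient by a unimodular factor, so the case of the
    point 0 applies to every translate. *)
Lemma fourier_unique (g : R -> R) : rcont g -> (forall t, g (t + 2 * PI) = g t) ->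
  (forall j : Z, cmean (fun t => RtoC (g t) * eit (IZR j * t))%C = RtoC 0) ->
  forall t, g t = 0.
Proof.
  intros Hg Hp H x.
  assert (Hs : rcont (fun t => g (t + x))).
  { apply (rcont_comp (fun t => t + x) g); auto.
    apply rcont_derive; intros; auto_derive; auto. }
  rewrite <- (Rplus_0_l x); apply (fourier_unique_at_0 (fun t => g (t + x))); auto.
  intros j.
  set (F := fun t => (RtoC (g t) * eit (IZR j * t))%C).
  assert (HF : ccont F) by (apply ccont_mult; [apply ccont_RtoC; auto|apply ccont_eit]).
  rewrite (cmean_ext _ (fun t => eit (- (IZR j * x)) * F (t + x)%R)%C).
  - rewrite cmean_scal.
    + rewrite (cmean_shift F); auto; [unfold F; rewrite H; ring|].
      intros t; unfold F; rewrite Hp, eit_period; reflexivity.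
    + destruct HF as [HF1 HF2]; split;
        [apply (rcont_comp (fun t => t + x) (fun t => fst (F t)))
        |apply (rcont_comp (fun t => t + x) (fun t => snd (F t)))]; auto;
        apply rcont_derive; intros; auto_derive; auto.
  - intros t; unfold F; rewrite Rmult_plus_distr_l, eit_plus.
    replace (eit (- (IZR j * x)) * (RtoC (g (t + x)%R) * (eit (IZR j * t) * eit (IZR j * x))))%C
      with (RtoC (g (t + x)%R) * eit (IZR j * t) * (eit (- (IZR j * x)) * eit (IZR j * x)))%C by ring.
    rewrite <- (eit_plus (- (IZR j * x))), Rplus_opp_l, eit_0; ring.
Qed.

(** * Fourier coefficients of the potential *)

(** Iterated symmetric differences of step [2 h]; the symmetry makes the Fourier multiplier of one
    difference exactly [-2 i sin (m h)] on [rcoef]. *)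
Fixpoint sdiff (n : nat) (h : R) (g : R -> R) (t : R) : R :=
  match n with
  | O => g t
  | S n => sdiff n h g (t + h) - sdiff n h g (t - h)
  end.

Lemma is_derive_sdiff n h (g dg : R -> R) :
  (forall t, is_derive g t (dg t)) ->
  forall t, is_derive (sdiff n h g) t (sdiff n h dg t).
Proof.
  intros H; induction n as [|n IH]; intros t; [apply H|].
  assert (K : forall c, is_derive (fun s => sdiff n h g (s + c)) t (sdiff n h dg (t + c))).
  { intros c; replace (sdiff n h dg (t + c)) with (scal 1 (sdiff n h dg (t + c)))
      by (unfold scal; simpl; unfold mult; simpl; ring).
    apply (is_derive_comp (sdiff n h g) (fun s => s + c)); [apply IH|].
    auto_derive; auto; ring. }
  apply (is_derive_minus _ _ _ _ _ (K h) (K (- h))).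
Qed.

(** The outermost difference is turned into a derivative by the mean value theorem, and the
    induction hypothesis is applied to [Derive V]; hence [V] is quantified inside. The last
    difference uses the Lipschitz bound. *)
Lemma sdiff_bound k : forall (V : R -> R) L,
  (forall j, (j <= k)%nat -> forall t, ex_derive_n V j t) ->
  (forall s t, Rabs (Derive_n V k s - Derive_n V k t) <= L * Rabs (s - t)) ->
  forall h t, 0 <= h -> Rabs (sdiff (S k) h V t) <= L * (2 * h) ^ S k.
Proof.
  induction k as [|k IH]; intros V L HD HL h t Hh.
  - simpl; eapply Rle_trans; [apply (HL (t + h) (t - h))|].
    replace (t + h - (t - h)) with (2 * h) by ring; rewrite Rabs_right by lra; lra.
  - assert (HdV : forall s, is_derive V s (Derive V s)).
    { intros s; apply Derive_correct, (HD 1%nat); lia. }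
    assert (Hn : forall j s, Derive_n (Derive V) j s = Derive_n V (S j) s).
    { intros j s; change (Derive V) with (Derive_n V 1).
      rewrite Derive_n_comp, Nat.add_1_r; reflexivity. }
    assert (B : forall s, Rabs (sdiff (S k) h (Derive V) s) <= L * (2 * h) ^ S k).
    { intros s; apply IH; auto.
      - intros [|j] Hj x; [exact I|].
        apply ex_derive_ext with (Derive_n V (S j)); [intros; symmetry; apply Hn|].
        apply (HD (S (S j))); lia.
      - intros x y; rewrite !Hn; apply HL. }
    assert (HS := is_derive_sdiff (S k) h V (Derive V) HdV).
    change (Rabs (sdiff (S k) h V (t + h) - sdiff (S k) h V (t - h)) <= L * (2 * h) ^ S (S k)).
    destruct (MVT_gen (sdiff (S k) h V) (t - h) (t + h) (sdiff (S k) h (Derive V))) as [c [_ Ec]].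
    + intros; apply HS.
    + intros; apply derivable_continuous_pt, ex_derive_Reals_0; eexists; apply HS.
    + rewrite Ec; replace (t + h - (t - h)) with (2 * h) by ring.
      rewrite Rabs_mult, (Rabs_right (2 * h)) by lra.
      replace (L * (2 * h) ^ S (S k)) with (L * (2 * h) ^ S k * (2 * h)) by (simpl; ring).
      apply Rmult_le_compat_r; [lra|apply B].
Qed.

Lemma rcont_shift (g : R -> R) c : rcont g -> rcont (fun t => g (t + c)).
Proof.
  intros Hg; apply (rcont_comp (fun t => t + c) g); auto.
  apply rcont_derive; intros; auto_derive; auto.
Qed.

Lemma rcont_sdiff n h g : rcont g -> rcont (sdiff n h g).
Proof.
  intros Hg; induction n as [|n IH]; simpl; [exact Hg|].
  apply rcont_minus; apply rcont_shift; auto.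
Qed.

Lemma sdiff_periodic n h g : (forall t, g (t + 2 * PI) = g t) ->
  forall t, sdiff n h g (t + 2 * PI) = sdiff n h g t.
Proof.
  intros Hg; induction n as [|n IH]; intros t; simpl; [apply Hg|].
  rewrite <- (IH (t + h)), <- (IH (t - h)); f_equal; f_equal; ring.
Qed.

Definition rcoef (g : R -> R) (m : nat) : CC := fcoef (fun t => RtoC (g t)) m.

Lemma rcoef_shift (g : R -> R) c m : rcont g -> (forall t, g (t + 2 * PI) = g t) ->
  rcoef (fun t => g (t + c)) m = (eit (- (INR m * c)) * rcoef g m)%C.
Proof.
  intros Hg Hp; unfold rcoef, fcoef.
  set (F := fun t => (RtoC (g t) * Cconj (em m t))%C).
  assert (HF : ccont F) by (apply ccont_fcoef, ccont_RtoC; auto).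
  rewrite <- (cmean_shift F c).
  - rewrite <- cmean_scal.
    + apply cmean_ext; intros t; unfold F; rewrite !em_conj, Rmult_plus_distr_l, eit_plus.
      rewrite <- INR_IZR_INZ.
      replace (eit (- (INR m * c)) * (RtoC (g (t + c)%R) * (eit (INR m * t) * eit (INR m * c))))%C
        with (RtoC (g (t + c)%R) * eit (INR m * t) * (eit (- (INR m * c)) * eit (INR m * c)))%C by ring.
      rewrite <- (eit_plus (- (INR m * c))), Rplus_opp_l, eit_0; ring.
    + destruct HF as [H1 H2]; split;
        [apply (rcont_shift (fun t => fst (F t)))|apply (rcont_shift (fun t => snd (F t)))]; auto.
  - exact HF.
  - intros t; unfold F; rewrite !em_conj, Hp, eit_period; reflexivity.
Qed.

Lemma rcoef_minus (f g : R -> R) m : rcont f -> rcont g ->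
  rcoef (fun t => f t - g t) m = (rcoef f m - rcoef g m)%C.
Proof.
  intros Hf Hg; unfold rcoef, fcoef.
  rewrite <- cmean_minus by (apply ccont_fcoef, ccont_RtoC; auto).
  apply cmean_ext; intros t; rewrite RtoC_minus; ring.
Qed.

Lemma Cmod_rcoef_sdiff n h (g : R -> R) m : rcont g -> (forall t, g (t + 2 * PI) = g t) ->
  Cmod (rcoef (sdiff n h g) m) = (2 * Rabs (sin (INR m * h))) ^ n * Cmod (rcoef g m).
Proof.
  intros Hg Hp; induction n as [|n IH]; [simpl; rewrite Rmult_1_l; reflexivity|].
  change (rcoef (sdiff (S n) h g) m)
    with (rcoef (fun t => sdiff n h g (t + h) - sdiff n h g (t + - h)) m).
  rewrite rcoef_minus, !rcoef_shift
    by (auto using rcont_sdiff, sdiff_periodic, rcont_shift).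
  replace (eit (- (INR m * h)) * rcoef (sdiff n h g) m - eit (- (INR m * - h)) * rcoef (sdiff n h g) m)%C
    with ((eit (- (INR m * h)) - eit (- (INR m * - h))) * rcoef (sdiff n h g) m)%C by ring.
  rewrite Cmod_mult, IH.
  replace (eit (- (INR m * h)) - eit (- (INR m * - h)))%C with (- Ci * RtoC (2 * sin (INR m * h)))%C.
  - rewrite Cmod_mult, Cmod_opp, Cmod_Ci, Cmod_R, Rabs_mult, (Rabs_right 2) by lra.
    simpl; ring.
  - replace (- (INR m * - h)) with (INR m * h) by ring.
    unfold eit, Ci, RtoC, Cminus, Cplus, Copp, Cmult; simpl; rewrite cos_neg, sin_neg; f_equal; ring.
Qed.

Lemma sin_lower x : 0 <= x <= 1 -> x / 2 <= sin x.
Proof.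
  intros Hx; destruct (Req_dec x 0) as [->|Hn]; [rewrite sin_0; lra|].
  destruct (pre_sin_bound x 0) as [H1 _]; [lra|lra|].
  unfold sin_approx, sin_term in H1; simpl in H1.
  assert (x * x * x <= x) by nra.
  lra.
Qed.

(** Bessel's inequality for the difference of order [S k]. Its multiplier is at least [(j h) ^ S k]
    as long as [j h <= 1], and the powers of [h] cancel against those in [sdiff_bound]. Here [k]
    counts the derivatives of [V], one less than in the theorem. *)
Lemma lip_coef_bound k (V : R -> R) L : rcont V -> (forall t, V (t + 2 * PI) = V t) ->
  (forall j, (j <= k)%nat -> forall t, ex_derive_n V j t) ->
  (forall s t, Rabs (Derive_n V k s - Derive_n V k t) <= L * Rabs (s - t)) ->
  forall n, sum_f_R0 (fun j => (INR j ^ S k * Cmod (rcoef V j)) ^ 2) n <= (L * 2 ^ S k) ^ 2.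
Proof.
  intros HV Hp HD HL n.
  (* The step depends on [n] so that [j h <= 1] for all [j <= n]; the final bound does not depend on
     [n]. *)
  set (h := / (INR n + 1)).
  assert (Hn1 : 0 < INR n + 1) by (pose proof (pos_INR n); lra).
  assert (Hh : 0 < h) by (apply Rinv_0_lt_compat; auto).
  assert (HL0 : 0 <= L).
  { specialize (HL 1 0); rewrite Rminus_0_r, Rabs_R1 in HL.
    pose proof (Rabs_pos (Derive_n V k 1 - Derive_n V k 0)); lra. }
  assert (Hc : ccont (fun t => RtoC (sdiff (S k) h V t))) by (apply ccont_RtoC, rcont_sdiff, HV).
  assert (Hb := bessel _ n Hc).
  assert (Hnorm : norm2 (fun t => RtoC (sdiff (S k) h V t)) <= (L * (2 * h) ^ S k) ^ 2).
  { unfold norm2; rewrite <- (rmean_const ((L * (2 * h) ^ S k) ^ 2)).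
    apply rmean_le; [apply rcont_Cmod_sqr, Hc|apply rcont_const|].
    intros t _; rewrite Cmod_R; apply pow_incr; split; [apply Rabs_pos|].
    apply sdiff_bound; auto; lra. }
  apply Rmult_le_reg_l with ((h ^ S k) ^ 2); [apply pow_lt, pow_lt, Hh|].
  rewrite <- sum_scal_l.
  apply Rle_trans with ((L * (2 * h) ^ S k) ^ 2);
    [|right; rewrite !Rpow_mult_distr; ring].
  eapply Rle_trans; [|exact Hnorm]; eapply Rle_trans; [|exact Hb].
  apply sum_Rle; intros j Hj.
  change (fcoef (fun t => RtoC (sdiff (S k) h V t)) j) with (rcoef (sdiff (S k) h V) j).
  rewrite Cmod_rcoef_sdiff by auto.
  rewrite <- Rpow_mult_distr, <- Rmult_assoc, <- Rpow_mult_distr.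
  assert (Hx : 0 <= INR j * h <= 1).
  { split; [apply Rmult_le_pos; [apply pos_INR|lra]|].
    apply Rmult_le_reg_r with (INR n + 1); auto.
    unfold h; rewrite Rmult_assoc, Rinv_l, Rmult_1_r, Rmult_1_l by lra.
    apply le_INR in Hj; lra. }
  assert (Hs := sin_lower _ Hx).
  rewrite (Rmult_comm h).
  apply pow_incr; split.
  - apply Rmult_le_pos; [apply pow_le; lra|apply Cmod_ge_0].
  - apply Rmult_le_compat_r; [apply Cmod_ge_0|].
    apply pow_incr; split; [lra|].
    pose proof (Rle_abs (sin (INR j * h))); lra.
Qed.

Lemma sum_inv_sqr_le n : sum_f_R0 (fun j => / (INR j + 1) ^ 2) n <= 2 - / (INR n + 1).
Proof.
  induction n as [|n IH]; [simpl; lra|].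
  rewrite tech5, S_INR; set (x := INR n + 1) in *.
  assert (Hx : 1 <= x) by (unfold x; pose proof (pos_INR n); lra).
  assert (/ (x + 1) ^ 2 <= / x - / (x + 1)); [|lra].
  apply Rminus_le.
  replace (/ (x + 1) ^ 2 - (/ x - / (x + 1))) with (- (/ (x * (x + 1) ^ 2))) by (field; lra).
  assert (0 < / (x * (x + 1) ^ 2)); [|lra].
  apply Rinv_0_lt_compat, Rmult_lt_0_compat; [lra|apply pow_lt; lra].
Qed.

(** From [|a_j| = (j |a_j|) (1 / j) <= (j |a_j|)^2 + 1 / j^2] and [1 / j^2 <= 4 / (j + 1)^2]; the 8
    is 4 times the bound 2 for the sum of [1 / (j + 1)^2]. The index 0, where the weight vanishes,
    is covered by [a 0 = 0]. *)
Lemma l1_of_weighted k (a : nat -> CC) Q : a O = RtoC 0 ->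
  (forall n, sum_f_R0 (fun j => (INR j ^ S k * Cmod (a j)) ^ 2) n <= Q) -> l1 a (Q + 8).
Proof.
  intros Ha HQ n.
  apply Rle_trans with
    (sum_f_R0 (fun j => (INR j ^ S k * Cmod (a j)) ^ 2 + 4 * / (INR j + 1) ^ 2) n).
  - apply sum_Rle; intros j _.
    pose proof (Cmod_ge_0 (a j)) as P.
    assert (P1 : 0 < / (INR j + 1) ^ 2)
      by (apply Rinv_0_lt_compat, pow_lt; pose proof (pos_INR j); lra).
    destruct j as [|j].
    + rewrite Ha, Cmod_0; pose proof (pow2_ge_0 (INR 0 ^ S k * 0)); lra.
    + set (x := INR (S j)) in *.
      assert (Hx : 1 <= x) by (unfold x; rewrite S_INR; pose proof (pos_INR j); lra).
      assert (Hxk : x <= x ^ S k).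
      { simpl; assert (1 <= x ^ k) by (apply pow_R1_Rle; lra); nra. }
      assert (H1 : (x * Cmod (a (S j))) ^ 2 <= (x ^ S k * Cmod (a (S j))) ^ 2).
      { apply pow_incr; split; [nra|apply Rmult_le_compat_r; auto]. }
      assert (H2 : / x ^ 2 <= 4 * / (x + 1) ^ 2).
      { apply Rmult_le_reg_r with (x ^ 2 * (x + 1) ^ 2); [apply Rmult_lt_0_compat; apply pow_lt; lra|].
        replace (/ x ^ 2 * (x ^ 2 * (x + 1) ^ 2)) with ((x + 1) ^ 2) by (field; lra).
        replace (4 * / (x + 1) ^ 2 * (x ^ 2 * (x + 1) ^ 2)) with (4 * x ^ 2) by (field; lra).
        nra. }
      assert (H3 : Cmod (a (S j)) = (x * Cmod (a (S j))) * / x) by (field; lra).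
      pose proof (pow2_ge_0 (x * Cmod (a (S j)) - / x)) as H4.
      assert (H5 : (/ x) ^ 2 = / x ^ 2) by (field; lra).
      set (y := x * Cmod (a (S j))) in *.
      pose proof (pow2_ge_0 y); pose proof (pow2_ge_0 (/ x)); nra.
  - rewrite plus_sum, sum_scal_l.
    pose proof (sum_inv_sqr_le n); specialize (HQ n).
    assert (0 < / (INR n + 1)) by (apply Rinv_0_lt_compat; pose proof (pos_INR n); lra).
    lra.
Qed.

(* The coefficients of [N (1 / w)]; index [0] is set to [0]. *)
Definition acoef (V : R -> R) (m : nat) : CC :=
  match m with O => RtoC 0 | S _ => rcoef V m end.

Lemma fourier_rcoef (V : R -> R) m : rcont V -> fourier V (- Z.of_nat m) = rcoef V m.
Proof.
  intros HV; unfold fourier; rewrite cmean_RInt.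
  - unfold rcoef, fcoef; apply cmean_ext; intros t; rewrite em_conj, opp_IZR, Ropp_involutive; reflexivity.
  - apply ccont_mult; [apply ccont_RtoC, HV|apply ccont_eit].
Qed.

Lemma rcont_lipschitz (g : R -> R) L :
  (forall s t, Rabs (g s - g t) <= L * Rabs (s - t)) -> rcont g.
Proof.
  intros H; apply rcont_eps; intros t eps He.
  assert (HL : 0 <= L).
  { specialize (H 1 0); rewrite Rminus_0_r, Rabs_R1 in H; pose proof (Rabs_pos (g 1 - g 0)); lra. }
  exists (eps / (L + 1)); split; [apply Rdiv_lt_0_compat; lra|].
  intros s Hs; eapply Rle_trans; [apply H|].
  apply Rle_trans with ((L + 1) * (eps / (L + 1))); [|right; field; lra].
  apply Rmult_le_compat; try lra; apply Rabs_pos.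
Qed.

(** For [k >= 2] continuity comes from the first derivative; for [k = 1] the Lipschitz bound on [V]
    itself provides it. *)
Lemma C_lip_rcont k V : C_lip_periodic k V -> rcont V.
Proof.
  intros (_ & HD & L & HL).
  destruct (le_lt_dec 1 (k - 1)) as [Hk|Hk].
  - apply rcont_derive; intros t; apply (HD 1%nat Hk t).
  - replace (k - 1)%nat with O in HL by lia; apply (rcont_lipschitz V L); exact HL.
Qed.

Lemma acoef_wiener k V : (1 <= k)%nat -> C_lip_periodic k V -> exists B, wiener k (acoef V) B.
Proof.
  intros Hk HV; assert (Hc := C_lip_rcont k V HV); destruct HV as (Hp & HD & L & HL).
  destruct k as [|k]; [lia|]; replace (S k - 1)%nat with k in * by lia.
  set (Q := (L * 2 ^ S k) ^ 2).
  assert (HQ : forall n, sum_f_R0 (fun j => (INR j ^ S k * Cmod (acoef V j)) ^ 2) n <= Q).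
  { intros n; eapply Rle_trans; [|apply (lip_coef_bound k V L Hc Hp HD HL n)].
    right; apply sum_eq; intros [|j] _; [simpl; ring|reflexivity]. }
  assert (H0 : 0 <= Q) by apply pow2_ge_0.
  exists (Q + 8); split; [lra|split].
  - apply (l1_of_weighted k); auto.
  - intros n; eapply Rle_trans; [apply HQ|]; nra.
Qed.

Lemma cmean_real_conj (g : R -> R) (j : Z) : rcont g ->
  cmean (fun t => RtoC (g t) * eit (IZR (- j) * t))%C
  = Cconj (cmean (fun t => RtoC (g t) * eit (IZR j * t))%C).
Proof.
  intros Hg; rewrite <- cmean_conj.
  - apply cmean_ext; intros t; rewrite Cmult_conj, eit_conj, opp_IZR.
    replace (Cconj (RtoC (g t))) with (RtoC (g t)) by (unfold Cconj, RtoC; simpl; f_equal; ring).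
    do 2 f_equal; ring.
  - apply ccont_mult; [apply ccont_RtoC, Hg|apply ccont_eit].
Qed.

Lemma eit_neg_period t : eit (- (t + 2 * PI)) = eit (- t).
Proof.
  pose proof (eit_period (-1) t) as H; replace (IZR (-1)) with (-1) in H by reflexivity.
  replace (- (t + 2 * PI)) with (-1 * (t + 2 * PI)) by ring; rewrite H; f_equal; ring.
Qed.

(** The difference of the two sides is continuous and periodic with vanishing coefficients, so
    [fourier_unique] applies; convergence of the Fourier series of [V] is never discussed. *)
Lemma fourier_inversion V B : rcont V -> (forall t, V (t + 2 * PI) = V t) -> l1 (acoef V) B ->
  forall t, V t = rmean V + 2 * fst (cPS (acoef V) t).
Proof.
  intros HV Hp Ha.
  set (A := cPS (acoef V)).
  assert (HA : ccont A) by apply (ccont_cPS _ B Ha).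
  set (g := fun t => V t - (rmean V + 2 * fst (A t))).
  assert (Hg : rcont g).
  { apply rcont_minus; auto; apply rcont_plus; [apply rcont_const|].
    apply rcont_mult; [apply rcont_const|apply HA]. }
  assert (Hm : forall m : nat, rcoef g m = RtoC 0).
  { intros m; unfold rcoef, fcoef.
    (* Written with [2 Re A = A + conj A]: the part with [conj A] is the conjugate of [A w^m], whose
       mean vanishes because [A] has no constant term. *)
    rewrite (cmean_ext _ (fun t => (RtoC (V t) * Cconj (em m t) - RtoC (rmean V) * Cconj (em m t))
       - (A t * Cconj (em m t) + Cconj (A t * em m t)))%C).
    - assert (HAe : ccont (fun t => A t * em m t)%C) by (apply ccont_mult; auto; apply ccont_em).
      assert (Hem : ccont (fun t => Cconj (em m t))) by (apply ccont_conj, ccont_em).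
      assert (Hr : ccont (fun t => RtoC (rmean V) * Cconj (em m t))%C)
        by (apply ccont_mult; auto; apply ccont_const).
      assert (HVe : ccont (fun t => RtoC (V t) * Cconj (em m t))%C)
        by (apply ccont_fcoef, ccont_RtoC; auto).
      assert (HAf : ccont (fun t => A t * Cconj (em m t))%C) by (apply ccont_fcoef; auto).
      assert (HAc : ccont (fun t => Cconj (A t * em m t))) by (apply ccont_conj; auto).
      rewrite cmean_minus, cmean_minus, cmean_plus, cmean_scal, (cmean_conj (fun t => A t * em m t)%C), cmean_conj;
        auto using ccont_minus, ccont_plus, ccont_em.
      unfold A at 2; rewrite (cmean_cPS_em (acoef V) B); auto.
      change (cmean (fun t => A t * Cconj (em m t))%C) with (fcoef (cPS (acoef V)) m).
      rewrite (fcoef_cPS _ B) by auto.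
      change (cmean (fun t => RtoC (V t) * Cconj (em m t))%C) with (rcoef V m).
      replace (Cconj (RtoC 0)) with (RtoC 0) by (unfold Cconj, RtoC; simpl; f_equal; ring).
      destruct m as [|m]; simpl acoef.
      + replace (cmean (em 0)) with (RtoC 1)
          by (rewrite (cmean_ext _ (fun _ => RtoC 1)) by reflexivity; symmetry; apply cmean_const).
        replace (rcoef V 0) with (RtoC (rmean V)).
        * unfold Cconj, RtoC, Cminus, Cplus, Copp, Cmult; simpl; f_equal; ring.
        * unfold rcoef, fcoef, cmean, RtoC; f_equal.
          -- apply rmean_ext; intros; simpl; ring.
          -- symmetry; transitivity (rmean (fun _ => 0)); [apply rmean_ext; intros; simpl; ring|apply rmean_const].
      + rewrite cmean_em by lia.
        replace (Cconj (RtoC 0)) with (RtoC 0) by (unfold Cconj, RtoC; simpl; f_equal; ring).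
        ring.
    - intros t; unfold g; rewrite Cmult_conj.
      replace (RtoC (V t - (rmean V + 2 * fst (A t)))%R)
        with (RtoC (V t) - RtoC (rmean V) - (A t + Cconj (A t)))%C; [ring|].
      destruct (A t); unfold Cconj, RtoC, Cminus, Cplus, Copp; simpl; f_equal; ring. }
  intros t; assert (Hz : g t = 0); [|unfold g in Hz; lra].
  apply fourier_unique; auto.
  - intros s; unfold g, A, cPS; rewrite Hp, eit_neg_period; reflexivity.
  - assert (Hn : forall m : nat, cmean (fun t => RtoC (g t) * eit (IZR (Z.of_nat m) * t))%C = RtoC 0).
    { intros m; rewrite <- (Hm m); unfold rcoef, fcoef; apply cmean_ext; intros; rewrite em_conj; reflexivity. }
    intros j; destruct (Z.le_gt_cases 0 j) as [Hj|Hj].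
    + replace j with (Z.of_nat (Z.to_nat j)) by lia; apply Hn.
    + replace j with (- Z.of_nat (Z.to_nat (- j)))%Z by lia.
      rewrite cmean_real_conj, Hn by auto; unfold Cconj, RtoC; simpl; f_equal; ring.
Qed.

Lemma PS_eval_opp (a : nat -> CC) B w : l1 a B -> Cmod w <= 1 -> PS (fun j => - a j)%C w = (- PS a w)%C.
Proof.
  intros Ha Hw; apply cser_unique; intros eps He.
  destruct (PS_clim a B w Ha Hw eps He) as [N HN]; exists N; intros n Hn; specialize (HN n Hn).
  rewrite (csum_ext _ (fun j => (- RtoC 1) * (a j * w ^ j))%C) by (intros; ring).
  rewrite csum_scal.
  replace (- RtoC 1 * csum (fun j => a j * w ^ j) n - - PS a w)%C
    with (- (csum (fun j => a j * w ^ j) n - PS a w))%C by ring.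
  rewrite Cmod_opp; exact HN.
Qed.

Lemma wiener_opp k a B : wiener k a B -> wiener k (fun j => - a j)%C B.
Proof.
  intros (H0 & H1 & H2); split; [auto|split]; intros n.
  - eapply Rle_trans; [|apply (H1 n)]; right; apply sum_eq; intros; apply Cmod_opp.
  - eapply Rle_trans; [|apply (H2 n)]; right; apply sum_eq; intros; rewrite Cmod_opp; reflexivity.
Qed.

(** * Termwise differentiation of Laurent series *)

(* If [f z = sum b_m z^-m], then [f' z = sum (dseq b)_m z^-m]. *)
Definition dseq (b : nat -> CC) (m : nat) : CC :=
  match m with O => RtoC 0 | S m => (- RtoC (INR m) * b m)%C end.

(** Convertible to [PS b (/ z)], but studied for [|z| > 1] only, where coefficients of polynomial
    growth are admissible. *)
Definition LS (b : nat -> CC) (z : CC) : CC := cser (fun m => b m * (/ z) ^ m)%C.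

(** The factor [r] on the left avoids the exponent [m - 1] on the right. The remainders [X_m] obey
    [X_(m+1) = w X_m + (m + 1) v^m (w - v)^2]. *)
Lemma pow_taylor_bound (v w : CC) (r : R) m : Cmod v <= r -> Cmod w <= r ->
  Cmod (w ^ S m - v ^ S m - RtoC (INR (S m)) * v ^ m * (w - v)) * r
  <= INR (S m) ^ 2 * r ^ m * Cmod (w - v) ^ 2.
Proof.
  intros Hv Hw; assert (Hr : 0 <= r) by (eapply Rle_trans; [apply Cmod_ge_0|exact Hv]).
  set (d := Cmod (w - v)); assert (Hd : 0 <= d) by apply Cmod_ge_0.
  induction m as [|m IH].
  - replace (w ^ 1 - v ^ 1 - RtoC (INR 1) * v ^ 0 * (w - v))%C with (RtoC 0) by (simpl; ring).
    rewrite Cmod_0; simpl; nra.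
  - set (X := (w ^ S m - v ^ S m - RtoC (INR (S m)) * v ^ m * (w - v))%C) in *.
    replace (w ^ S (S m) - v ^ S (S m) - RtoC (INR (S (S m))) * v ^ S m * (w - v))%C
      with (w * X + RtoC (INR (S m)) * v ^ m * ((w - v) * (w - v)))%C.
    + assert (E : Cmod (RtoC (INR (S m)) * v ^ m * ((w - v) * (w - v)))%C <= INR (S m) * r ^ m * d ^ 2).
      { rewrite !Cmod_mult, Cmod_R, Cmod_pow, Rabs_right by (apply Rle_ge, pos_INR).
        fold d; replace (d ^ 2) with (d * d) by ring.
        apply Rmult_le_compat_r; [nra|]; apply Rmult_le_compat_l; [apply pos_INR|].
        apply pow_incr; split; [apply Cmod_ge_0|exact Hv]. }
      apply Rle_trans with ((r * Cmod X + INR (S m) * r ^ m * d ^ 2) * r).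
      * apply Rmult_le_compat_r; auto.
        eapply Rle_trans; [apply Cmod_triangle|]; apply Rplus_le_compat; auto.
        rewrite Cmod_mult; apply Rmult_le_compat_r; [apply Cmod_ge_0|exact Hw].
      * apply Rle_trans with (r * (INR (S m) ^ 2 * r ^ m * d ^ 2) + INR (S m) * r ^ m * d ^ 2 * r).
        -- replace ((r * Cmod X + INR (S m) * r ^ m * d ^ 2) * r)
             with (r * (Cmod X * r) + INR (S m) * r ^ m * d ^ 2 * r) by ring.
           apply Rplus_le_compat_r, Rmult_le_compat_l; auto.
        -- assert (P : 0 <= r ^ S m * d ^ 2) by (apply Rmult_le_pos; apply pow_le; auto).
           rewrite (S_INR (S m)); set (c := INR (S m)); assert (Hc : 0 <= c) by apply pos_INR.
           apply Rle_trans with ((c ^ 2 + c) * (r ^ S m * d ^ 2)); [right; simpl; ring|].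
           rewrite (Rmult_assoc ((c + 1) ^ 2)); apply Rmult_le_compat_r; [exact P|simpl; lra].
    + rewrite (S_INR (S m)), RtoC_plus; unfold X; simpl Cpow; ring.
Qed.

(** The previous bound at [w = 1/y], [v = 1/z], where [w - v = - w v (y - z)]. Replacing the
    remaining [w] by [v] in the linear term costs a second quadratic error, whence the factor 2. *)
Lemma inv_pow_taylor_bound (y z : CC) (r : R) m : y <> RtoC 0 -> z <> RtoC 0 ->
  r <= 1 -> Cmod (/ y) <= r -> Cmod (/ z) <= r ->
  Cmod ((/ y) ^ m - (/ z) ^ m + RtoC (INR m) * (/ z) ^ S m * (y - z))
  <= 2 * INR m ^ 2 * r ^ m * Cmod (y - z) ^ 2.
Proof.
  intros Hy Hz Hr1 Hyr Hzr.
  assert (Hr : 0 <= r) by (eapply Rle_trans; [apply Cmod_ge_0|exact Hzr]).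
  set (w := (/ y)%C) in *; set (v := (/ z)%C) in *; set (d := Cmod (y - z)).
  assert (Hd : 0 <= d) by apply Cmod_ge_0.
  destruct m as [|m].
  - replace (w ^ 0 - v ^ 0 + RtoC (INR 0) * v ^ 1 * (y - z))%C with (RtoC 0) by (simpl; ring).
    rewrite Cmod_0; simpl; nra.
  - assert (Ewv : (w - v)%C = (- (w * v) * (y - z))%C) by (unfold w, v; field; auto).
    assert (Hwv : Cmod (w - v) <= r * (r * d)).
    { rewrite Ewv, !Cmod_mult, Cmod_opp, Cmod_mult; fold d; rewrite Rmult_assoc.
      apply Rmult_le_compat; auto; try apply Cmod_ge_0.
      - apply Rmult_le_pos; auto; apply Cmod_ge_0.
      - apply Rmult_le_compat_r; auto. }
    assert (T := pow_taylor_bound v w r m Hzr Hyr).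
    set (X := (w ^ S m - v ^ S m - RtoC (INR (S m)) * v ^ m * (w - v))%C) in *.
    replace (w ^ S m - v ^ S m + RtoC (INR (S m)) * v ^ S (S m) * (y - z))%C
      with (X + RtoC (INR (S m)) * v ^ S (S m) * w * ((y - z) * (y - z)))%C.
    + assert (Hr0 : 0 < r).
      { eapply Rlt_le_trans; [|exact Hzr]; unfold v; rewrite Cmod_inv by auto.
        apply Rinv_0_lt_compat, Cmod_gt_0; auto. }
      assert (HX : Cmod X <= INR (S m) ^ 2 * r ^ S m * d ^ 2).
      { apply Rmult_le_reg_r with r; auto.
        eapply Rle_trans; [exact T|].
        apply Rle_trans with (INR (S m) ^ 2 * r ^ m * (r * (r * d)) ^ 2).
        - apply Rmult_le_compat_l; [apply Rmult_le_pos; [apply pow2_ge_0|apply pow_le; auto]|].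
          apply pow_incr; split; [apply Cmod_ge_0|exact Hwv].
        - replace (INR (S m) ^ 2 * r ^ m * (r * (r * d)) ^ 2)
            with ((INR (S m) ^ 2 * r ^ S m * d ^ 2 * r) * r ^ 2) by (simpl; ring).
          rewrite <- (Rmult_1_r (INR (S m) ^ 2 * r ^ S m * d ^ 2 * r)) at 2.
          apply Rmult_le_compat_l; [|nra].
          repeat apply Rmult_le_pos; auto; try (apply pow_le; auto); try apply pos_INR; lra. }
      assert (HY : Cmod (RtoC (INR (S m)) * v ^ S (S m) * w * ((y - z) * (y - z)))%C
                   <= INR (S m) ^ 2 * r ^ S m * d ^ 2).
      { rewrite !Cmod_mult, Cmod_R, Cmod_pow, Rabs_right by (apply Rle_ge, pos_INR).
        fold d; replace (d ^ 2) with (d * d) by ring.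
        apply Rmult_le_compat_r; [nra|].
        assert (H1 : 1 <= INR (S m)) by (rewrite S_INR; pose proof (pos_INR m); lra).
        assert (H2 : Cmod v ^ S (S m) <= r ^ S (S m))
          by (apply pow_incr; split; [apply Cmod_ge_0|auto]).
        assert (H3 : r ^ S (S m) * Cmod w <= r ^ S m).
        { pose proof (pow_le r (S m) Hr); pose proof (Cmod_ge_0 w); simpl (r ^ S (S m)).
          assert (r * Cmod w <= 1) by nra.
          change (r * r ^ S m * Cmod w <= r ^ S m); nra. }
        apply Rle_trans with (INR (S m) * r ^ S m).
        - rewrite Rmult_assoc; apply Rmult_le_compat_l; [lra|].
          eapply Rle_trans; [apply Rmult_le_compat_r; [apply Cmod_ge_0|exact H2]|exact H3].
        - apply Rmult_le_compat_r; [apply pow_le; auto|nra]. }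
      eapply Rle_trans; [apply Cmod_triangle|]; lra.
    + unfold X; rewrite Ewv.
      assert (Ew : w = (v - w * v * (y - z))%C) by (unfold w, v; field; auto).
      transitivity (w ^ S m - v ^ S m + RtoC (INR (S m)) * v ^ m * v * (y - z)
                      * (w + w * v * (y - z)))%C; [simpl Cpow; ring|].
      replace (w + w * v * (y - z))%C with v by (rewrite Ew at 1; ring).
      simpl Cpow; ring.
Qed.

(** The constant is separated from the growth so that all dependence on the degree [n] sits in [C],
    and sums over [m] depend only on [q] and the radius. *)
Definition pbound (b : nat -> CC) (C : R) (q : nat) : Prop :=
  0 <= C /\ forall m, Cmod (b m) <= C * (INR m + 1) ^ q.

Lemma pow_geom_summable (x : R) q : 0 <= x < 1 ->
  exists S, forall n, sum_f_R0 (fun m => (INR m + 1) ^ q * x ^ m) n <= S.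
Proof.
  (* The ratio test below needs nonzero terms. *)
  intros Hx; destruct (Req_dec x 0) as [->|Hx0].
  { exists 1; intros n; destruct n as [|n]; [simpl; rewrite Rplus_0_l, pow1; lra|].
    rewrite decomp_sum by lia; simpl; rewrite Rplus_0_l, pow1.
    rewrite (sum_eq _ (fun _ => 0)) by (intros; ring).
    rewrite sum_cte; lra. }
  set (u := fun m => (INR m + 1) ^ q * x ^ m).
  assert (Hpos : forall m, 0 < u m).
  { intros m; unfold u; apply Rmult_lt_0_compat; apply pow_lt; [pose proof (pos_INR m)|]; lra. }
  assert (Hex : ex_series u).
  { apply ex_series_Rabs, ex_series_DAlembert with x; [lra|intros m; specialize (Hpos m); lra|].
    apply is_lim_seq_ext with (fun m => (1 + / (INR m + 1)) ^ q * x).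
    - intros m; unfold u; rewrite S_INR; pose proof (pos_INR m).
      rewrite Rabs_right.
      + replace (1 + / (INR m + 1)) with ((INR m + 1 + 1) / (INR m + 1)) by (field; lra).
        unfold Rdiv at 1; rewrite Rpow_mult_distr, pow_inv; simpl pow; field; split; apply pow_nonzero; lra.
      + apply Rle_ge, Rlt_le, Rdiv_lt_0_compat.
        * rewrite <- S_INR; apply (Hpos (S m)).
        * apply (Hpos m).
    - assert (H1 : is_lim_seq (fun m => 1 + / (INR m + 1)) 1).
      { replace (Finite 1) with (Rbar_plus 1 0) by (simpl; f_equal; ring).
        apply is_lim_seq_plus'; [apply is_lim_seq_const|].
        apply is_lim_seq_ext with (fun m => / INR (S m)); [intros; rewrite S_INR; reflexivity|].
        apply (is_lim_seq_incr_1 (fun n => / INR n)).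
        replace (Finite 0) with (Rbar_inv p_infty) by reflexivity.
        apply is_lim_seq_inv; [apply is_lim_seq_INR|discriminate]. }
      replace (Finite x) with (Finite (1 * x)) by (f_equal; ring).
      apply is_lim_seq_mult'; [|apply is_lim_seq_const].
      clear - H1; induction q as [|q IH]; simpl; [apply is_lim_seq_const|].
      replace (Finite 1) with (Finite (1 * 1)) by (f_equal; ring).
      apply is_lim_seq_mult'; auto. }
  exists (Series u); intros n.
  apply Series_correct, is_series_sum_f in Hex.
  apply (is_lim_seq_incr_compare _ _ Hex).
  intros m; simpl; specialize (Hpos (S m)); lra.
Qed.

Lemma dseq_pbound b C q : pbound b C q -> pbound (dseq b) C (S q).
Proof.
  intros [HC H]; split; auto; intros [|m]; simpl dseq.
  - rewrite Cmod_0; apply Rmult_le_pos; auto; apply pow_le; pose proof (pos_INR 0); lra.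
  - rewrite Cmod_mult, Cmod_opp, Cmod_R, Rabs_right by (apply Rle_ge, pos_INR).
    specialize (H m); pose proof (pos_INR m) as Hm.
    rewrite S_INR.
    assert (P : 0 <= (INR m + 1) ^ q) by (apply pow_le; lra).
    assert (P2 : (INR m + 1) ^ q <= (INR m + 1 + 1) ^ q) by (apply pow_incr; lra).
    apply Rle_trans with (INR m * (C * (INR m + 1 + 1) ^ q)).
    + apply Rmult_le_compat_l; auto; eapply Rle_trans; [exact H|]; apply Rmult_le_compat_l; auto.
    + simpl; assert (0 <= C * (INR m + 1 + 1) ^ q) by (apply Rmult_le_pos; lra); nra.
Qed.

Lemma LS_term_le b C q m z x : pbound b C q -> Cmod (/ z) <= x ->
  Cmod (b m * (/ z) ^ m)%C <= C * ((INR m + 1) ^ q * x ^ m).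
Proof.
  intros [HC H] Hx; rewrite Cmod_mult, Cmod_pow, <- Rmult_assoc.
  apply Rmult_le_compat; [apply Cmod_ge_0|apply pow_le, Cmod_ge_0|apply H|].
  apply pow_incr; split; [apply Cmod_ge_0|exact Hx].
Qed.

Lemma LS_l1 b C q S z x : pbound b C q -> Cmod (/ z) <= x ->
  (forall n, sum_f_R0 (fun m => (INR m + 1) ^ q * x ^ m) n <= S) ->
  l1 (fun m => b m * (/ z) ^ m)%C (C * S).
Proof.
  intros Hb Hx HS n.
  eapply Rle_trans; [apply sum_Rle; intros; eapply LS_term_le; eauto|].
  rewrite sum_scal_l; apply Rmult_le_compat_l; [apply Hb|apply HS].
Qed.

Lemma Cmod_pos_neq0 (z : CC) : 0 < Cmod z -> z <> RtoC 0.
Proof. intros H E; rewrite E, Cmod_0 in H; lra. Qed.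

Lemma LS_taylor b C q z : pbound b C q -> 1 < Cmod z ->
  exists K d, 0 < d /\ 0 <= K /\ forall y, Cmod (y - z) < d ->
    Cmod (LS b y - LS b z - LS (dseq b) z * (y - z)) <= K * Cmod (y - z) ^ 2.
Proof.
  intros Hb Hz.
  (* A radius halfway between the unit circle and [z]: every [y] closer to [z] than [(|z| - 1) / 2]
     stays outside it, so [x] dominates both [1/y] and [1/z]. *)
  set (s := (1 + Cmod z) / 2); set (x := / s).
  assert (Hs : 1 < s) by (unfold s; lra).
  assert (Hx : 0 <= x < 1).
  { unfold x; split; [left; apply Rinv_0_lt_compat; lra|].
    rewrite <- Rinv_1; apply Rinv_lt_contravar; lra. }
  destruct (pow_geom_summable x (q + 2) Hx) as [S2 HS2].
  destruct (pow_geom_summable x q Hx) as [S0 HS0].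
  destruct (pow_geom_summable x (S q) Hx) as [S1 HS1].
  assert (Hz0 : z <> RtoC 0) by (apply Cmod_pos_neq0; lra).
  assert (Hxz : Cmod (/ z) <= x).
  { rewrite Cmod_inv by auto; unfold x; apply Rinv_le_contravar; unfold s; lra. }
  assert (HS2p : 0 <= S2).
  { eapply Rle_trans; [|apply (HS2 O)]; simpl; rewrite Rplus_0_l, pow1; lra. }
  destruct (Hb) as [HC _].
  exists (2 * C * S2), ((Cmod z - 1) / 2); split; [lra|split; [nra|]].
  intros y Hy.
  assert (Hys : s < Cmod y).
  { unfold s; replace z with (y - (y - z))%C by ring.
    pose proof (Cmod_triangle y (- (y - z))) as Ht; rewrite Cmod_opp in Ht.
    replace (y + - (y - z))%C with z in Ht by ring.
    replace (y - (y - z))%C with z by ring; lra. }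
  assert (Hy0 : y <> RtoC 0) by (apply Cmod_pos_neq0; lra).
  assert (Hxy : Cmod (/ y) <= x).
  { rewrite Cmod_inv by auto; unfold x; apply Rinv_le_contravar; lra. }
  set (d := (y - z)%C).
  pose proof (cser_clim _ _ (LS_l1 b C q S0 y x Hb Hxy HS0)) as L1.
  pose proof (cser_clim _ _ (LS_l1 b C q S0 z x Hb Hxz HS0)) as L2.
  pose proof (cser_clim _ _ (LS_l1 _ C (S q) S1 z x (dseq_pbound b C q Hb) Hxz HS1)) as L3.
  apply (clim_scal d) in L3.
  fold (LS b y) in L1; fold (LS b z) in L2; fold (LS (dseq b) z) in L3.
  (* The partial sum for [dseq] runs to [S n] because [dseq] shifts the index by one. *)
  assert (Hfin : forall n, Cmod (csum (fun m => b m * (/ y) ^ m) n - csum (fun m => b m * (/ z) ^ m) n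
             - d * csum (fun m => dseq b m * (/ z) ^ m) (S n))%C <= 2 * C * S2 * Cmod d ^ 2).
  { intros n; rewrite csum_shift; simpl dseq.
    replace (csum (fun m => b m * (/ y) ^ m) n - csum (fun m => b m * (/ z) ^ m) n
        - d * (RtoC 0 * (/ z) ^ 0 + csum (fun m => - RtoC (INR m) * b m * (/ z) ^ S m) n))%C
      with (csum (fun m => b m * ((/ y) ^ m - (/ z) ^ m + RtoC (INR m) * (/ z) ^ S m * d)) n)%C.
    - eapply Rle_trans; [apply Cmod_csum|].
      apply Rle_trans with (sum_f_R0 (fun m => 2 * C * Cmod d ^ 2 * ((INR m + 1) ^ (q + 2) * x ^ m)) n).
      + apply sum_Rle; intros m _; rewrite Cmod_mult.
        pose proof (inv_pow_taylor_bound y z x m Hy0 Hz0 (Rlt_le _ _ (proj2 Hx)) Hxy Hxz) as T; fold d in T.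
        destruct Hb as [_ Hbm]; specialize (Hbm m).
        eapply Rle_trans; [apply Rmult_le_compat; [apply Cmod_ge_0|apply Cmod_ge_0|exact Hbm|exact T]|].
        rewrite pow_add; pose proof (pos_INR m) as Pm.
        assert (INR m ^ 2 <= (INR m + 1) ^ 2) by (apply pow_incr; lra).
        assert (P1 : 0 <= C * (INR m + 1) ^ q * x ^ m * Cmod d ^ 2).
        { repeat apply Rmult_le_pos; auto; try (apply pow_le; lra); try apply Cmod_ge_0; lra. }
        apply Rle_trans with (2 * (C * (INR m + 1) ^ q * x ^ m * Cmod d ^ 2) * INR m ^ 2); [right; ring|].
        apply Rle_trans with (2 * (C * (INR m + 1) ^ q * x ^ m * Cmod d ^ 2) * (INR m + 1) ^ 2); [|right; ring].
        apply Rmult_le_compat_l; lra.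
      + rewrite sum_scal_l; specialize (HS2 n).
        replace (2 * C * S2 * Cmod d ^ 2) with (2 * C * Cmod d ^ 2 * S2) by ring.
        apply Rmult_le_compat_l; auto.
        pose proof (pow2_ge_0 (Cmod d)); nra.
    - replace (RtoC 0 * (/ z) ^ 0 + csum (fun m => - RtoC (INR m) * b m * (/ z) ^ S m) n)%C
        with (csum (fun m => - RtoC (INR m) * b m * (/ z) ^ S m) n)%C by ring.
      rewrite <- csum_scal, <- !csum_minus; apply csum_ext; intros; ring. }
  replace (LS b y - LS b z - LS (dseq b) z * d)%C
    with (LS b y - (LS b z + d * LS (dseq b) z))%C by ring.
  apply le_epsilon; intros e He.
  destruct (L1 (e / 3) ltac:(lra)) as [N1 K1].
  destruct (L2 (e / 3) ltac:(lra)) as [N2 K2].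
  destruct (L3 (e / 3) ltac:(lra)) as [N3 K3].
  set (n := (N1 + N2 + N3)%nat).
  specialize (K1 n ltac:(lia)); specialize (K2 n ltac:(lia)); specialize (K3 (S n) ltac:(lia)).
  specialize (Hfin n).
  set (A1 := csum (fun m => b m * (/ y) ^ m)%C n) in *.
  set (A2 := csum (fun m => b m * (/ z) ^ m)%C n) in *.
  set (A3 := (d * csum (fun m => dseq b m * (/ z) ^ m) (S n))%C) in *.
  replace (LS b y - (LS b z + d * LS (dseq b) z))%C
    with ((A1 - A2 - A3) + ((- (A1 - LS b y)) + ((A2 - LS b z) + (A3 - d * LS (dseq b) z))))%C by ring.
  eapply Rle_trans; [apply Cmod_triangle|]; apply Rplus_le_compat; [exact Hfin|].
  eapply Rle_trans; [apply Cmod_triangle|]; rewrite Cmod_opp.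
  pose proof (Cmod_triangle (A2 - LS b z) (A3 - d * LS (dseq b) z)); lra.
Qed.

Lemma LS_bound b C q S z x : pbound b C q -> Cmod (/ z) <= x ->
  (forall n, sum_f_R0 (fun m => (INR m + 1) ^ q * x ^ m) n <= S) -> Cmod (LS b z) <= C * S.
Proof. intros Hb Hx HS; apply Cmod_cser_le; eapply LS_l1; eauto. Qed.

Lemma is_derive_C_dist (f : CC -> CC) (z l : CC) :
  is_derive (K := C_AbsRing) (V := C_NormedModule) f z l ->
  forall eps, 0 < eps -> exists d, 0 < d /\ forall y, Cmod (y - z) < d ->
    Cmod (f y - f z - l * (y - z)) <= eps * Cmod (y - z).
Proof.
  intros [_ H] eps He.
  destruct (H z (fun P HP => HP) (mkposreal eps He)) as [d Hd].
  exists d; split; [apply cond_pos|]; intros y Hy.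
  assert (Hball : ball (M := AbsRing_UniformSpace C_AbsRing) z d y) by exact Hy.
  specialize (Hd y Hball); simpl in Hd.
  replace (f y - f z - l * (y - z))%C with (f y - f z - (y - z) * l)%C by ring.
  exact Hd.
Qed.

(** A [deriv_chain] consists of arbitrary functions, known only through [is_derive]; this identifies
    each of them with an explicit series. The two expansions are compared at a single small real
    increment. *)
Lemma is_derive_C_unique (f : CC -> CC) (z l : CC) (F : CC -> CC) K d0 :
  (forall y, 1 < Cmod y -> f y = F y) -> 1 < Cmod z ->
  0 < d0 -> 0 <= K ->
  (forall y, Cmod (y - z) < d0 -> Cmod (F y - F z - l * (y - z)) <= K * Cmod (y - z) ^ 2) ->
  forall l', is_derive (K := C_AbsRing) (V := C_NormedModule) f z l' -> l' = l.
Proof.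
  intros Hf Hz Hd0 HK HF l' Hl'.
  apply C_eq_of_dist; intros eps He.
  destruct (is_derive_C_dist f z l' Hl' (eps / 2) ltac:(lra)) as [d [Hd HD]].
  (* Small enough for both expansions, for [z + h] to stay outside the unit disc, and for
     [K h <= eps / 2]. *)
  set (h := Rmin (Rmin d d0) (Rmin (Cmod z - 1) (eps / (2 * K + 1))) / 2).
  assert (Hq : 0 < eps / (2 * K + 1)) by (apply Rdiv_lt_0_compat; lra).
  assert (Hm : 0 < Rmin (Rmin d d0) (Rmin (Cmod z - 1) (eps / (2 * K + 1)))).
  { repeat apply Rmin_glb_lt; lra. }
  pose proof (Rmin_l (Rmin d d0) (Rmin (Cmod z - 1) (eps / (2 * K + 1)))).
  pose proof (Rmin_r (Rmin d d0) (Rmin (Cmod z - 1) (eps / (2 * K + 1)))).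
  pose proof (Rmin_l d d0); pose proof (Rmin_r d d0).
  pose proof (Rmin_l (Cmod z - 1) (eps / (2 * K + 1))).
  pose proof (Rmin_r (Cmod z - 1) (eps / (2 * K + 1))).
  assert (Hh : 0 < h) by (unfold h; lra).
  assert (Hh1 : h < d /\ h < d0 /\ h < Cmod z - 1 /\ h < eps / (2 * K + 1)) by (unfold h; lra).
  destruct Hh1 as (h1 & h2 & h3 & h4).
  set (y := (z + RtoC h)%C).
  assert (Ey : (y - z)%C = RtoC h) by (unfold y; ring).
  assert (Eh : Cmod (y - z) = h) by (rewrite Ey, Cmod_R, Rabs_right; lra).
  assert (Hy : 1 < Cmod y).
  { pose proof (Cmod_triangle y (- (y - z))) as Ht; rewrite Cmod_opp in Ht.
    replace (y + - (y - z))%C with z in Ht by ring; lra. }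
  specialize (HD y ltac:(lra)); specialize (HF y ltac:(lra)).
  rewrite (Hf y Hy), (Hf z Hz) in HD; rewrite Eh in HD, HF.
  apply Rmult_le_reg_r with h; auto.
  replace (Cmod (l' - l) * h) with (Cmod ((l' - l) * (y - z))) by (rewrite Cmod_mult, Eh; ring).
  replace ((l' - l) * (y - z))%C
    with ((F y - F z - l * (y - z)) - (F y - F z - l' * (y - z)))%C by ring.
  unfold Cminus at 1; eapply Rle_trans; [apply Cmod_triangle|]; rewrite Cmod_opp.
  assert (K * h <= eps / 2).
  { apply Rle_trans with (K * (eps / (2 * K + 1))); [apply Rmult_le_compat_l; lra|].
    apply Rmult_le_reg_r with (2 * K + 1); [lra|].
    replace (K * (eps / (2 * K + 1)) * (2 * K + 1)) with (K * eps) by (field; lra).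
    nra. }
  nra.
Qed.

Lemma iter_dseq_pbound b C q j : pbound b C q -> pbound (Nat.iter j dseq b) C (q + j).
Proof.
  intros Hb; induction j as [|j IH]; [rewrite Nat.add_0_r; exact Hb|].
  rewrite Nat.add_succ_r; apply dseq_pbound, IH.
Qed.

Lemma deriv_chain_LS (f : CC -> CC) p g b C q : deriv_chain f p g -> pbound b C q ->
  (forall z, 1 < Cmod z -> f z = LS b z) ->
  forall j, (j <= p)%nat -> forall z, 1 < Cmod z -> g j z = LS (Nat.iter j dseq b) z.
Proof.
  intros [Hg0 Hg] Hb Hf j; induction j as [|j IH]; intros Hj z Hz.
  - rewrite Hg0; apply Hf, Hz.
  - destruct (LS_taylor _ _ _ z (iter_dseq_pbound b C q j Hb) Hz) as (K & d & Hd & HK & HT).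
    apply (is_derive_C_unique (g j) z _ (LS (Nat.iter j dseq b)) K d); auto.
    intros y Hy; apply IH; auto; lia.
Qed.

(** [S] is chosen before the function and its coefficients, so it can serve all degrees [n] at
    once. *)
Lemma deriv_chain_bound (q p : nat) (rho : R) : 1 < rho ->
  exists S, 0 < S /\ forall f g b C, deriv_chain f p g -> pbound b C q ->
    (forall z, 1 < Cmod z -> f z = LS b z) ->
    forall z, rho <= Cmod z -> Cmod (g p z) <= C * S.
Proof.
  intros Hrho.
  assert (Hx : 0 <= / rho < 1).
  { split; [left; apply Rinv_0_lt_compat; lra|].
    rewrite <- Rinv_1; apply Rinv_lt_contravar; lra. }
  destruct (pow_geom_summable (/ rho) (q + p) Hx) as [S HS].
  exists S; split.
  - eapply Rlt_le_trans; [|apply (HS O)]; simpl; rewrite Rplus_0_l, pow1; lra.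
  - intros f g b C Hg Hb Hf z Hz.
    rewrite (deriv_chain_LS f p g b C q Hg Hb Hf p (le_n _) z) by lra.
    apply (LS_bound _ C (q + p) S z (/ rho)); auto.
    + apply iter_dseq_pbound; auto.
    + rewrite Cmod_inv by (apply Cmod_pos_neq0; lra).
      apply Rinv_le_contravar; lra.
Qed.

(** * Polynomial approximation of the Szego function *)

Lemma l1_minus (a b : nat -> CC) A B : l1 a A -> l1 b B -> l1 (fun j => a j - b j)%C (A + B).
Proof.
  intros Ha Hb n.
  apply Rle_trans with (sum_f_R0 (fun j => Cmod (a j) + Cmod (b j)) n).
  - apply sum_Rle; intros j _; unfold Cminus; rewrite <- (Cmod_opp (b j)); apply Cmod_triangle.
  - rewrite plus_sum; specialize (Ha n); specialize (Hb n); lra.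
Qed.

Lemma PS_eval_minus (a b : nat -> CC) A B w : l1 a A -> l1 b B -> Cmod w <= 1 ->
  PS (fun j => a j - b j)%C w = (PS a w - PS b w)%C.
Proof.
  intros Ha Hb Hw; apply cser_unique; intros eps He.
  destruct (PS_clim a A w Ha Hw (eps / 2) ltac:(lra)) as [N1 K1].
  destruct (PS_clim b B w Hb Hw (eps / 2) ltac:(lra)) as [N2 K2].
  exists (N1 + N2)%nat; intros n Hn.
  specialize (K1 n ltac:(lia)); specialize (K2 n ltac:(lia)).
  rewrite (csum_ext _ (fun j => a j * w ^ j - b j * w ^ j)%C) by (intros; ring).
  rewrite csum_minus.
  match goal with |- Cmod (?x - ?y - (?u - ?v)) <= _ =>
    replace (x - y - (u - v))%C with ((x - u) + (- (y - v)))%C by ring end.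
  eapply Rle_trans; [apply Cmod_triangle|]; rewrite Cmod_opp; lra.
Qed.

Definition trunc (a : nat -> CC) (n j : nat) : CC := if le_dec j n then a j else RtoC 0.

Lemma trunc_le a n j : (j <= n)%nat -> trunc a n j = a j.
Proof. intros H; unfold trunc; destruct le_dec; [reflexivity|lia]. Qed.

Lemma trunc_gt a n j : (n < j)%nat -> trunc a n j = RtoC 0.
Proof. intros H; unfold trunc; destruct le_dec; [lia|reflexivity]. Qed.

Lemma PS_trunc a n w : PS (trunc a n) w = csum (fun j => a j * w ^ j)%C n.
Proof.
  rewrite (PS_finite _ n) by (intros; apply trunc_gt; auto).
  apply csum_ext; intros; rewrite trunc_le; auto.
Qed.

Lemma cPS_trunc a n t : cPS (trunc a n) t = trig a n t.
Proof. unfold cPS; rewrite PS_trunc; reflexivity. Qed.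

(** Since [E D = 1], the function is [(E - E_M) D]. Here [D] is bounded by [Bd], and on the tail
    [j > M] the weight [j ^ (2k)] is at least [(M + 1) ^ (2k)]. *)
Lemma norm2_approx k (d e : nat -> CC) Bd Be M : l1 d Bd -> wiener k e Be ->
  (forall t, (cPS e t * cPS d t)%C = RtoC 1) ->
  norm2 (fun t => RtoC 1 - trig e M t * cPS d t)%C <= (Bd * Be) ^ 2 / (INR M + 1) ^ (2 * k).
Proof.
  intros Hd (HBe & He1 & He2) HED.
  set (r := fun j => (e j - trunc e M j)%C).
  pose proof (l1_finite (trunc e M) M (fun j Hj => trunc_gt e M j Hj)) as Ht.
  assert (Hr : l1 r (Be + sum_f_R0 (fun j => Cmod (trunc e M j)) M)) by (apply l1_minus; auto).
  assert (Hr2 : norm2 (cPS r) <= Be ^ 2 / (INR M + 1) ^ (2 * k)).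
  { apply (norm2_cPS_le r _ _ Hr); intros n.
    assert (HM : 0 < (INR M + 1) ^ (2 * k)) by (apply pow_lt; pose proof (pos_INR M); lra).
    apply Rmult_le_reg_l with ((INR M + 1) ^ (2 * k)); auto.
    replace ((INR M + 1) ^ (2 * k) * (Be ^ 2 / (INR M + 1) ^ (2 * k))) with (Be ^ 2) by (field; lra).
    rewrite <- sum_scal_l; eapply Rle_trans; [|apply (He2 n)].
    apply sum_Rle; intros j _; unfold r; destruct (le_lt_dec j M) as [Hj|Hj].
    - rewrite trunc_le by auto; replace (e j - e j)%C with (RtoC 0) by ring; rewrite Cmod_0.
      replace ((INR M + 1) ^ (2 * k) * 0 ^ 2) with 0 by ring; apply pow2_ge_0.
    - rewrite trunc_gt by auto; replace (e j - RtoC 0)%C with (e j) by ring.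
      rewrite Rpow_mult_distr; apply Rmult_le_compat_r; [apply pow2_ge_0|].
      rewrite <- pow_mult, (Nat.mul_comm k); apply pow_incr.
      apply (le_INR (S M) j) in Hj; rewrite S_INR in Hj; pose proof (pos_INR M); lra. }
  rewrite (norm2_ext _ (fun t => cPS r t * cPS d t)%C).
  - eapply Rle_trans; [apply (norm2_mult_le _ _ Bd)|].
    + apply (ccont_cPS _ _ Hr).
    + apply (ccont_cPS _ _ Hd).
    + intros; apply cPS_bound, Hd.
    + rewrite Rpow_mult_distr; unfold Rdiv; rewrite Rmult_assoc.
      apply Rmult_le_compat_l; [apply pow2_ge_0|exact Hr2].
  - intros t; replace (cPS r t) with (cPS e t - trig e M t)%C.
    + rewrite <- (HED t); ring.
    + rewrite <- cPS_trunc; symmetry; apply (PS_eval_minus _ _ _ _ _ He1 Ht); rewrite Cmod_eit; lra.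
Qed.

(** * The extremal problem *)

(** The alternative [s i = 0] handles the index 0, where no orthogonality is available:
    [extremal_norm] uses it with [m = 0], while [extremal_coef] has [m >= 1]. *)
Lemma orth_trig (f D : R -> CC) (s : nat -> CC) (m N : nat) : ccont f -> ccont D ->
  (forall i, (i <= N)%nat -> s i = RtoC 0 \/
     cmean (fun t => f t * Cconj (em (m + i) t * D t))%C = RtoC 0) ->
  cmean (fun t => f t * Cconj (em m t * trig s N t * D t))%C = RtoC 0.
Proof.
  intros Hf HD H.
  assert (HG : forall i, ccont (fun t => f t * Cconj (em (m + i) t * D t))%C).
  { intros i; apply ccont_mult; auto; apply ccont_conj, ccont_mult; auto; apply ccont_em. }
  rewrite (cmean_ext _ (fun t => csum (fun i => Cconj (s i) * (f t * Cconj (em (m + i) t * D t)))%C N)).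
  - rewrite cmean_csum by (intros; apply ccont_mult; auto; apply ccont_const).
    apply csum_0; intros i Hi; rewrite cmean_scal by auto.
    destruct (H i Hi) as [E|E]; rewrite E; [|ring].
    replace (Cconj (RtoC 0)) with (RtoC 0) by (unfold Cconj, RtoC; simpl; f_equal; ring); ring.
  - intros t; unfold trig.
    replace (em m t * csum (fun j => s j * em j t) N * D t)%C
      with (csum (fun j => s j * (em (m + j) t * D t)) N)%C.
    + rewrite csum_conj, <- csum_scal; apply csum_ext; intros i _; rewrite Cmult_conj; ring.
    + replace (em m t * csum (fun j => s j * em j t) N * D t)%C
        with ((em m t * D t) * csum (fun j => s j * em j t) N)%C by ring.
      rewrite <- csum_scal; apply csum_ext; intros i _; rewrite <- em_mult; ring.
Qed.

(** Pythagoras: with [g = E_n D - 1], the difference [f - g = (q - E_n) D] is orthogonal to [f]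
    because the constant terms agree, so [|f - g|^2 = |g|^2 - |f|^2]. *)
Lemma extremal_norm (D f : R -> CC) (q e : nat -> CC) n : ccont D ->
  (forall t, f t = trig q n t * D t - RtoC 1)%C -> q O = e O ->
  (forall l, (1 <= l <= n)%nat -> cmean (fun t => f t * Cconj (em l t * D t))%C = RtoC 0) ->
  norm2 f <= norm2 (fun t => RtoC 1 - trig e n t * D t)%C.
Proof.
  intros HD Hf Hqe Ho.
  assert (Hfc : ccont f).
  { apply ccont_ext with (fun t => trig q n t * D t - RtoC 1)%C; [auto|].
    apply ccont_minus; [apply ccont_mult; auto; apply ccont_trig|apply ccont_const]. }
  set (g := fun t => (trig e n t * D t - RtoC 1)%C).
  assert (Hg : ccont g).
  { apply ccont_minus; [apply ccont_mult; auto; apply ccont_trig|apply ccont_const]. }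
  replace (norm2 (fun t => RtoC 1 - trig e n t * D t)%C) with (norm2 g).
  2: { apply rmean_ext; intros t; unfold g; rewrite Cmod_sym; reflexivity. }
  assert (Hz := orth_trig f D (fun j => q j - e j)%C 0 n Hfc HD).
  assert (H : norm2 (fun t => f t - g t)%C = norm2 g - norm2 f).
  { rewrite norm2_minus by auto.
    replace (cmean (fun t => f t * Cconj (g t))%C) with (RtoC (norm2 f)); [simpl; ring|].
    rewrite <- cmean_self.
    transitivity (cmean (fun t => f t * Cconj (f t))%C
                  - cmean (fun t => f t * Cconj (em 0 t * trig (fun j => q j - e j) n t * D t))%C)%C.
    - rewrite Hz; [ring|]; intros [|i] Hi; [left; rewrite Hqe; ring|right; apply Ho; lia].
    - rewrite <- cmean_minus.
      + apply cmean_ext; intros t.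
        replace (g t) with (f t - em 0 t * trig (fun j => q j - e j)%C n t * D t)%C.
        * rewrite Cminus_conj; ring.
        * rewrite Hf; unfold g, trig.
          rewrite (csum_ext (fun j => (q j - e j) * em j t)%C (fun j => q j * em j t - e j * em j t)%C)
            by (intros; ring).
          rewrite csum_minus; change (em 0 t) with (RtoC 1); ring.
      + apply ccont_mult; auto; apply ccont_conj; auto.
      + apply ccont_mult; auto; apply ccont_conj, ccont_mult; auto.
        apply ccont_mult; [apply ccont_em|apply ccont_trig]. }
  pose proof (norm2_nonneg _ (ccont_minus _ _ Hfc Hg)) as P; rewrite H in P; lra.
Qed.

Lemma fcoef_bound (f : R -> CC) m : ccont f -> Cmod (fcoef f m) ^ 2 <= norm2 f.
Proof.
  intros Hf; eapply Rle_trans; [apply (cmean_cauchy_schwarz f (em m)); auto; apply ccont_em|].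
  replace (norm2 (em m)) with 1; [lra|].
  symmetry; unfold norm2; transitivity (rmean (fun _ => 1)); [|apply rmean_const].
  apply rmean_ext; intros; rewrite Cmod_em; ring.
Qed.

(** Degree [n - m] is the largest for which [w^m] times the Taylor polynomial keeps its exponents
    within the range [1..n] of orthogonality. *)
Lemma extremal_coef (D f : R -> CC) (e : nat -> CC) n m : ccont D -> ccont f ->
  (forall l, (1 <= l <= n)%nat -> cmean (fun t => f t * Cconj (em l t * D t))%C = RtoC 0) ->
  (1 <= m <= n)%nat ->
  Cmod (fcoef f m) ^ 2 <= norm2 f * norm2 (fun t => RtoC 1 - trig e (n - m) t * D t)%C.
Proof.
  intros HD Hf Ho Hm.
  set (G := fun t => (RtoC 1 - trig e (n - m) t * D t)%C).
  assert (HG : ccont G).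
  { apply ccont_minus; [apply ccont_const|apply ccont_mult; auto; apply ccont_trig]. }
  assert (HGm : ccont (fun t => G t * em m t)%C) by (apply ccont_mult; auto; apply ccont_em).
  replace (fcoef f m) with (cmean (fun t => f t * Cconj (G t * em m t))%C).
  - eapply Rle_trans; [apply cmean_cauchy_schwarz; auto|].
    apply Rmult_le_compat_l; [apply norm2_nonneg; auto|].
    eapply Rle_trans; [apply (norm2_mult_le _ _ 1); auto; [apply ccont_em|]|lra].
    intros; rewrite Cmod_em; lra.
  - unfold fcoef.
    transitivity (cmean (fun t => f t * Cconj (em m t))%C
                  - cmean (fun t => f t * Cconj (em m t * trig e (n - m) t * D t))%C)%C.
    + rewrite <- cmean_minus.
      * apply cmean_ext; intros t; unfold G.
        replace ((RtoC 1 - trig e (n - m) t * D t) * em m t)%C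
          with (em m t - em m t * trig e (n - m) t * D t)%C by ring.
        rewrite Cminus_conj; ring.
      * apply ccont_fcoef; auto.
      * apply ccont_mult; auto; apply ccont_conj, ccont_mult; auto.
        apply ccont_mult; [apply ccont_em|apply ccont_trig].
    + rewrite orth_trig; auto; [ring|].
      intros i Hi; right; apply Ho; lia.
Qed.

(** * Orthogonal polynomials *)

Lemma poly_eval_reversed n (c : nat -> CC) (z : CC) : z <> RtoC 0 ->
  (poly_eval n c z * / cpow z n)%C = csum (fun l => c (n - l)%nat * (/ z) ^ l)%C n.
Proof.
  intros Hz; unfold poly_eval; rewrite csum_sum_n, csum_rev.
  change (cpow z n) with (z ^ n)%C.
  rewrite Cmult_comm, <- csum_scal; apply csum_ext; intros l Hl.
  change (cpow z (n - l)) with (z ^ (n - l))%C.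
  assert (E : (z ^ n = z ^ (n - l) * z ^ l)%C) by (rewrite <- Cpow_add_r; f_equal; lia).
  rewrite E, Cpow_inv by auto; field; split; apply Cpow_nz; auto.
Qed.

Lemma eit_neq0 t : eit t <> RtoC 0.
Proof. apply Cmod_pos_neq0; rewrite Cmod_eit; lra. Qed.

Lemma eit_inv t : (/ eit t)%C = eit (- t).
Proof.
  rewrite <- (Cmult_1_r (/ eit t)), <- eit_0, <- (Rplus_opp_r t), eit_plus, Cmult_assoc, Cinv_l by apply eit_neq0.
  ring.
Qed.

(** On the circle [pi_n(z) conj(z^j) = q(w) z^(n-j)], and [z^(n-j)] is the conjugate of [w^(n-j)].
    Testing against [z^j] with [j < n] thus becomes testing [q] against [w^l] with [1 <= l <= n]. *)
Lemma inner_reversed V n c j : rcont V -> (j <= n)%nat ->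
  inner V (poly_eval n c) (fun z => cpow z j)
  = cmean (fun t => trig (fun l => c (n - l)%nat) n t * Cconj (em (n - j) t) * RtoC (weight V t))%C.
Proof.
  intros HV Hj; unfold inner.
  set (F := fun t => (trig (fun l => c (n - l)%nat) n t * Cconj (em (n - j) t) * RtoC (weight V t))%C).
  assert (E : forall t, F t = (poly_eval n c (eit t) * Cconj (cpow (eit t) j) * RtoC (weight V t))%C).
  { intros t; unfold F; f_equal.
    assert (Ep := poly_eval_reversed n c (eit t) (eit_neq0 t)); rewrite eit_inv in Ep.
    unfold trig, em at 1; rewrite <- Ep.
    change (cpow (eit t) n) with (eit t ^ n)%C; change (cpow (eit t) j) with (eit t ^ j)%C.
    rewrite <- Cpow_inv, eit_inv by apply eit_neq0.
    change (eit (- t) ^ n)%C with (em n t).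
    rewrite Cpow_conj, eit_conj; change (eit (- t) ^ j)%C with (em j t).
    replace n with (j + (n - j))%nat at 2 by lia; rewrite <- em_mult.
    rewrite <- !Cmult_assoc, em_norm; ring. }
  rewrite <- cmean_RInt.
  - f_equal; apply RInt_ext; intros t _; symmetry; apply E.
  - apply ccont_mult; [apply ccont_fcoef, ccont_trig|].
    apply ccont_RtoC; unfold weight; apply (rcont_comp (fun t => - V t) exp); [apply rcont_opp, HV|].
    apply rcont_derive; intros; auto_derive; auto.
Qed.

(** [|e^(-A)|^2 = e^(-2 Re A)], and [2 Re A = V - v0]. *)
Lemma weight_factor V d v0 t : V t = v0 + 2 * fst (cPS (acoef V) t) ->
  cPS d t = cexp (- cPS (acoef V) t) ->
  (cPS d t * Cconj (cPS d t))%C = (RtoC (exp v0) * RtoC (weight V t))%C.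
Proof.
  intros HV Hd; unfold weight; rewrite Hd, HV, <- RtoC_mult, <- exp_plus.
  rewrite <- Cmod2_conj, Cmod_cexp.
  replace (exp (fst (- cPS (acoef V) t)%C) ^ 2)
    with (exp (fst (- cPS (acoef V) t)%C + fst (- cPS (acoef V) t)%C))
    by (rewrite exp_plus; ring).
  do 2 f_equal; simpl; ring.
Qed.

Lemma Nfun_PS V B z : rcont V -> l1 (acoef V) B -> 1 < Cmod z -> Nfun V z = PS (acoef V) (/ z).
Proof.
  intros HV Ha Hz.
  assert (Hz0 : z <> RtoC 0) by (apply Cmod_pos_neq0; lra).
  assert (Hw : Cmod (/ z) <= 1).
  { rewrite Cmod_inv by auto; rewrite <- Rinv_1; apply Rinv_le_contravar; lra. }
  change (Nfun V z) with (cser (fun m => fourier V (- Z.of_nat (S m)) * / cpow z (S m))%C).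
  apply cser_unique; intros eps He.
  destruct (PS_clim _ _ _ Ha Hw eps He) as [N HN]; exists N; intros n Hn.
  (* [Nfun] starts at the first power, whereas [acoef] carries a zero at index 0; hence partial sums
     to [S n] on one side match those to [n] on the other. *)
  specialize (HN (S n) ltac:(lia)); rewrite csum_shift in HN.
  replace (csum (fun m => fourier V (- Z.of_nat (S m)) * / cpow z (S m))%C n)
    with (acoef V 0 * (/ z) ^ 0 + csum (fun j => acoef V (S j) * (/ z) ^ S j) n)%C; auto.
  rewrite (csum_ext (fun m => fourier V (- Z.of_nat (S m)) * / cpow z (S m))%C
             (fun j => acoef V (S j) * (/ z) ^ S j)%C).
  - simpl acoef; ring.
  - intros m _; rewrite fourier_rcoef by auto; change (cpow z (S m)) with (z ^ S m)%C.
    rewrite <- Cpow_inv by auto; reflexivity.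
Qed.

(** For [m <= n] the two-factor bound is used with [n + 1 <= (m + 1) (n - m + 1)]. For [m > n] the
    one-factor bound suffices, as then [n + 1 <= m + 1]. The constant [beta + beta ^ 2] covers both
    cases. *)
Lemma coef_decay (beta x : R) (n m k : nat) : 0 <= beta ->
  0 <= x -> x ^ 2 <= beta ^ 2 / (INR n + 1) ^ (2 * k) ->
  ((m <= n)%nat -> x ^ 2 <= beta ^ 2 / (INR n + 1) ^ (2 * k) * (beta ^ 2 / (INR (n - m) + 1) ^ (2 * k))) ->
  x <= (beta + beta ^ 2) / (INR n + 1) ^ (2 * k) * (INR m + 1) ^ k.
Proof.
  intros Hb Hx H1 H2.
  pose proof (pos_INR n) as Pn; pose proof (pos_INR m) as Pm; pose proof (pos_INR (n - m)) as Pnm.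
  assert (Hk : 0 < (INR n + 1) ^ k) by (apply pow_lt; lra).
  assert (Hm : 0 < (INR m + 1) ^ k) by (apply pow_lt; lra).
  assert (Hnm : 0 < (INR (n - m) + 1) ^ k) by (apply pow_lt; lra).
  assert (E2 : forall y, y ^ (2 * k) = (y ^ k) ^ 2) by (intros; rewrite <- pow_mult; f_equal; lia).
  rewrite !E2 in *.
  set (N := (INR n + 1) ^ k) in *; set (M := (INR m + 1) ^ k) in *;
    set (D := (INR (n - m) + 1) ^ k) in *.
  assert (HN2 : 0 < N ^ 2) by (apply pow_lt; auto).
  assert (sq : forall y, 0 <= y -> x ^ 2 <= y ^ 2 -> x <= y).
  { intros y Hy Hxy; apply Rsqr_incr_0_var; auto; unfold Rsqr; lra. }
  destruct (le_lt_dec m n) as [Hmn|Hmn].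
  - assert (Hprod : N <= M * D).
    { unfold N, M, D; rewrite <- Rpow_mult_distr; apply pow_incr; split; [lra|].
      rewrite minus_INR in * by auto; apply le_INR in Hmn; nra. }
    apply Rle_trans with (beta ^ 2 / (N * D)).
    + apply sq.
      * apply Rmult_le_pos; [apply pow2_ge_0|left; apply Rinv_0_lt_compat; nra].
      * eapply Rle_trans; [apply H2, Hmn|]; right; field; lra.
    + apply Rle_trans with (beta ^ 2 / N ^ 2 * M).
      * apply Rmult_le_reg_r with (N ^ 2 * D); [apply Rmult_lt_0_compat; auto|].
        replace (beta ^ 2 / (N * D) * (N ^ 2 * D)) with (beta ^ 2 * N) by (field; lra).
        replace (beta ^ 2 / N ^ 2 * M * (N ^ 2 * D)) with (beta ^ 2 * (M * D)) by (field; lra).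
        apply Rmult_le_compat_l; [apply pow2_ge_0|exact Hprod].
      * apply Rmult_le_compat_r; [lra|].
        apply Rmult_le_compat_r; [left; apply Rinv_0_lt_compat; auto|lra].
  - assert (HNM : N <= M).
    { unfold N, M; apply pow_incr; split; [lra|]; apply lt_INR in Hmn; lra. }
    apply Rle_trans with (beta / N).
    + apply sq; [apply Rmult_le_pos; [auto|left; apply Rinv_0_lt_compat; auto]|].
      eapply Rle_trans; [exact H1|]; right; field; lra.
    + apply Rle_trans with (beta / N ^ 2 * M).
      * apply Rmult_le_reg_r with (N ^ 2); auto.
        replace (beta / N * N ^ 2) with (beta * N) by (field; lra).
        replace (beta / N ^ 2 * M * N ^ 2) with (beta * M) by (field; lra).
        apply Rmult_le_compat_l; auto.
      * apply Rmult_le_compat_r; [lra|].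
        apply Rmult_le_compat_r; [left; apply Rinv_0_lt_compat; auto|].
        pose proof (pow2_ge_0 beta); lra.
Qed.

(** The Laurent coefficients are the Taylor coefficients of [q D - 1] in [w]; their values on the
    circle are estimated in [L^2], and the same series is then evaluated at [w = 1/z]. *)
Lemma opuc_laurent k V : (1 <= k)%nat -> C_lip_periodic k V ->
  exists C, 0 <= C /\ forall n c, is_monic_OPUC V n c ->
    exists b, pbound b (C / (INR n + 1) ^ (2 * k)) k /\
      forall z, 1 < Cmod z ->
        (poly_eval n c z * / cpow z n * cexp (- Nfun V z) - RtoC 1)%C = LS b z.
Proof.
  intros Hk HV.
  assert (HVc := C_lip_rcont k V HV).
  destruct (acoef_wiener k V Hk HV) as [Ba Ha].
  set (a := acoef V) in *.
  set (a' := fun j => (- a j)%C).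
  assert (Ha' : wiener k a' Ba) by (apply wiener_opp; auto).
  assert (Ha0 : a O = RtoC 0) by reflexivity.
  assert (Ha0' : a' O = RtoC 0) by (unfold a'; rewrite Ha0; ring).
  set (e := exp_coef a); set (d := exp_coef a').
  destruct (wiener_exp_coef k a Ba Ha0 Ha) as [Be He]; fold e in He.
  destruct (wiener_exp_coef k a' Ba Ha0' Ha') as [Bd Hd]; fold d in Hd.
  assert (Ha1 : l1 a Ba) by apply Ha; assert (Hd1 : l1 d Bd) by apply Hd.
  assert (PSd : forall w, Cmod w <= 1 -> PS d w = cexp (- PS a w)).
  { intros w Hw; unfold d; rewrite (PS_exp_coef a' k Ba) by auto.
    unfold a'; rewrite (PS_eval_opp a Ba) by auto; reflexivity. }
  assert (Hun : forall t, Cmod (eit t) <= 1) by (intros; rewrite Cmod_eit; lra).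
  assert (cPSd : forall t, cPS d t = cexp (- cPS a t)) by (intros; apply PSd, Hun).
  assert (HED : forall t, (cPS e t * cPS d t)%C = RtoC 1).
  { intros t; rewrite cPSd; unfold cPS at 1, e; rewrite (PS_exp_coef a k Ba) by auto.
    fold (cPS a t); rewrite <- cexp_plus.
    replace (cPS a t + - cPS a t)%C with (RtoC 0) by ring; apply cexp_0. }
  assert (Hw : forall t, (cPS d t * Cconj (cPS d t))%C = (RtoC (exp (rmean V)) * RtoC (weight V t))%C).
  { intros t; apply (weight_factor V); auto.
    apply (fourier_inversion V Ba); auto; apply HV. }
  assert (HD : ccont (cPS d)) by apply (ccont_cPS _ _ Hd1).
  set (beta := Bd * Be).
  assert (Hbeta : 0 <= beta) by (apply Rmult_le_pos; [apply Hd|apply He]).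
  exists (beta + beta ^ 2); split; [pose proof (pow2_ge_0 beta); lra|].
  intros n c [Hmonic Horth].
  set (q := fun l => c (n - l)%nat).
  (* For [l > n] the natural-number subtraction in [q] yields [c 0], so the sequence must be cut at
     [n] before it is convolved. *)
  pose proof (l1_finite (trunc q n) n (fun j Hj => trunc_gt q n j Hj)) as Hq1.
  set (Bq := sum_f_R0 (fun j => Cmod (trunc q n j)) n) in Hq1.
  set (u := conv (trunc q n) d).
  assert (Hu1 : l1 u (Bq * Bd)) by (apply l1_conv; auto).
  assert (Hdelta : l1 delta0 1) by apply (wiener_delta0 k).
  set (b := fun j => (u j - delta0 j)%C).
  assert (Hb1 : l1 b (Bq * Bd + 1)) by (apply l1_minus; auto).
  assert (PSdelta : forall w, PS delta0 w = RtoC 1).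
  { intros w; rewrite (PS_finite _ 0); [simpl; ring|]; intros [|j] Hj; [lia|reflexivity]. }
  assert (PSb : forall w, Cmod w <= 1 ->
    PS b w = (csum (fun l => q l * w ^ l) n * PS d w - RtoC 1)%C).
  { intros w Hw1; unfold b; rewrite (PS_eval_minus _ _ _ _ _ Hu1 Hdelta Hw1), PSdelta.
    unfold u; rewrite (PS_conv _ _ _ _ _ Hq1 Hd1 Hw1), PS_trunc; reflexivity. }
  exists b; split.
  - set (f := cPS b).
    assert (Ef : forall t, f t = (trig q n t * cPS d t - RtoC 1)%C) by (intros; apply PSb, Hun).
    assert (Hf : ccont f) by apply (ccont_cPS _ _ Hb1).
    assert (Ho : forall l, (1 <= l <= n)%nat ->
              cmean (fun t => f t * Cconj (em l t * cPS d t))%C = RtoC 0).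
    { intros l Hl.
      set (G := fun t => (trig q n t * Cconj (em l t) * RtoC (weight V t))%C).
      assert (HW : rcont (weight V)).
      { unfold weight; apply (rcont_comp (fun t => - V t) exp); [apply rcont_opp, HVc|].
        apply rcont_derive; intros; auto_derive; auto. }
      assert (HG : ccont G).
      { apply ccont_mult; [apply ccont_fcoef, ccont_trig|apply ccont_RtoC, HW]. }
      assert (Hel : ccont (fun t => cPS d t * em l t)%C) by (apply ccont_mult; auto; apply ccont_em).
      (* [f conj(w^l D)] splits into [q conj(w^l) |D|^2], where [|D|^2] is the weight times
         [e^(V_0)], and [- conj(w^l D)]; each part has mean zero. *)
      rewrite (cmean_ext _ (fun t => RtoC (exp (rmean V)) * G t - Cconj (cPS d t * em l t))%C).
      - rewrite cmean_minus, cmean_scal, cmean_conj; auto.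
        + rewrite (cmean_cPS_em d Bd) by (auto; right; lia).
          replace (cmean G) with (RtoC 0).
          * unfold Cconj, RtoC, Cminus, Cplus, Copp, Cmult; simpl; f_equal; ring.
          * rewrite <- (Horth (n - l)%nat) by lia.
            rewrite inner_reversed by (auto; lia).
            replace (n - (n - l))%nat with l by lia; reflexivity.
        + apply ccont_mult; auto; apply ccont_const.
        + apply ccont_conj; auto.
      - intros t; unfold G; rewrite Ef, !Cmult_conj.
        replace (RtoC (exp (rmean V)) * (trig q n t * Cconj (em l t) * RtoC (weight V t)))%C
          with (trig q n t * Cconj (em l t) * (RtoC (exp (rmean V)) * RtoC (weight V t)))%C by ring.
        rewrite <- Hw; ring. }
    assert (Hqe : q O = e O).
    { unfold q, e; rewrite Nat.sub_0_r, Hmonic, exp_coef_0; reflexivity. }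
    assert (Hf2 : norm2 f <= beta ^ 2 / (INR n + 1) ^ (2 * k)).
    { eapply Rle_trans; [apply (extremal_norm (cPS d) f q e n); auto|].
      apply norm2_approx; auto. }
    split.
    { apply Rmult_le_pos; [pose proof (pow2_ge_0 beta); lra|].
      left; apply Rinv_0_lt_compat, pow_lt; pose proof (pos_INR n); lra. }
    intros m; destruct m as [|m].
    (* The coefficient estimate needs [m >= 1]; the constant term vanishes exactly because [q] and
       [D] both have constant term 1. *)
    + replace (b O) with (RtoC 0).
      * rewrite Cmod_0; apply Rmult_le_pos; [|apply pow_le; simpl; lra].
        apply Rmult_le_pos; [pose proof (pow2_ge_0 beta); lra|].
        left; apply Rinv_0_lt_compat, pow_lt; pose proof (pos_INR n); lra.
      * unfold b, u, conv; simpl csum; rewrite trunc_le, Hqe by lia; simpl.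
        unfold e, d; rewrite !exp_coef_0; ring.
    + rewrite <- (fcoef_cPS b _ (S m) Hb1); fold f.
      apply coef_decay; auto; [apply Cmod_ge_0| |].
      * eapply Rle_trans; [apply fcoef_bound; auto|exact Hf2].
      * intros Hmn; eapply Rle_trans; [apply (extremal_coef (cPS d) f e n (S m)); auto; lia|].
        apply Rmult_le_compat; auto; try (apply norm2_nonneg; auto).
        -- apply ccont_minus; [apply ccont_const|apply ccont_mult; auto; apply ccont_trig].
        -- apply norm2_approx; auto.
  - intros z Hz.
    assert (Hz0 : z <> RtoC 0) by (apply Cmod_pos_neq0; lra).
    assert (Hwz : Cmod (/ z) <= 1).
    { rewrite Cmod_inv by auto; rewrite <- Rinv_1; apply Rinv_le_contravar; lra. }
    change (LS b z) with (PS b (/ z)).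
    rewrite PSb, PSd, (Nfun_PS V Ba) by auto.
    rewrite poly_eval_reversed by auto; reflexivity.
Qed.

Theorem theorem3p1 (k : nat) (V : R -> R) (pi : nat -> nat -> CC) :
  (1 <= k)%nat ->
  C_lip_periodic k V ->
  (forall n, is_monic_OPUC V n (pi n)) ->
  forall (p : nat) (rho : R), 1 < rho ->
  exists K : R, 0 < K /\
  exists N0 : nat, forall n : nat, (N0 <= n)%nat ->
    forall g : nat -> CC -> CC,
      deriv_chain
        (fun z => Cminus
           (Cmult (Cmult (poly_eval n (pi n) z) (Cinv (cpow z n)))
                  (cexp (Copp (Nfun V z))))
           (RtoC 1)) p g ->
      forall z : CC, rho <= Cmod z ->
        Cmod (g p z) <= K * ln (INR n) / INR n ^ (2 * k).
Proof.
  intros Hk HV Hpi p rho Hrho.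
  destruct (opuc_laurent k V Hk HV) as [C [HC HL]].
  destruct (deriv_chain_bound k p rho Hrho) as [S [HS HB]].
  (* The summand 1 keeps the constant positive even if [C = 0]. *)
  exists (C * S + 1); split; [nra|].
  (* Since [e <= 3], the logarithm is at least 1 from here on and can simply be inserted. *)
  exists 3%nat; intros n Hn g Hg z Hz.
  destruct (HL n (pi n) (Hpi n)) as [b [Hb Eb]].
  eapply Rle_trans; [apply (HB _ g b _ Hg Hb Eb z Hz)|].
  assert (Hn3 : 3 <= INR n) by (apply le_INR in Hn; simpl in Hn; lra).
  assert (Hln : 1 <= ln (INR n)).
  { rewrite <- (ln_exp 1); apply ln_le; [apply exp_pos|].
    pose proof exp_le_3; lra. }
  assert (Hp0 : 0 < INR n ^ (2 * k)) by (apply pow_lt; lra).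
  assert (Hp1 : / (INR n + 1) ^ (2 * k) <= / INR n ^ (2 * k)).
  { apply Rinv_le_contravar; auto; apply pow_incr; lra. }
  assert (Hp2 : 0 < / INR n ^ (2 * k)) by (apply Rinv_0_lt_compat; auto).
  assert (HCS : 0 <= C * S) by nra.
  unfold Rdiv.
  apply Rle_trans with (C * S * / INR n ^ (2 * k)).
  - replace (C * / (INR n + 1) ^ (2 * k) * S) with (C * S * / (INR n + 1) ^ (2 * k)) by ring.
    apply Rmult_le_compat_l; auto.
  - apply Rmult_le_compat_r; nra.
Qed.
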